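(* Let $T>0$ and suppose that $\Phi$ is of error function-type. Then the function $R(z)=\Phi(z+\bar z)\cdot\mathbf 1_{\Sigma_T}(z)$ satisfies the hard edge Ward equation $$\bar\partial C(z)=R(z)-1-\Delta\log R(z),\qquad z\in\operatorname{Int}\Sigma_T,$$ if and only if there is an interval $I\subset\mathbb{R}$ of positive measure such that $\Phi=H_{I,T}$.
   Context: $\Delta=\partial\bar\partial$ (one quarter of the usual Laplacian), $dA$ is Lebesgue measure on $\mathbb{C}$ divided by $\pi$, and $\Sigma_T=\{z:-T\le\operatorname{Re}z\le T\}$. Let $\gamma(z)=\frac1{\sqrt{2\pi}}e^{-z^2/2}$. A function $\Phi$ is of error function-type if $$\Phi(z)=\gamma*\varphi(z)=\int_{-\infty}^{+\infty}\gamma(z-t)\varphi(t)\,dt$$ for some measurable window function $\varphi$ on $\mathbb{R}$ of moderate increase (a tempered distribution). Hard edge Ward equation: with $G(z,w)=e^{z\bar w-|z|^2/2-|w|^2/2}$, $\Psi(z,w)=\Phi(z+\bar w)$ and $K(z,w)=G(z,w)\Psi(z,w)\mathbf 1_{\Sigma_T}(z)\mathbf 1_{\Sigma_T}(w)$, one has $R(z)=K(z,z)$ and $$C(z)=\int_{\Sigma_T}\frac{B(z,w)}{z-w}\,dA(w),\qquad B(z,w)=\frac{|K(z,w)|^2}{R(z)},\qquad z\in\operatorname{Int}\Sigma_T;$$ satisfying the equation presupposes that $R>0$ in $\operatorname{Int}\Sigma_T$. Put $F_T(z)=\gamma*\mathbf 1_{(-2T,2T)}(z)=\frac1{\sqrt{2\pi}}\int_{-2T}^{2T}e^{-(z-t)^2/2}\,dt$.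 For a Borel set $E\subset\mathbb{R}$, $$H_{E,T}(z)=\gamma*\Big[\frac{\mathbf 1_E}{F_T}\Big](z)=\frac1{\sqrt{2\pi}}\int_E\frac{e^{-(z-t)^2/2}}{F_T(t)}\,dt .$$ The identity $\Phi=H_{I,T}$ is understood on $\{-2T<\operatorname{Re}z<2T\}$, where the integral always converges. *)

(* Defs.v *)
From mathcomp Require Import all_boot all_order all_algebra.
From mathcomp Require Import all_classical all_reals all_analysis.

Set Implicit Arguments.
Unset Strict Implicit.
Unset Printing Implicit Defensive.

Import Order.TTheory GRing.Theory Num.Theory.
Import numFieldNormedType.Exports.
From mathcomp.real_closed Require Import complex.

Local Open Scope classical_set_scope.
Local Open Scope ring_scope.
Local Open Scope complex_scope.

Section ComplexPlane.
Context {R : realType}.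
Implicit Types (z w : R[i]) (f : R[i] -> R[i]).

Definition cexp z : R[i] :=
  (expR (Re z))%:C * (cos (Im z) +i* sin (Im z)).

(* R[i] carries no measurable structure in the libraries, so integrals over a
   subset of C are taken over R * R, through (u, v) |-> u + iv. *)
Definition cintegrable d (X : measurableType d)
    (mu : {measure set X -> \bar R}) (D : set X) (f : X -> R[i]) : Prop :=
  mu.-integrable D (EFin \o (fun x => Re (f x))) /\
  mu.-integrable D (EFin \o (fun x => Im (f x))).

Definition cintegral d (X : measurableType d)
    (mu : {measure set X -> \bar R}) (D : set X) (f : X -> R[i]) : R[i] :=
  Rintegral mu D (fun x => Re (f x)) +i* Rintegral mu D (fun x => Im (f x)).

Definition leb2 : {measure set (measurableTypeR R * measurableTypeR R) -> \bar R} :=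
  (@lebesgue_measure R \x @lebesgue_measure R)%E.

Definition of_pair (p : R * R) : R[i] := p.1 +i* p.2.

Definition dA_integrable (S : set R[i]) f : Prop :=
  cintegrable leb2 (of_pair @^-1` S) (fun p => f (of_pair p)).

Definition dA_integral (S : set R[i]) f : R[i] :=
  (pi^-1)%:C * cintegral leb2 (of_pair @^-1` S) (fun p => f (of_pair p)).

Definition partial_x f z : R[i] :=
  derive1 (fun s : R => Re (f (s +i* Im z))) (Re z)
  +i* derive1 (fun s : R => Im (f (s +i* Im z))) (Re z).

Definition partial_y f z : R[i] :=
  derive1 (fun s : R => Re (f (Re z +i* s))) (Im z)
  +i* derive1 (fun s : R => Im (f (Re z +i* s))) (Im z).

Definition has_partials f z : Prop :=
  [/\ derivable (fun s : R => Re (f (s +i* Im z))) (Re z) 1,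
      derivable (fun s : R => Im (f (s +i* Im z))) (Re z) 1,
      derivable (fun s : R => Re (f (Re z +i* s))) (Im z) 1 &
      derivable (fun s : R => Im (f (Re z +i* s))) (Im z) 1].

Definition d_ f z : R[i] := 2^-1 * (partial_x f z - 'i * partial_y f z).
Definition dbar f z : R[i] := 2^-1 * (partial_x f z + 'i * partial_y f z).
Definition Delta f : R[i] -> R[i] := d_ (dbar f).

End ComplexPlane.

Section ErrorFunctionType.
Context {R : realType}.
Implicit Types (z : R[i]) (phi : R -> R[i]) (Phi : R[i] -> R[i]).

Definition gaussian z : R[i] :=
  ((Num.sqrt (2 * pi))^-1)%:C * cexp (- (z ^+ 2) / 2).

Definition gauss_conv phi z : R[i] :=
  cintegral (@lebesgue_measure R) setT (fun t => gaussian (z - t%:C) * phi t).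

(* phi is a tempered function: it is integrable against some (1 + |t|)^-N.
   This covers every measurable function of at most polynomial growth. *)
Definition moderate_increase phi : Prop :=
  exists N : nat, cintegrable (@lebesgue_measure R) setT
    (fun t => phi t / ((1 + `|t|) ^+ N)%:C).

Definition error_function_type Phi : Prop :=
  exists phi : R -> R[i],
    [/\ measurable_fun setT (fun t => Re (phi t) : R),
        measurable_fun setT (fun t => Im (phi t) : R),
        moderate_increase phi &
        forall z, Phi z = gauss_conv phi z].

Definition F_ (T : R) : R[i] -> R[i] :=
  gauss_conv \1_(`](- (2 * T)), (2 * T)[%classic).

Definition H_ (E : set R) (T : R) : R[i] -> R[i] :=
  gauss_conv (fun t => \1_E t / F_ T t%:C).

End ErrorFunctionType.

Section HardEdgeWard.
Context {R : realType}.
Variables (T : R) (Phi : R[i] -> R[i]).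
Implicit Types z w : R[i].

Definition strip : set R[i] := [set z | - T <= Re z <= T].
Definition Int_strip : set R[i] := [set z | - T < Re z < T].

Definition G z w : R[i] :=
  cexp (z * w^* - `|z| ^+ 2 / 2 - `|w| ^+ 2 / 2).
Definition K z w : R[i] :=
  G z w * Phi (z + w^*) * \1_strip z * \1_strip w.

(* This is K z z, since G z z = 1. *)
Definition one_point z : R[i] := Phi (z + z^*) * \1_strip z.

Definition berezin z w : R[i] := `|K z w| ^+ 2 / one_point z.

Definition cauchy z : R[i] :=
  dA_integral strip (fun w => berezin z w / (z - w)).

(* In R[i] the inequality 0 < a says that a is real and positive; log R is
   then the real logarithm of its real part. The totalised integral and partial
   derivatives are guarded by explicit existence conditions. *)
Definition hard_edge_ward : Prop :=
  (forall z, Int_strip z -> 0 < one_point z) /\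
  forall z, Int_strip z ->
    [/\ dA_integrable strip (fun w => berezin z w / (z - w)),
        has_partials cauchy z &
        dbar cauchy z =
          one_point z - 1 - Delta (fun x => (ln (Re (one_point x)))%:C) z].

End HardEdgeWard.

(* Main.v *)
Require Import Defs.
From HB Require Import structures.
From mathcomp Require Import all_boot all_order all_algebra.
From mathcomp Require Import all_classical all_reals all_analysis.
From mathcomp Require Import measurable_realfun ring lra.

Set Implicit Arguments.
Unset Strict Implicit.
Unset Printing Implicit Defensive.

Import Order.TTheory GRing.Theory Num.Theory.
Import numFieldNormedType.Exports.
From mathcomp.real_closed Require Import complex.

Local Open Scope classical_set_scope.
Local Open Scope ring_scope.

(** Write S = 2T and F = F_T, and let first phi be real, so that R(z) = P(2 Re z)
    with P = gamma * phi on the real line. With z = x + iy, w = u + iv, b = x - u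
    and s = y - v one has |K(z,w)|^2 = exp(-b^2) E(s), where E(s) is the squared
    modulus of the Fourier transform of the window gamma(x + u - t) phi(t). It is
    the superposition, over the pairs (t, t'), of the cosines of s (t - t').

    The Cauchy transform can then be computed. The imaginary part of 1 / (z - w)
    is odd in s and drops out. The real part b / (b^2 + s^2) has the Fourier
    transform pi sgn(b) exp(-|b| |t - t'|) (Rint_cauchyK_cos), so the integral over
    v is explicit (Rint_cauchyK_energy). The factor exp(-b^2 - |b| |t - t'|) that it
    leaves moves the two Gaussians centred at x + u to the centres 2x and 2u
    (gauss_shear), so the integral over u is explicit too (Rint_shear). The outcome
    (Rint_shear_total, cauchyE) is C(z) = M(2x) - Q(2x) / P(2x), where M' = P,
    Q = gamma * (phi W), and W is a primitive of phi F.

    On the other side Delta log R = (N / P)' - 1 with N = gamma * (t phi). Hence the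
    equation reads (Q / P)' = (N / P)' on (-S, S): there is a constant c such that
    gamma * (phi (W - t - c)) vanishes on (-S, S) (ward_equation, ward_defect).

    A function of moderate increase whose Gaussian convolution vanishes on an
    interval is null, because the convolution is a Laplace transform (laplace_uniq).
    So phi (W - t - c) = 0 almost everywhere. Let I be the zero set of
    V = W - t - c. Off I the window phi vanishes, so W is constant and V decreases
    at unit speed; a continuous function with this property cannot return to 0, and
    I is an interval (zero_set_interval). Inside I one has W' = 1, that is
    phi F = 1. Therefore phi = 1_I / F (defect_window). For a complex window the
    positivity of R first forces Im phi = 0, again by uniqueness.

    Conversely phi = 1_I / F makes W - t constant on I (wind_defect). What
    remains is that R > 0 and that the Cauchy transform converges absolutely
    (itg_re_kern, itg_im_kern). The latter rests on the comparison of F with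
    Gaussians (gam_div_FF), which makes the windows bounded and integrable, and on
    a Bessel inequality for E (itg_energy). *)

(** * Real-valued integration *)

Section RealIntegration.
Context d (X : measurableType d) (R : realType).
Variable mu : {measure set X -> \bar R}.
Implicit Types f g h : X -> R.

(** Integrability over the whole space of a real-valued function, which keeps
    the calculus of integrals free of extended reals. *)
Definition itg f : Prop := mu.-integrable setT (EFin \o f).

Lemma itg_measurable f : itg f -> measurable_fun setT f.
Proof. by move=> /measurable_int/measurable_EFinP. Qed.

Lemma itg_le f g : itg g -> measurable_fun setT f ->
  (forall x, `|f x| <= g x) -> itg f.
Proof.
move=> ig mf fg; apply: le_integrable ig => //; first exact/measurable_EFinP.
by move=> x _ /=; rewrite lee_fin (le_trans (fg x))// ler_norm.
Qed.

Lemma itgD f g : itg f -> itg g -> itg (fun x => f x + g x).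
Proof. by move=> hf hg; apply: (integrableD _ hf hg). Qed.

Lemma itgB f g : itg f -> itg g -> itg (fun x => f x - g x).
Proof. by move=> hf hg; apply: (integrableB _ hf hg). Qed.

Lemma itgZl (c : R) f : itg f -> itg (fun x => c * f x).
Proof. by move=> hf; apply: (integrableZl _ c hf). Qed.

Lemma itgN f : itg f -> itg (fun x => - f x).
Proof. by move=> /(itgZl (-1)); congr itg; apply/funext => x; rewrite mulN1r. Qed.

Lemma itg_norm f : itg f -> itg (fun x => `|f x|).
Proof. exact: integrable_norm. Qed.

Lemma itg0 : itg (fun=> 0).
Proof. exact: integrable0. Qed.

Lemma itgMb (C : R) h f : itg f -> measurable_fun setT h ->
  (forall x, `|h x| <= C) -> itg (fun x => h x * f x).
Proof.
move=> hf mh hC; apply: (itg_le (itgZl C (itg_norm hf))) => [|x].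
  by apply: measurable_funM => //; exact: itg_measurable.
by rewrite normrM ler_wpM2r.
Qed.

Lemma itg_ae f g : itg f -> measurable_fun setT g ->
  {ae mu, forall x, f x = g x} -> itg g.
Proof.
move=> /integrableP[mf fi] mg fg; apply/integrableP; split.
  exact/measurable_EFinP.
rewrite (@ae_eq_integral _ _ _ mu setT (fun x => `|(f x)%:E|%E))//.
- by apply: measurableT_comp => //; exact/measurable_EFinP.
- by apply: measurableT_comp.
- by apply: filterS fg => x /= + _ => ->.
Qed.

Lemma eq_itg f g : itg f -> f =1 g -> itg g.
Proof. by move=> + /funext <-. Qed.

Lemma eq_Rint f g : f =1 g -> \int[mu]_x f x = \int[mu]_x g x.
Proof. by move=> /funext ->. Qed.

Lemma ae_Rint f g : itg f -> measurable_fun setT g ->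
  {ae mu, forall x, f x = g x} -> \int[mu]_x f x = \int[mu]_x g x.
Proof.
move=> /itg_measurable mf mg fg; congr fine; apply: ae_eq_integral => //.
- exact/measurable_EFinP.
- exact/measurable_EFinP.
- by apply: filterS fg => x /= + _ => ->.
Qed.

Lemma RintD f g : itg f -> itg g ->
  \int[mu]_x (f x + g x) = \int[mu]_x f x + \int[mu]_x g x.
Proof. by move=> hf hg; rewrite RintegralD. Qed.

Lemma RintB f g : itg f -> itg g ->
  \int[mu]_x (f x - g x) = \int[mu]_x f x - \int[mu]_x g x.
Proof. by move=> hf hg; rewrite RintegralB. Qed.

Lemma RintZl (c : R) f : itg f -> \int[mu]_x (c * f x) = c * \int[mu]_x f x.
Proof. by move=> hf; rewrite RintegralZl. Qed.

Lemma RintN f : itg f -> \int[mu]_x (- f x) = - \int[mu]_x f x.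
Proof.
move=> hf; rewrite -mulN1r -RintZl//.
by apply: eq_Rint => x; rewrite mulN1r.
Qed.

Lemma Rint0 : \int[mu]_x (0 : R) = 0.
Proof. by rewrite /Rintegral integral0. Qed.

Lemma Rint_le f g : itg f -> itg g -> (forall x, f x <= g x) ->
  \int[mu]_x f x <= \int[mu]_x g x.
Proof. by move=> hf hg fg; apply: le_Rintegral. Qed.

Lemma Rint_ge0 f : (forall x, 0 <= f x) -> 0 <= \int[mu]_x f x.
Proof. by move=> f0; apply: Rintegral_ge0. Qed.

Lemma norm_Rint_le f g : itg g -> measurable_fun setT f ->
  (forall x, `|f x| <= g x) -> `|\int[mu]_x f x| <= \int[mu]_x g x.
Proof.
move=> hg mf fg; have hf := itg_le hg mf fg.
by rewrite (le_trans (le_normr_Rintegral _ hf))//; apply: Rint_le => //; apply: itg_norm.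
Qed.

Lemma EFin_Rint f : itg f ->
  (\int[mu]_x (f x)%:E)%E = (\int[mu]_x f x)%:E.
Proof. by move=> hf; rewrite fineK//; exact: integrable_fin_num. Qed.

Lemma Rint_dominated_cvg (u : nat -> X -> R) f g :
  (forall n, measurable_fun setT (u n)) -> measurable_fun setT f ->
  itg g -> (forall n x, `|u n x| <= g x) ->
  {ae mu, forall x, u ^~ x @ \oo --> f x} ->
  \int[mu]_x u n x @[n --> \oo] --> \int[mu]_x f x.
Proof.
move=> mu_ mf hg ug uf.
have [] := @dominated_convergence _ _ _ mu setT measurableT
  (fun n x => (u n x)%:E) (EFin \o f) (EFin \o g) _ _ _ hg _.
- by move=> n; exact/measurable_EFinP.
- exact/measurable_EFinP.
- by apply: filterS uf => x h _; apply: cvg_EFin; [exact: nearW|exact: h].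
- by apply: aeW => x n _; rewrite lee_fin.
by move=> hf _; rewrite EFin_Rint// => /fine_cvg.
Qed.

(** For a nonnegative function integrability can be read off from a bound
    that holds along an increasing limit. *)
Lemma itg_monotone_limit (u : nat -> X -> R) f (C : R) :
  (forall n, itg (u n)) -> (forall n x, 0 <= u n x) ->
  (forall x, {homo u^~ x : n m / (n <= m)%N >-> n <= m}) ->
  (forall x, u ^~ x @ \oo --> f x) ->
  (forall n, \int[mu]_x u n x <= C) ->
  itg f /\ \int[mu]_x f x <= C.
Proof.
move=> hu u0 ndu uf uC.
have f0 x : 0 <= f x.
  by apply: (cvgr_to_ge (uf x)); exact: nearW.
have mf : measurable_fun setT f.
  apply: (measurable_fun_cvg (fun n => itg_measurable (hu n))) => x _.
  exact: uf.
have lim : (\int[mu]_x (u n x)%:E)%E @[n --> \oo] --> (\int[mu]_x (f x)%:E)%E.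
  rewrite [X in _ --> X](_ : _ =
      (\int[mu]_x (limn (fun n => (u n x)%:E)))%E); last first.
    by apply: eq_integral => x _; apply/esym/cvg_lim => //; apply: cvg_EFin; [exact: nearW|exact: uf].
  apply: cvg_monotone_convergence => //.
  - by move=> n; apply/measurable_EFinP; exact: itg_measurable.
  - by move=> n x _; rewrite lee_fin.
  - by move=> x _ n m nm; rewrite lee_fin; exact: ndu.
have leC : (\int[mu]_x (f x)%:E <= C%:E)%E.
  apply: (cvge_to_le lim); apply: nearW => n.
  by rewrite EFin_Rint// lee_fin.
have hf : itg f.
  apply/integrableP; split; first exact/measurable_EFinP.
  apply: le_lt_trans (ltry C); apply: le_trans leC.
  by under eq_integral => x _ do rewrite /= ger0_norm//.
by split => //; rewrite -lee_fin -EFin_Rint.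
Qed.

End RealIntegration.

Section RealFubini.
Context d1 d2 (X : measurableType d1) (Y : measurableType d2) (R : realType).
Variables (m1 : {sigma_finite_measure set X -> \bar R})
          (m2 : {sigma_finite_measure set Y -> \bar R}).
Implicit Types f : X * Y -> R.

(** Integrability in y may fail for some x. The positive and the negative part
    are integrated separately, and the difference is measurable in any case. *)
Lemma measurable_Rint_param f : measurable_fun setT f ->
  measurable_fun setT (fun x => \int[m2]_y f (x, y)).
Proof.
move=> mf; apply: (measurableT_comp (fine_measurable measurableT)).
rewrite (_ : (fun x => _) = (fun x => (\int[m2]_y ((EFin \o f)^\+ (x, y)) -
    \int[m2]_y ((EFin \o f)^\- (x, y)))%E)); last first.
  apply/funext => x; rewrite integralE.
  by congr (_ - _)%E; apply: eq_integral => y _; rewrite ?funeposE ?funenegE.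
have mf' : measurable_fun setT (EFin \o f) by exact/measurable_EFinP.
apply: emeasurable_funB.
- apply: (measurable_fun_fubini_tonelli_F (fun p => ((EFin \o f)^\+ p)%E)) => //.
  exact: measurable_funepos.
- apply: (measurable_fun_fubini_tonelli_F (fun p => ((EFin \o f)^\- p)%E)) => //.
  exact: measurable_funeneg.
Qed.

Lemma itg_section f : itg (m1 \x m2)%E f ->
  {ae m1, forall x, itg m2 (fun y => f (x, y))}.
Proof. by move=> hf; exact: (@ae_integrable1 _ _ _ _ _ m1 m2 _ hf). Qed.

Lemma itg_Rint_section f : itg (m1 \x m2)%E f ->
  itg m1 (fun x => \int[m2]_y f (x, y)).
Proof.
move=> hf; have hF := integrable_fubini_F hf.
have mI := measurable_Rint_param (itg_measurable hf).
apply: le_integrable hF => //; first exact/measurable_EFinP.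
move=> x _; rewrite /= /fubini_F /Rintegral.
by case: (\int[m2]_y _)%E => [r| |] //=; rewrite ?normr0 leey.
Qed.

Lemma Rint_Fubini1 f : itg (m1 \x m2)%E f ->
  \int[(m1 \x m2)%E]_p f p = \int[m1]_x \int[m2]_y f (x, y).
Proof.
move=> hf; apply: EFin_inj; rewrite -!EFin_Rint//; last exact: itg_Rint_section.
rewrite -(integral12_prod_meas1 hf); apply: ae_eq_integral => //.
- exact: measurable_fubini_F hf.
- exact/measurable_EFinP/measurable_Rint_param/itg_measurable/hf.
- apply: filterS (itg_section hf) => x hx _.
  by rewrite /fubini_F /= -EFin_Rint.
Qed.

End RealFubini.

Section RealFubini2.
Context d1 d2 (X : measurableType d1) (Y : measurableType d2) (R : realType).
Variables (m1 : {sigma_finite_measure set X -> \bar R})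
          (m2 : {sigma_finite_measure set Y -> \bar R}).

Lemma itg_swap (f : X * Y -> R) :
  itg (m1 \x m2)%E f -> itg (m2 \x m1)%E (fun p => f (p.2, p.1)).
Proof.
move=> /[dup] hf /integrableP[mf fi].
have mf' : measurable_fun setT (fun p : Y * X => f (p.2, p.1)).
  by apply: (measurableT_comp (itg_measurable hf)); exact: measurable_swap.
apply/integrable12ltyP; first exact/measurable_EFinP.
by have /integrable21ltyP := hf; apply; exact/measurable_EFinP/itg_measurable/hf.
Qed.

Lemma Rint_swap (f : X * Y -> R) : itg (m1 \x m2)%E f ->
  \int[(m2 \x m1)%E]_p f (p.2, p.1) = \int[(m1 \x m2)%E]_p f p.
Proof.
move=> hf; have hs := itg_swap hf.
apply: EFin_inj; rewrite -!EFin_Rint//.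
by rewrite -(integral12_prod_meas1 hs) -(integral21_prod_meas1 hf).
Qed.

Lemma Rint_Fubini (f : X * Y -> R) : itg (m1 \x m2)%E f ->
  \int[m1]_x \int[m2]_y f (x, y) = \int[m2]_y \int[m1]_x f (x, y).
Proof.
move=> hf; rewrite -Rint_Fubini1// -(Rint_swap hf) Rint_Fubini1//.
exact: itg_swap.
Qed.

(** Tonelli's criterion, with a bound h for the inner integrals of the norm. *)
Lemma itg_Tonelli (f : X * Y -> R) (h : X -> R) : measurable_fun setT f ->
  (forall x, itg m2 (fun y => f (x, y))) -> itg m1 h ->
  (forall x, \int[m2]_y `|f (x, y)| <= h x) ->
  itg (m1 \x m2)%E f.
Proof.
move=> mf fs hh fh; apply/integrable12ltyP; first exact/measurable_EFinP.
have /integrableP[mh] := hh; apply: le_lt_trans.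
apply: ge0_le_integral => //.
- by move=> x _; apply: integral_ge0.
- apply: (measurable_fun_fubini_tonelli_F (fun p => `|(f p)%:E|%E)) => //.
  by apply: measurableT_comp => //; exact/measurable_EFinP.
- by apply: measurableT_comp.
- move=> x _.
  by rewrite (EFin_Rint (itg_norm (fs x))) /= lee_fin (le_trans (fh x))// ler_norm.
Qed.

Lemma itg_prod (f : X -> R) (g : Y -> R) : itg m1 f -> itg m2 g ->
  itg (m1 \x m2)%E (fun p => f p.1 * g p.2).
Proof.
move=> hf hg; apply: (@itg_Tonelli _ (fun x => (\int[m2]_y `|g y|) * `|f x|)).
- apply: measurable_funM.
    exact: (measurableT_comp (itg_measurable hf) measurable_fst).
  exact: (measurableT_comp (itg_measurable hg) measurable_snd).
- by move=> x; exact: (itgZl (f x) hg).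
- exact: (itgZl _ (itg_norm hf)).
- move=> x /=; rewrite mulrC -RintZl//; last exact: itg_norm.
  by rewrite le_eqVlt (eq_Rint m2 (fun y => normrM _ _)) eqxx.
Qed.

Lemma Rint_prod (f : X -> R) (g : Y -> R) : itg m1 f -> itg m2 g ->
  \int[(m1 \x m2)%E]_p (f p.1 * g p.2) = (\int[m1]_x f x) * (\int[m2]_y g y).
Proof.
move=> hf hg; rewrite Rint_Fubini1; last exact: itg_prod.
rewrite mulrC -RintZl//; apply: eq_Rint => x /=.
by rewrite RintZl// mulrC.
Qed.

End RealFubini2.

Section ProductMeasure.
Context d d' (X : measurableType d) (Y : measurableType d') (R : realType).
Variables (m1 : {sigma_finite_measure set X -> \bar R})
          (m2 : {sigma_finite_measure set Y -> \bar R}).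

(** The product measure under a name of its own, which carries its
    sigma-finiteness, so that it can in turn be a factor of a product. *)
Definition prodm : set (X * Y)%type -> \bar R := (m1 \x m2)%E.

HB.instance Definition _ := Measure.on prodm.

Lemma prodm_sigma_finite : sigma_finite setT prodm.
Proof.
have /sigma_finiteP[F [FT ndF Foo]] := sigma_finiteT m1.
have /sigma_finiteP[G [GT ndG Goo]] := sigma_finiteT m2.
exists (fun n => F n `*` G n) => [|k].
  rewrite -setXTT FT GT predeqE => -[x y]; split.
    move=> [[n _ Fx] [k _ Gy]]; exists (maxn n k) => //; split.
      have /subsetPset := ndF _ _ (leq_maxl n k); exact.
    have /subsetPset := ndG _ _ (leq_maxr n k); exact.
  by move=> [n _ [Fx Gy]]; split; exists n.
have [mF Fk] := Foo k; have [mG Gk] := Goo k.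
split; first exact: measurableX.
have -> : prodm (F k `*` G k) = (m1 (F k) * m2 (G k))%E by exact: product_measure1E.
by rewrite lte_mul_pinfty// ge0_fin_numE.
Qed.

HB.instance Definition _ := Measure_isSigmaFinite.Build _ _ _ prodm prodm_sigma_finite.

End ProductMeasure.

Notation leb := (@lebesgue_measure _).

Section LebesgueInvariance.
Context {R : realType}.
Implicit Types f : R -> R.

Lemma lebesgue_measureD (r : R) (A : set R) : measurable A ->
  pushforward leb (fun x : measurableTypeR R => x + r : measurableTypeR R) A
  = leb A.
Proof.
move=> mA; apply/esym/lebesgue_measure_unique => //=.
  exact: measurable_funD.
move=> mr _ [[a b]] _ <-.
rewrite /pushforward/= (_ : _ @^-1` _ = `](a - r), (b - r)]%classic); last first.
  by apply/seteqP; split => x /=; rewrite !in_itv/= lerBrDr ltrBlDr.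
rewrite !lebesgue_measure_itv/= !lte_fin ltrD2r.
by case: ifP => // _; rewrite -!EFinB; congr EFin; ring.
Qed.

Section Pushforward.
Variable phi : measurableTypeR R -> measurableTypeR R.
Hypothesis mphi : measurable_fun setT phi.
Hypothesis inv : forall A : set R, measurable A -> pushforward leb phi A = leb A.

Lemma itg_invariant f : itg leb f <-> measurable_fun setT f /\ itg leb (f \o phi).
Proof.
have E g : measurable_fun setT g -> (forall x, 0 <= g x)%E ->
    (\int[leb]_x g x = \int[leb]_x (g (phi x)))%E.
  move=> mg g0.
  transitivity (\int[pushforward leb phi]_x g x)%E.
    by apply: eq_measure_integral => A mA _; apply/esym/inv.
  rewrite (ge0_integral_pushforward mphi) ?preimage_setT//.
split=> [hf|[mf /integrableP[mff fi]]].
  have mf := itg_measurable hf; split => //.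
  move/integrableP: hf => [_ fi]; apply/integrableP; split.
    exact/measurable_EFinP/(measurableT_comp mf).
  move: fi; rewrite E//; apply: measurableT_comp => //.
  exact/measurable_EFinP.
apply/integrableP; split; first exact/measurable_EFinP.
by rewrite E//; apply: measurableT_comp => //; exact/measurable_EFinP.
Qed.

Lemma Rint_invariant f : itg leb f -> \int[leb]_x f (phi x) = \int[leb]_x f x.
Proof.
move=> hf; have [mf hff] := (itg_invariant f).1 hf.
congr fine; apply/esym.
transitivity (\int[pushforward leb phi]_x (f x)%:E)%E.
  by apply: eq_measure_integral => A mA _; apply/esym/inv.
rewrite (integral_pushforward mphi) ?preimage_setT//.
exact/measurable_EFinP.
Qed.

End Pushforward.

Lemma measurable_shift (r : R) : measurable_fun setT (fun x : R => x + r).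
Proof. exact: measurable_funD. Qed.

Lemma itg_shift f (r : R) : itg leb f -> itg leb (fun x => f (x + r)).
Proof.
by move=> /(itg_invariant (measurable_shift r) (@lebesgue_measureD r))[].
Qed.

Lemma Rint_shift f (r : R) : itg leb f ->
  \int[leb]_x f (x + r) = \int[leb]_x f x.
Proof.
exact: (Rint_invariant (measurable_shift r) (@lebesgue_measureD r)).
Qed.

Lemma itg_opp f : itg leb f -> itg leb (fun x => f (- x)).
Proof.
by move=> /(itg_invariant (@oppr_measurable R setT) (@lebesgue_measureN R))[].
Qed.

Lemma Rint_opp f : itg leb f -> \int[leb]_x f (- x) = \int[leb]_x f x.
Proof.
exact: (Rint_invariant (@oppr_measurable R setT) (@lebesgue_measureN R)).
Qed.

Lemma itg_reflect (F : R -> R) y : itg leb F -> itg leb (fun s => F (y - s)).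
Proof.
move=> hF; apply: (eq_itg (itg_opp (itg_shift y hF))) => s.
by rewrite addrC.
Qed.

Lemma Rint_reflect (F : R -> R) y : itg leb F ->
  \int[leb]_s F (y - s) = \int[leb]_s F s.
Proof.
move=> hF; rewrite -(Rint_shift y hF) -(Rint_opp (itg_shift y hF)).
by apply: eq_Rint => s; rewrite addrC.
Qed.

Lemma Rint_odd f : itg leb f -> (forall x, f (- x) = - f x) ->
  \int[leb]_x f x = 0.
Proof.
move=> hf fN; have := Rint_opp hf; rewrite (eq_Rint leb fN) RintN// => /eqP.
by rewrite -subr_eq0 -opprD oppr_eq0 -mulr2n mulrn_eq0/= => /eqP.
Qed.

End LebesgueInvariance.

(** * Integrals on the line: antiderivatives and two Fourier transforms *)

Section Line.
Context {R : realType}.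
Implicit Types (f g F : R -> R) (a b l x y s t : R).

Lemma measurable_cos : measurable_fun setT (@cos R).
Proof. by apply: continuous_measurable_fun; exact: continuous_cos. Qed.

Lemma measurable_sin : measurable_fun setT (@sin R).
Proof. by apply: continuous_measurable_fun; exact: continuous_sin. Qed.

Lemma derive_continuous F f : (forall x, is_derive x 1 F (f x)) -> continuous F.
Proof.
move=> dF x; apply: differentiable_continuous.
by apply/derivable1_diffP; have [] := dF x.
Qed.

Lemma derivable_cont F : (forall x, derivable F x 1) -> continuous F.
Proof. by move=> dF x; exact/differentiable_continuous/derivable1_diffP. Qed.

Lemma cont_comp f g : continuous f -> continuous g -> continuous (fun x => g (f x)).
Proof. by move=> cf cg x; apply: continuous_comp; [exact: cf|exact: cg]. Qed.

Lemma contM f g : continuous f -> continuous g -> continuous (fun x => f x * g x).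
Proof. by move=> cf cg x; apply: cvgM; [exact: cf|exact: cg]. Qed.

Lemma cvg0_squeeze (u v : nat -> R) : (forall n, `|u n| <= v n) ->
  v n @[n --> \oo] --> (0 : R) -> u n @[n --> \oo] --> (0 : R).
Proof.
move=> uv v0; apply: norm_cvg0.
apply: (@squeeze_cvgr _ _ _ _ (cst 0) v) => //; last exact: cvg_cst.
by apply: nearW => n; rewrite normr_ge0 uv.
Qed.

Lemma Rint_indic d (X : measurableType d) (mu : {measure set X -> \bar R})
    (D : set X) (F : X -> R) :
  Rintegral mu D F = \int[mu]_p (\1_D p * F p).
Proof.
rewrite Rintegral_mkcond; apply: eq_Rint => p.
by rewrite patchE indicE; case: ifP => _; rewrite ?mul1r ?mul0r.
Qed.

Lemma itg_indic d (X : measurableType d) (mu : {measure set X -> \bar R})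
    (D : set X) (F : X -> R) : measurable D ->
  mu.-integrable D (EFin \o F) <-> itg mu (fun p => \1_D p * F p).
Proof.
move=> mD; rewrite integrable_mkcond// /itg.
rewrite (_ : (EFin \o F) \_ D = EFin \o (fun p => \1_D p * F p))//.
apply/funext => p; rewrite patchE /= indicE.
by case: ifP => _; rewrite ?mul1r ?mul0r.
Qed.

Lemma itg_indicM (D : set R) f : measurable D -> itg leb f ->
  itg leb (fun x => \1_D x * f x).
Proof.
move=> mD hf; apply: (itgMb (C := 1) hf) => // x.
by rewrite indicE; case: (_ \in _); rewrite ?normr1 ?normr0.
Qed.

Lemma itg_cont_itv f a b : continuous f ->
  itg leb (fun x => \1_`[a, b] x * f x).
Proof.
move=> cf; apply: (itg_indic leb _ _).1 => //.
by apply: continuous_compact_integrable; [exact: segment_compact|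
  exact: continuous_subspaceT].
Qed.

Lemma Rint_FTC f F a b : a <= b -> continuous f ->
  (forall x, is_derive x 1 F (f x)) ->
  \int[leb]_x (\1_`[a, b] x * f x) = F b - F a.
Proof.
move=> ab cf dF; rewrite -(Rint_indic leb).
move: ab; rewrite le_eqVlt => /predU1P[->|ab].
  by rewrite set_itv1 Rintegral_set1 subrr.
rewrite /Rintegral (@continuous_FTC2 _ f F)//.
- exact: continuous_subspaceT.
- split.
  + by move=> x _; have [] := dF x.
  + exact/cvg_at_right_filter/(derive_continuous dF).
  + exact/cvg_at_left_filter/(derive_continuous dF).
- by move=> x _; rewrite derive1E; have [_ ->] := dF x.
Qed.

Lemma indic_itvE a b x : \1_`[a, b] x = (a <= x <= b)%R%:R :> R.
Proof. by rewrite indicE; congr (nat_of_bool _)%:R; apply/idP/idP; rewrite inE/= in_itv. Qed.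

Lemma indic_rayE x : \1_`[0, +oo[ x = (0 <= x)%R%:R :> R.
Proof.
rewrite indicE; congr (nat_of_bool _)%:R; apply/idP/idP; rewrite inE/= in_itv/= andbT//.
Qed.

(** The half-line is exhausted along the integers, which keeps the limits below
   sequential. *)
Lemma indic_ray_cvg f x :
  \1_`[0, n%:R] x * f x @[n --> \oo] --> \1_`[0, +oo[ x * f x.
Proof.
apply: cvg_near_cst; near=> n; rewrite indic_itvE indic_rayE.
have -> : x <= n%:R; last by rewrite andbT.
apply: (le_trans (ler_norm x)).
by near: n; apply: nbhs_infty_ger.
Unshelve. all: end_near. Qed.

Lemma Rint_FTC_ray f F l : continuous f ->
  (forall x, is_derive x 1 F (f x)) ->
  F n%:R @[n --> \oo] --> l ->
  itg leb (fun x => \1_`[0, +oo[ x * f x) ->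
  \int[leb]_x (\1_`[0, +oo[ x * f x) = l - F 0.
Proof.
move=> cf dF Fl hf.
have mf := continuous_measurable_fun cf.
have h1 : \int[leb]_x (\1_`[0, n%:R] x * f x) @[n --> \oo] -->
          \int[leb]_x (\1_`[0, +oo[ x * f x).
  apply: (@Rint_dominated_cvg _ _ _ leb (fun n x => \1_`[0, n%:R] x * f x)
    (fun x => \1_`[0, +oo[ x * f x) (fun x => `|\1_`[0, +oo[ x * f x|)) => //.
  - by move=> n; apply: measurable_funM.
  - exact: itg_measurable hf.
  - exact: itg_norm.
  - move=> n x; rewrite !normrM ler_wpM2r// indic_itvE indic_rayE.
    by rewrite !ger0_norm// ler_nat; case: (0 <= x); case: (x <= _).
  - by apply: aeW => x; exact: indic_ray_cvg.
have h2 : \int[leb]_x (\1_`[0, n%:R] x * f x) @[n --> \oo] --> l - F 0.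
  under eq_cvg => n do rewrite (Rint_FTC (ler0n _ n) cf dF).
  by apply: cvgB => //; exact: cvg_cst.
exact: (cvg_unique _ h1 h2).
Qed.

(** A bounded primitive of a nonnegative function bounds all its partial
    integrals. *)
Lemma itg_ray f F l : continuous f -> (forall x, 0 <= f x) ->
  (forall x, is_derive x 1 F (f x)) -> (forall x, F x <= l) ->
  itg leb (fun x => \1_`[0, +oo[ x * f x).
Proof.
move=> cf f0 dF Fl.
have [] := @itg_monotone_limit _ _ _ leb
  (fun n x => \1_`[0, n%:R] x * f x) (fun x => \1_`[0, +oo[ x * f x) (l - F 0) => //.
- by move=> n; exact: itg_cont_itv.
- by move=> n x; rewrite mulr_ge0.
- move=> x n m nm /=; rewrite ler_wpM2r// !indic_itvE ler_nat.
  have [x0|//] := leP 0 x; have [xn|//] := leP x n%:R.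
  by rewrite (le_trans xn)// ler_nat.
- by move=> x; exact: indic_ray_cvg.
- by move=> n; rewrite (Rint_FTC _ cf dF)// lerD2r.
Qed.

Lemma ae_lebS (P Q : R -> Prop) : (forall x, P x -> Q x) ->
  {ae (@lebesgue_measure R), forall x, P x} ->
  {ae (@lebesgue_measure R), forall x, Q x}.
Proof. exact: (@filterS _ _ (ae_filter_ringOfSetsType (@lebesgue_measure R))). Qed.

Lemma ae_leb2 (P Q : R -> Prop) :
  {ae (@lebesgue_measure R), forall x, P x} ->
  {ae (@lebesgue_measure R), forall x, Q x} ->
  {ae (@lebesgue_measure R), forall x, P x /\ Q x}.
Proof.
exact: (@filterI _ _ (ae_filter_ringOfSetsType (@lebesgue_measure R))).
Qed.

Lemma ae_neq (a : R) : {ae (@lebesgue_measure R), forall x, x != a}.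
Proof.
exists [set a]; split => //; first exact: lebesgue_measure_set1.
by move=> x /= /negP/negPn/eqP.
Qed.

Lemma Rint_even f : measurable_fun setT f -> (forall x, f (- x) = f x) ->
  itg leb (fun x => \1_`[0, +oo[ x * f x) ->
  itg leb f /\ \int[leb]_x f x = 2 * \int[leb]_x (\1_`[0, +oo[ x * f x).
Proof.
move=> mf fN hf; have hN := itg_opp hf; have hD := itgD hf hN.
have E : {ae (@lebesgue_measure R), forall x,
    \1_`[0, +oo[ x * f x + \1_`[0, +oo[ (- x) * f (- x) = f x}.
  apply: ae_lebS (ae_neq 0) => x x0.
  rewrite fN -mulrDl -[RHS]mul1r; congr (_ * _).
  by rewrite !indic_rayE oppr_ge0; case: ltgtP x0 => //= _ _; rewrite ?addr0 ?add0r.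
split; first exact: (itg_ae hD mf E).
rewrite -(ae_Rint hD mf E) RintD//.
by rewrite [X in _ + X](Rint_opp hf) mulr_natl mulr2n.
Qed.

End Line.

Section Poisson.
Context {R : realType}.
Implicit Types (b c e s t q r tau : R).

Lemma measurable_expM (g : R -> R) : measurable_fun setT g ->
  measurable_fun setT (fun x => expR (g x)).
Proof. by move=> mg; exact: (measurableT_comp (@measurable_expR R)). Qed.

Lemma measurable_cosM (g : R -> R) : measurable_fun setT g ->
  measurable_fun setT (fun x => cos (g x)).
Proof. by move=> mg; exact: (measurableT_comp measurable_cos). Qed.

Lemma measurable_mulc c : measurable_fun setT (fun x : R => c * x).
Proof. exact: measurable_funM. Qed.

Lemma sqrD_gt0 b s : 0 < b -> 0 < b ^+ 2 + s ^+ 2.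
Proof. by move=> b0; rewrite ltr_pwDl ?sqr_ge0// exprn_gt0. Qed.

Lemma cvg_expR_natM e : 0 < e -> expR (- e * n%:R) @[n --> \oo] --> (0 : R).
Proof.
move=> e0; rewrite (_ : (fun n : nat => _) = (fun n : nat => expR (- e) ^+ n)).
  by apply: cvg_expr; rewrite ger0_norm ?expR_ge0// -[ltRHS]expR0 ltr_expR oppr_lt0.
by apply/funext => n; rewrite -expRM_natl mulr_natr mulr_natl.
Qed.

Lemma is_derive_expcos e tau s : 0 < e ->
  is_derive s 1 (fun s => expR (- e * s) *
    (tau * sin (tau * s) - e * cos (tau * s)) / (e ^+ 2 + tau ^+ 2))
    (expR (- e * s) * cos (tau * s)).
Proof.
move=> e0; apply: is_derive_eq.
have h : e ^+ 2 + tau ^+ 2 != 0 by rewrite gt_eqF// sqrD_gt0.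
by rewrite /GRing.scale/=; field.
Qed.

Lemma is_derive_expN e s : 0 < e ->
  is_derive s 1 (fun s => - expR (- e * s) / e) (expR (- e * s)).
Proof.
by move=> e0; apply: is_derive_eq; rewrite /GRing.scale/=; field; rewrite gt_eqF.
Qed.

Lemma is_derive_atan_scale b s : 0 < b ->
  is_derive s 1 (fun s => atan (s / b)) (b / (b ^+ 2 + s ^+ 2)).
Proof.
move=> b0; apply: is_derive_eq.
have h : b ^+ 2 + s ^+ 2 != 0 by rewrite gt_eqF// sqrD_gt0.
by rewrite /GRing.scale/=; field; rewrite h gt_eqF.
Qed.

Lemma continuous_expN e : continuous (fun s => expR (- e * s)).
Proof.
by apply: (@derive_continuous _ _ (fun s => - e * expR (- e * s))) => s;
  apply: is_derive_eq; rewrite /GRing.scale/= mulr1 mulrC.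
Qed.

Lemma measurable_expN e : measurable_fun setT (fun s => expR (- e * `|s|)).
Proof.
exact: (measurable_expM (measurableT_comp (measurable_mulc (- e))
  (@normr_measurable R setT))).
Qed.

Lemma itg_expN e : 0 < e -> itg leb (fun s => expR (- e * `|s|)).
Proof.
move=> e0.
have h : itg leb (fun s => \1_`[0, +oo[ s * expR (- e * s)).
  apply: (@itg_ray _ _ _ 0 (@continuous_expN e)) => [s|s|s].
  - exact: expR_ge0.
  - exact: is_derive_expN.
  - by rewrite pmulr_lle0 ?invr_gt0// oppr_le0 expR_ge0.
have [] // := @Rint_even _ (fun s => expR (- e * `|s|)).
- exact: measurable_expN.
- by move=> s; rewrite normrN.
- apply: (eq_itg h) => s; rewrite indic_rayE.
  by have [s0|s0] := leP 0 s; rewrite ?mul0r// ger0_norm.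
Qed.

Lemma itg_expN_cos e tau : 0 < e ->
  itg leb (fun s => expR (- e * `|s|) * cos (tau * s)).
Proof.
move=> e0; apply: (itg_le (itg_expN e0)) => [|s].
  by apply: measurable_funM; [exact: measurable_expN|exact: measurable_cosM].
by rewrite normrM ger0_norm ?expR_ge0// ler_piMr ?expR_ge0// cos_max.
Qed.

Lemma Rint_expN_cos e tau : 0 < e ->
  \int[leb]_s (expR (- e * `|s|) * cos (tau * s)) = 2 * e / (e ^+ 2 + tau ^+ 2).
Proof.
move=> e0; set f := fun s => _.
have hf : itg leb f by exact: itg_expN_cos.
have h1 : (fun s => \1_`[0, +oo[ s * f s) =
          (fun s => \1_`[0, +oo[ s * (expR (- e * s) * cos (tau * s))).
  apply/funext => s; rewrite indic_rayE /f.
  by have [s0|s0] := leP 0 s; rewrite ?mul0r// ger0_norm.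
have fN s : f (- s) = f s by rewrite /f normrN mulrN cosN.
have hray : itg leb (fun s => \1_`[0, +oo[ s * f s) by exact: itg_indicM.
have [_ ->] := Rint_even (itg_measurable hf) fN hray.
rewrite h1 in hray *.
rewrite (@Rint_FTC_ray _ _ _ 0 _ (fun s => is_derive_expcos tau s e0))//.
- by rewrite !mulr0 expR0 sin0 cos0; field;
    rewrite gt_eqF// sqrD_gt0.
- by apply: derivable_cont => s; exact: ex_derive.
- apply: (cvg0_squeeze (v := fun n => (`|tau| + e) / (e ^+ 2 + tau ^+ 2) *
      expR (- e * n%:R))) => [n|]; last first.
    by rewrite -[X in _ --> X](mulr0 ((`|tau| + e) / (e ^+ 2 + tau ^+ 2)));
      apply: cvgMr; exact: cvg_expR_natM.
  rewrite -mulrA mulrC normrM (ger0_norm (expR_ge0 _)) ler_wpM2r ?expR_ge0//.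
  have D0 : 0 <= (e ^+ 2 + tau ^+ 2)^-1 by rewrite invr_ge0 addr_ge0 ?sqr_ge0.
  rewrite normrM (ger0_norm D0) ler_wpM2r//.
  rewrite (le_trans (ler_normB _ _))// lerD// normrM.
    by rewrite ler_piMr ?sin_max.
  by rewrite (gtr0_norm e0) ler_piMr ?cos_max// ltW.
Qed.

Lemma itg_cauchy b : 0 < b -> itg leb (fun s => b / (b ^+ 2 + s ^+ 2)) /\
  \int[leb]_s (b / (b ^+ 2 + s ^+ 2)) = pi.
Proof.
move=> b0; have pos s : 0 < b ^+ 2 + s ^+ 2 by exact: sqrD_gt0.
have cf : continuous (fun s => b / (b ^+ 2 + s ^+ 2)).
  apply: derivable_cont => s.
  apply: derivableM; first exact: derivable_cst.
  by apply: derivableV; [rewrite gt_eqF|exact: ex_derive].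
have dF := fun s => is_derive_atan_scale s b0.
have hray : itg leb (fun s => \1_`[0, +oo[ s * (b / (b ^+ 2 + s ^+ 2))).
  apply: (itg_ray (l := pi / 2) cf _ dF) => s; last exact/ltW/atan_ltpi2.
  by rewrite divr_ge0// ltW.
have [//|s|//|hf ->] := @Rint_even _ (fun s => b / (b ^+ 2 + s ^+ 2)) .
- exact: continuous_measurable_fun.
- by rewrite sqrrN.
split => //.
rewrite (@Rint_FTC_ray _ _ _ (pi / 2) cf dF)//.
  by rewrite mul0r atan0 subr0 mulrC divfK// pnatr_eq0.
have h : (n%:R / b : R) @[n --> \oo] --> +oo%R.
  apply/cvgryPge => A; near=> n.
  rewrite ler_pdivlMr//; apply: (le_trans (ler_norm _)).
  by near: n; exact: nbhs_infty_ger.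
exact: (cvg_comp _ (@atan R) h (@cvgy_atan R)).
Unshelve. all: end_near. Qed.

Lemma itg_cauchy_cos b tau : 0 < b ->
  itg leb (fun s => b / (b ^+ 2 + s ^+ 2) * cos (tau * s)).
Proof.
move=> b0; have [hb _] := itg_cauchy b0.
have hm : itg leb (fun s => cos (tau * s) * (b / (b ^+ 2 + s ^+ 2))).
  by apply: (itgMb (C := 1) hb) => [|s]; [exact: measurable_cosM|exact: cos_max].
by apply: (eq_itg hm) => s; rewrite mulrC.
Qed.

(** Abel summation of the cosine integral of the Cauchy kernel. By Fubini the
   damped integral is the Poisson integral of exp(-b|r|) at scale e, written
   here in the variable q = (r - tau) / e. *)
Let abel_cauchy b e tau : 0 < b -> 0 < e ->
  \int[leb]_s (expR (- e * `|s|) * (b / (b ^+ 2 + s ^+ 2) * cos (tau * s))) =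
  \int[leb]_q (expR (- b * `|tau + e * q|) / (1 + q ^+ 2)).
Proof.
move=> b0 e0.
pose h (p : R * R) := expR (- e * `|p.1|) * cos (tau * p.1) *
  (expR (- b * `|p.2|) * cos (p.1 * p.2)).
have hh : itg (leb \x leb)%E h.
  apply: (itg_le (itg_prod (itg_expN e0) (itg_expN b0))) => [|p].
  - apply: measurable_funM; apply: measurable_funM.
    + exact: (measurableT_comp (measurable_expN e) measurable_fst).
    + exact: (measurableT_comp (measurable_cosM (measurable_mulc tau)) measurable_fst).
    + exact: (measurableT_comp (measurable_expN b) measurable_snd).
    + apply: (measurableT_comp measurable_cos).
      by apply: measurable_funM; [exact: measurable_fst|exact: measurable_snd].
  - rewrite !normrM !(ger0_norm (expR_ge0 _)) ler_pM ?mulr_ge0 ?expR_ge0//.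
      by rewrite ler_piMr ?expR_ge0// cos_max.
    by rewrite ler_piMr ?expR_ge0// cos_max.
have -> : \int[leb]_s (expR (- e * `|s|) * (b / (b ^+ 2 + s ^+ 2) * cos (tau * s))) =
    2^-1 * \int[leb]_s \int[leb]_r h (s, r).
  rewrite -RintZl; last exact: (itg_Rint_section hh).
  apply: eq_Rint => s; rewrite /h /= RintZl; last exact: itg_expN_cos.
  by rewrite Rint_expN_cos//; field; rewrite gt_eqF// sqrD_gt0.
rewrite (Rint_Fubini hh).
pose P q := 2 * e / (e ^+ 2 + q ^+ 2).
have inner r : \int[leb]_s h (s, r) =
   2^-1 * (expR (- b * `|r|) * P (r + tau)) + 2^-1 * (expR (- b * `|r|) * P (r - tau)).
  rewrite /P -!Rint_expN_cos// -mulrDr -mulrDr -RintD; [|exact: itg_expN_cos..].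
  rewrite mulrA -RintZl; last by apply: itgD; exact: itg_expN_cos.
  apply: eq_Rint => s; rewrite /h /=.
  rewrite mulrDl mulrBl cosD cosB (mulrC s r).
  by field.
have mP : measurable_fun setT P.
  apply: continuous_measurable_fun; apply: derivable_cont => q.
  apply: derivableM; first exact: derivable_cst.
  by apply: derivableV; [rewrite gt_eqF// sqrD_gt0|exact: ex_derive].
have P0 q : 0 <= P q by rewrite divr_ge0 ?mulr_ge0 ?ltW// sqrD_gt0.
have Pb q : `|P q| <= 2 / e.
  rewrite ger0_norm// /P -mulrA ler_pM2l//.
  rewrite ler_pdivrMr ?sqrD_gt0// mulrC ler_pdivlMr// -expr2.
  by rewrite lerDl sqr_ge0.
have hP c : itg leb (fun r => expR (- b * `|r|) * P (r + c)).
  have hm := itgMb (itg_expN b0)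
    (measurableT_comp mP (measurable_shift c)) (fun r => Pb (r + c)).
  by apply: (eq_itg hm) => r; rewrite mulrC.
rewrite [X in _ * X](eq_Rint leb inner) RintD; [|exact: itgZl..].
rewrite !RintZl//.
have -> : \int[leb]_r (expR (- b * `|r|) * P (r + tau)) =
          \int[leb]_r (expR (- b * `|r|) * P (r - tau)).
  rewrite -(Rint_opp (hP tau)); apply: eq_Rint => r.
  by rewrite normrN /P; congr (_ * (_ / (_ + _))); ring.
have half (I : R) : 2^-1 * (2^-1 * I + 2^-1 * I) = 2^-1 * I by field.
rewrite half -RintZl//.
pose g r := 2^-1 * (expR (- b * `|r|) * P (r - tau)).
have cg : continuous g.
  apply: contM; first by move=> r; exact: cvg_cst.
  apply: contM.
    by apply: (cont_comp _ (@continuous_expN b)); exact: norm_continuous.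
  apply: cont_comp; first by apply: derivable_cont => r; exact: ex_derive.
  apply: derivable_cont => q; apply: derivableM; first exact: derivable_cst.
  by apply: derivableV; [rewrite gt_eqF// sqrD_gt0|exact: ex_derive].
pose F q := tau + e * q.
have dF q : is_derive q 1 F e by apply: is_derive_eq; rewrite /GRing.scale/=; ring.
have F'E : derive1 F = cst e.
  by apply/funext => q; rewrite derive1E; have [_ ->] := dF q.
transitivity (\int[leb]_q (((g \o F) * derive1 F) q)); last first.
  apply: eq_Rint => q; rewrite F'E !fctE /g /P /=.
  have := sqrD_gt0 q (@ltr01 R); have := sqrD_gt0 (F q - tau) e0.
  rewrite expr1n => h1 h2; rewrite /F in h1 *.
  by field; rewrite !gt_eqF.
have Fy : F q @[q --> +oo%R] --> +oo%R.
  apply/cvgryPge => A; by near=> q; rewrite -lerBlDl -ler_pdivrMl.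
have FNy : F q @[q --> -oo%R] --> -oo%R.
  apply/cvgrNyPle => A; by near=> q; rewrite -lerBrDl -ler_pdivlMl.
congr fine; apply: increasing_ge0_integration_by_substitutionT => //.
- by move=> x y xy; rewrite ltrD2l ltr_pM2l.
- by rewrite F'E; exact: cst_continuous.
- by rewrite F'E; exact: is_cvg_cst.
- by rewrite F'E; exact: is_cvg_cst.
- by move=> r; rewrite mulr_ge0// mulr_ge0// expR_ge0.
Unshelve. all: end_near. Qed.

Lemma cvg_harmonic0 : (n.+1%:R^-1 : R) @[n --> \oo] --> (0 : R).
Proof. exact: cvg_harmonic. Qed.

Lemma continuous_expNnorm b : continuous (fun s : R => expR (- b * `|s|)).
Proof.
by apply: (cont_comp _ (@continuous_expN b)); exact: norm_continuous.
Qed.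

(** As e tends to 0 the damped integrals tend to the integral itself, and their
    values to exp(-b|tau|) times the mass pi of 1/(1 + q^2). *)
Lemma Rint_cauchy_cos_pos b tau : 0 < b ->
  \int[leb]_s (b / (b ^+ 2 + s ^+ 2) * cos (tau * s)) = pi * expR (- b * `|tau|).
Proof.
move=> b0; set f := fun s => _.
have hf : itg leb f by exact: itg_cauchy_cos.
pose eps n : R := n.+1%:R^-1.
have eps0 n : 0 < eps n by rewrite invr_gt0.
have lim1 : \int[leb]_s (expR (- eps n * `|s|) * f s) @[n --> \oo] -->
    \int[leb]_s f s.
  apply: (@Rint_dominated_cvg _ _ _ leb (fun n s => expR (- eps n * `|s|) * f s)
    f (fun s => `|f s|)).
  - move=> n; apply: measurable_funM; first exact: measurable_expN.
    exact: itg_measurable hf.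
  - exact: itg_measurable hf.
  - exact: itg_norm.
  - move=> n s; rewrite normrM (ger0_norm (expR_ge0 _)) ler_piMl//.
    by rewrite -[leRHS]expR0 ler_expR mulNr oppr_le0 mulr_ge0// ltW.
  - apply: aeW => s; rewrite -[X in _ --> X]mul1r -expR0.
    apply: cvgMl; apply: (continuous_cvg _ (@continuous_expR R 0)).
    rewrite -(mul0r `|s|) -oppr0; apply: cvgMl; apply: cvgN.
    exact: cvg_harmonic0.
have lim2 : \int[leb]_s (expR (- eps n * `|s|) * f s) @[n --> \oo] -->
    pi * expR (- b * `|tau|).
  under eq_cvg => n do rewrite abel_cauchy//.
  have [h1 hpi] := itg_cauchy (@ltr01 R).
  have h1E : (fun q : R => 1 / (1 ^+ 2 + q ^+ 2)) = (fun q => (1 + q ^+ 2)^-1).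
    by apply/funext => q; rewrite expr1n mul1r.
  rewrite h1E in h1 hpi.
  rewrite mulrC -hpi -RintZl//.
  apply: (@Rint_dominated_cvg _ _ _ leb
    (fun n q => expR (- b * `|tau + eps n * q|) / (1 + q ^+ 2))
    (fun q => expR (- b * `|tau|) * (1 + q ^+ 2)^-1) (fun q => (1 + q ^+ 2)^-1)).
  - move=> n; apply: measurable_funM; last exact: itg_measurable h1.
    apply: (measurableT_comp (measurable_expN b)).
    by apply: measurable_funD => //; exact: measurable_mulc.
  - by apply: measurable_funM => //; exact: itg_measurable h1.
  - exact: h1.
  - move=> n q; rewrite normrM ger0_norm ?expR_ge0// ger0_norm; last first.
      by rewrite invr_ge0 addr_ge0 ?sqr_ge0.
    rewrite ler_piMl ?invr_ge0 ?addr_ge0 ?sqr_ge0//.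
    by rewrite -[leRHS]expR0 ler_expR mulNr oppr_le0 mulr_ge0// ltW.
  - apply: aeW => q; apply: cvgMl.
    apply: (continuous_cvg _ (@continuous_expNnorm b tau)).
    rewrite -[X in _ --> X]addr0; apply: cvgD; first exact: cvg_cst.
    by rewrite -(mul0r q); apply: cvgMl; exact: cvg_harmonic0.
exact: (cvg_unique _ lim1 lim2).
Qed.

(** The real part of 1 / (b + is), with the value 0 at the pole. *)
Definition cauchyK b s := b / (b ^+ 2 + s ^+ 2).

Lemma cauchyKN b s : cauchyK (- b) s = - cauchyK b s.
Proof. by rewrite /cauchyK sqrrN mulNr. Qed.

Lemma itg_cauchyK_cos b tau : itg leb (fun s => cauchyK b s * cos (tau * s)).
Proof.
have [b0|b0|->] := ltgtP b 0.
- rewrite -(opprK b); have := itgN (@itg_cauchy_cos (- b) tau _).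
  rewrite oppr_gt0 => /(_ b0) h; apply: (eq_itg h) => s.
  by rewrite [RHS]mulrC cauchyKN mulrN mulrC.
- exact: itg_cauchy_cos.
- apply: (eq_itg (itg0 _)) => s.
  by rewrite /cauchyK !mul0r.
Qed.

(** Fourier's formula for b > 0, extended by oddness in b. *)
Lemma Rint_cauchyK_cos b tau :
  \int[leb]_s (cauchyK b s * cos (tau * s)) =
  pi * Num.sg b * expR (- (`|b| * `|tau|)).
Proof.
have [b0|b0|->] := ltgtP b 0.
- have b0' : 0 < - b by rewrite oppr_gt0.
  transitivity (\int[leb]_s (- (cauchyK (- b) s * cos (tau * s)))).
    by apply: eq_Rint => s; rewrite cauchyKN mulNr opprK.
  rewrite RintN; last exact: itg_cauchy_cos.
  by rewrite Rint_cauchy_cos_pos// ltr0_sg// (ltr0_norm b0) mulrN1 !mulNr opprK.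
- by rewrite Rint_cauchy_cos_pos// gtr0_sg// mulr1 (gtr0_norm b0) mulNr.
- rewrite sgr0 mulr0 mul0r -[RHS](Rint0 leb); apply: eq_Rint => s.
  by rewrite /cauchyK !mul0r.
Qed.

End Poisson.

(** * Uniqueness for Laplace transforms *)

Section OrientedInterval.
Context {R : realType}.
Implicit Types (h : R -> R) (a b c t x : R).

(** The indicator of the interval between a and b, with the sign of the
    orientation and half the value at the endpoints. In this form it is
    a limit of differences of arctangents and, up to a factor, an increment of
    the kernel Wk below. *)
Definition oitv a b t : R := 2^-1 * (Num.sg (b - t) - Num.sg (a - t)).

Lemma measurable_sg : measurable_fun setT (@Num.sg R).
Proof.
rewrite (_ : @Num.sg R = fun x => \1_`]0, +oo[ x - \1_`]-oo, 0[ x).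
  by apply: measurable_funB; exact: measurable_indic.
apply/funext => x; rewrite !indicE !mem_setE !in_itv/= andbT.
by case: sgrP => x0; rewrite ?ltxx ?x0 ?subrr ?subr0 ?(le_gtF (ltW x0)) ?subr0 ?sub0r.
Qed.

Lemma norm_sg_le1 x : `|Num.sg x| <= 1.
Proof. by rewrite normr_sg; case: (x != 0). Qed.

Lemma measurable_oitv a b : measurable_fun setT (oitv a b).
Proof.
apply: measurable_funM => //; apply: measurable_funB;
  by apply: (measurableT_comp measurable_sg); exact: measurable_funB.
Qed.

Lemma norm_oitv a b t : `|oitv a b t| <= 1.
Proof.
rewrite normrM ger0_norm// ler_pdivrMl// mulr1 (le_trans (ler_normB _ _))//.
by rewrite -[2]/(1 + 1) lerD ?norm_sg_le1.
Qed.

Lemma oitvC a b t : oitv a b t = - oitv b a t.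
Proof. by rewrite /oitv -mulrN opprB. Qed.

Lemma itg_oitv a b h : itg leb h -> itg leb (fun t => oitv a b t * h t).
Proof.
by move=> hh; apply: (itgMb hh (measurable_oitv a b)) => t; exact: norm_oitv.
Qed.

Lemma ae_derive_primitive h : itg leb h ->
  {ae (@lebesgue_measure R), forall x,
    derivable (fun x => \int[leb]_(t in `]-oo, x]) h t) x 1 /\
    (fun x => \int[leb]_(t in `]-oo, x]) h t)^`()%classic x = h x}.
Proof.
move=> hh; apply: FTC1Ny; first by move=> y; exact: (integrableS _ _ _ hh).
have := integrable_locally measurableT hh.
by rewrite patch_setT.
Qed.

Lemma Rint_oitv a b h : itg leb h ->
  \int[leb]_(t in `]-oo, b]) h t - \int[leb]_(t in `]-oo, a]) h t =
  \int[leb]_t (oitv a b t * h t).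
Proof.
move=> hh; rewrite (Rint_indic leb `]-oo, b]%classic) (Rint_indic leb `]-oo, a]%classic).
rewrite -RintB; [|exact: itg_indicM..].
apply: ae_Rint; first by apply: itgB; exact: itg_indicM.
  apply: measurable_funM; last exact: itg_measurable hh.
  exact: measurable_oitv.
apply: ae_lebS (ae_leb2 (ae_neq a) (ae_neq b)) => t [ta tb].
rewrite -mulrBl; congr (_ * _).
rewrite /oitv !indicE !mem_setE !in_itv/=.
have E c : t != c -> (t <= c)%R%:R = 2^-1 * (1 + Num.sg (c - t)) :> R.
  case: (ltgtP t c) => tc _ //.
    by rewrite gtr0_sg ?subr_gt0// mulVf// pnatr_eq0.
  by rewrite ltr0_sg ?subr_lt0// subrr mulr0.
by rewrite !E//; ring.
Qed.

(** By Lebesgue's differentiation theorem the function is almost everywhere the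
    derivative of its primitive, which is constant. *)
Lemma ae_eq0_oitv h : itg leb h ->
  (forall a b, a < b -> \int[leb]_t (oitv a b t * h t) = 0) ->
  {ae (@lebesgue_measure R), forall t, h t = 0}.
Proof.
move=> hh h0.
have := ae_derive_primitive hh; apply: ae_lebS => x [_ <-].
pose F x := \int[leb]_(t in `]-oo, x]) h t.
have Fc : F = cst (F 0).
  apply/funext => y /=; apply/eqP; rewrite -subr_eq0 /F (Rint_oitv _ _ hh).
  have [y0|y0|<-] := ltgtP 0 y.
  - by rewrite h0.
  - rewrite -oppr_eq0 -RintN; last exact: itg_oitv.
    rewrite (_ : (fun _ => _) = (fun t => oitv y 0 t * h t)) ?h0//.
    by apply/funext => t; rewrite oitvC mulNr opprK.
  - rewrite -(Rint0 leb); apply/eqP/eq_Rint => t.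
    by rewrite /oitv subrr mulr0 mul0r.
by rewrite -/F Fc derive1_cst.
Qed.

End OrientedInterval.

Section Laplace.
Context {R : realType}.

Lemma expR_ge_pow (x : R) k : 0 <= x -> x ^+ k / k`!%:R <= expR x.
Proof.
move=> x0; have := @nondecreasing_cvgn_le _ _ _ (is_cvg_series_exp_coeff x) k.+1.
rewrite -/(expR x) => h; apply: le_trans (h _).
  by rewrite /series/= big_nat_recr//= lerDr sumr_ge0// => j _; exact: exp_coeff_ge0.
by apply/nondecreasing_seqP => m; rewrite /series/= big_nat_recr//= lerDl exp_coeff_ge0.
Qed.

(** A series dominated by the exponential series has the tail of the latter,
    because (n + j)! is at least n! j!. *)
Lemma exp_tail (a : nat -> R) (x l : R) n :
  (forall k, `|a k| <= `|x| ^+ k / k`!%:R) -> series a @ \oo --> l ->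
  `|l - series a n| <= `|x| ^+ n / n`!%:R * expR `|x|.
Proof.
move=> ax al.
have bound N : (n <= N)%N -> `|series a N - series a n| <=
    `|x| ^+ n / n`!%:R * expR `|x|.
  move=> nN; rewrite sub_series_geq//.
  apply: (le_trans (ler_norm_sum _ _ _)).
  apply: (@le_trans _ _ (\sum_(n <= k < N) `|x| ^+ k / k`!%:R)).
    by apply: ler_sum => k _; exact: ax.
  rewrite -{1}[n]add0n big_addn.
  apply: (@le_trans _ _ (\sum_(0 <= j < N - n)
      (`|x| ^+ n / n`!%:R * (`|x| ^+ j / j`!%:R)))).
    apply: ler_sum => j _; rewrite mulrACA -exprD addnC.
    rewrite ler_wpM2l ?exprn_ge0// -invfM lef_pV2 ?posrE ?mulr_gt0 ?ltr0n ?fact_gt0//.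
    rewrite -natrM ler_nat -(bin_fact (leq_addr j n)).
    by rewrite addKn leq_pmull// bin_gt0 leq_addr.
  rewrite -mulr_sumr ler_wpM2l ?divr_ge0 ?exprn_ge0//.
  rewrite /expR; apply: (nondecreasing_cvgn_le _ (is_cvg_series_exp_coeff `|x|)).
  by apply/nondecreasing_seqP => m; rewrite /series/= big_nat_recr//= lerDl exp_coeff_ge0.
apply: (cvgr_to_le (cvg_norm (cvgB al (cvg_cst (series a n))))).
by near=> N; apply: bound; near: N; exact: nbhs_infty_ge.
Unshelve. all: end_near. Qed.

(** A form of the tail bound with geometric decay in n and only an exponential
    in x, so that it can be integrated. *)
Lemma exp_tail2 (a : nat -> R) (x l : R) n :
  (forall k, `|a k| <= `|x| ^+ k / k`!%:R) -> series a @ \oo --> l ->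
  `|l - series a n| <= 2^-1 ^+ n * expR (3 * `|x|).
Proof.
move=> ax al; apply: (le_trans (exp_tail n ax al)).
have h : `|x| ^+ n / n`!%:R <= 2^-1 ^+ n * expR (2 * `|x|).
  rewrite -ler_pdivrMl ?exprn_gt0// exprVn invrK mulrA -exprMn.
  by apply: expR_ge_pow; rewrite mulr_ge0.
apply: (le_trans (ler_wpM2r (expR_ge0 _) h)).
rewrite -mulrA -expRD.
by rewrite (_ : 2 * `|x| + `|x| = 3 * `|x|)//; ring.
Qed.

Implicit Types (g : R -> R) (s t r xi : R).

(** The functions whose two-sided Laplace transform is entire. *)
Definition exp_itg g := forall m : R, itg leb (fun t => expR (m * `|t|) * g t).

Lemma exp_itg_itg g : exp_itg g -> itg leb g.
Proof.
by move=> /(_ 0) h; apply: (eq_itg h) => t; rewrite mul0r expR0 mul1r.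
Qed.

Lemma exp_itg_pow g k : exp_itg g -> itg leb (fun t => t ^+ k * g t).
Proof.
move=> hg; have mg := itg_measurable (exp_itg_itg hg).
apply: (itg_le (itgZl k`!%:R (itg_norm (hg 1)))) => [|t].
  by apply: measurable_funM => //; exact: measurable_funX.
rewrite !normrM mulrA ler_wpM2r// normrX mul1r (ger0_norm (expR_ge0 _)).
by rewrite mulrC -ler_pdivrMr ?ltr0n ?fact_gt0// expR_ge_pow.
Qed.

Lemma Rint_poly0 g (c : nat -> R) n : exp_itg g ->
  (forall k, (k < n)%N -> \int[leb]_t (t ^+ k * g t) = 0) ->
  itg leb (fun t => \sum_(0 <= k < n) c k * t ^+ k * g t) /\
  \int[leb]_t (\sum_(0 <= k < n) c k * t ^+ k * g t) = 0.
Proof.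
move=> hg; elim: n => [|n IH] m0.
  have -> : (fun t => \sum_(0 <= k < 0) c k * t ^+ k * g t) = fun=> 0.
    by apply/funext => t; rewrite big_nil.
  by split; [exact: itg0|exact: Rint0].
have [i1 e1] := IH (fun k kn => m0 k (ltnW kn)).
have i2 := itgZl (c n) (exp_itg_pow n hg).
have -> : (fun t => \sum_(0 <= k < n.+1) c k * t ^+ k * g t) =
    (fun t => \sum_(0 <= k < n) c k * t ^+ k * g t + c n * (t ^+ n * g t)).
  by apply/funext => t; rewrite big_nat_recr//= mulrA.
split; first exact: itgD.
by rewrite RintD// e1 add0r RintZl ?m0 ?mulr0//; exact: exp_itg_pow.
Qed.

(** If the moments below n vanish then the Laplace transform at xi is
    xi^n / n! times the n-th moment, up to O(xi^(n+1)). *)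
Lemma laplace_moments g (S : R) n : exp_itg g -> 0 < S ->
  (forall xi, 0 < xi < S -> \int[leb]_t (expR (xi * t) * g t) = 0) ->
  \int[leb]_t (t ^+ n * g t) = 0.
Proof.
move=> hg S0 L0; elim/ltn_ind: n => n IH.
have mg := itg_measurable (exp_itg_itg hg).
pose C := \int[leb]_t `|expR (2 * `|t|) * g t|.
have C0 : 0 <= C by exact: Rint_ge0.
set m := LHS.
have small xi : 0 < xi < Num.min S 1 -> `|m| <= n`!%:R * C * xi.
  rewrite lt_min => /and3P[xi0 xiS xi1].
  pose D t := expR (xi * t) - series (exp_coeff (xi * t)) n.+1.
  have Db t : `|D t| <= xi ^+ n.+1 * expR (2 * `|t|).
    have := @exp_tail (exp_coeff (xi * t)) (xi * t) (expR (xi * t)) n.+1.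
    rewrite -/(D t) => /(_ _ _)/le_trans; apply.
    - by move=> k; rewrite /exp_coeff/= normrM normrX [X in _ * X]ger0_norm.
    - exact: is_cvg_series_exp_coeff.
    rewrite normrM (gtr0_norm xi0) exprMn -!mulrA ler_pM2l ?exprn_gt0//.
    rewrite (_ : 2 * `|t| = `|t| + `|t|); last by ring.
    rewrite expRD mulrA ler_pM ?expR_ge0 ?divr_ge0 ?exprn_ge0 ?expR_ge_pow//.
    by rewrite ler_expR ler_piMl// ltW.
  have mE t : expR (xi * t) * g t = xi ^+ n / n`!%:R * (t ^+ n * g t) +
      (\sum_(0 <= k < n) xi ^+ k / k`!%:R * t ^+ k * g t + D t * g t).
    rewrite /D /series/= big_nat_recr//= /exp_coeff/= mulrBl mulrDl mulr_suml.
    rewrite exprMn.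
    have -> : \sum_(0 <= i < n) ((xi * t) ^+ i / i`!%:R * g t) =
        \sum_(0 <= k < n) xi ^+ k / k`!%:R * t ^+ k * g t.
      by apply: eq_bigr => i _; rewrite exprMn; ring.
    by ring.
  have [i1 e1] := Rint_poly0 (fun k => xi ^+ k / k`!%:R) hg IH.
  have ie : itg leb (fun t => expR (xi * t) * g t).
    apply: (itg_le (itg_norm (hg 1))) => [|t].
      by apply: measurable_funM => //; exact: measurable_expM (measurable_mulc xi).
    rewrite !normrM !(ger0_norm (expR_ge0 _)) ler_wpM2r// ler_expR mul1r.
    rewrite (le_trans (ler_norm _))// normrM (gtr0_norm xi0).
    by rewrite ler_piMl// ltW.
  have iD : itg leb (fun t => D t * g t).
    apply: (eq_itg (itgB (itgB ie i1) (itgZl (xi ^+ n / n`!%:R) (exp_itg_pow n hg)))) => t.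
    by rewrite mE; ring.
  have := L0 xi; rewrite xi0 xiS => /(_ isT).
  rewrite (eq_Rint leb mE) RintD; [|exact/itgZl/exp_itg_pow|exact: itgD].
  rewrite RintD// e1 add0r RintZl; last exact: exp_itg_pow.
  move=> /eqP; rewrite addr_eq0 => /eqP e2.
  have : `|xi ^+ n / n`!%:R * m| <= xi ^+ n.+1 * C.
    rewrite e2 normrN /C -RintZl; last exact: itg_norm (hg 2).
    apply: norm_Rint_le => [||t].
    - by apply: itgZl; exact: itg_norm (hg 2).
    - exact: itg_measurable iD.
    - by rewrite !normrM (ger0_norm (expR_ge0 _)) mulrA ler_wpM2r.
  have p0 : 0 < xi ^+ n / n`!%:R by rewrite divr_gt0 ?exprn_gt0 ?ltr0n ?fact_gt0.
  rewrite normrM (gtr0_norm p0) exprSr -!mulrA.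
  rewrite ler_pM2l ?exprn_gt0// ler_pdivrMl ?ltr0n ?fact_gt0//.
  by rewrite (mulrC xi) mulrA.
apply/eqP; rewrite -normr_le0; apply/ler_addgt0Pr => e e0; rewrite add0r.
pose K := n`!%:R * C + 1.
have K0 : 0 < K by rewrite ltr_pwDr// mulr_ge0.
pose xi := Num.min (e / K) (Num.min S 1 / 2).
have xi0 : 0 < xi by rewrite /xi lt_min !divr_gt0 ?lt_min ?S0 ?ltr01.
apply: (le_trans (small xi _)).
  rewrite xi0/= /xi gt_min; apply/orP; right.
  by rewrite ltr_pdivrMr// ltr_pMr ?lt_min ?S0 ?ltr01// ltr1n.
have h : K * xi <= e by rewrite mulrC -ler_pdivlMr// /xi ge_min lexx.
by apply: le_trans h; rewrite ler_wpM2r ?lerDl// ltW.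
Qed.

(** The Taylor polynomials of the cosine integrate to 0 against g, and the
    remainder is small in the mean. *)
Lemma moments_cos g s : exp_itg g ->
  (forall n, \int[leb]_t (t ^+ n * g t) = 0) ->
  \int[leb]_t (cos (s * t) * g t) = 0.
Proof.
move=> hg m0; have mg := itg_measurable (exp_itg_itg hg).
pose C := \int[leb]_t `|expR (3 * `|s| * `|t|) * g t|.
have bound n : `|\int[leb]_t (cos (s * t) * g t)| <= C * 2^-1 ^+ n.
  pose D t := cos (s * t) - series (cos_coeff (s * t)) n.
  have Db t : `|D t| <= 2^-1 ^+ n * expR (3 * `|s| * `|t|).
    rewrite -mulrA -normrM; apply: exp_tail2.
      move=> k; rewrite /cos_coeff/= !normrM normrX normrV ?unitfE//.
      rewrite normrN1 expr1n mulr1 normrX normrM (ger0_norm (ler0n _ k`!)).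
      rewrite ler_wpM2r// ler_piMl ?exprn_ge0 ?mulr_ge0//.
      by rewrite normr_nat; case: odd.
    have -> : cos (s * t) = limn (series (cos_coeff (s * t))) by rewrite cos.unlock.
    exact: is_cvg_series_cos_coeff.
  have mE t : cos (s * t) * g t =
     \sum_(0 <= k < n) cos_coeff s k * t ^+ k * g t + D t * g t.
    rewrite /D mulrBl /series/= mulr_suml.
    have -> : \sum_(0 <= i < n) (cos_coeff (s * t) i * g t) =
        \sum_(0 <= k < n) cos_coeff s k * t ^+ k * g t.
      by apply: eq_bigr => i _; rewrite /cos_coeff/= exprMn; ring.
    by ring.
  have [i1 e1] := Rint_poly0 (n := n) (cos_coeff s) hg (fun k _ => m0 k).
  have iD : itg leb (fun t => D t * g t).
    have ic : itg leb (fun t => cos (s * t) * g t).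
      apply: (itgMb (C := 1) (exp_itg_itg hg)) => [|t]; last exact: cos_max.
      exact: measurable_cosM (measurable_mulc s).
    apply: (eq_itg (itgB ic i1)) => t.
    by rewrite mE; ring.
  rewrite (eq_Rint leb mE) RintD// e1 add0r mulrC -RintZl; last exact: itg_norm (hg _).
  apply: norm_Rint_le => [||t].
  - by apply: itgZl; exact: itg_norm (hg _).
  - exact: itg_measurable iD.
  - by rewrite !normrM (ger0_norm (expR_ge0 _)) mulrA ler_wpM2r.
have lim : C * 2^-1 ^+ n @[n --> \oo] --> (0 : R).
  rewrite -[X in _ --> X](mulr0 C); apply: cvgMr; apply: cvg_expr.
  by rewrite normfV normr_nat invf_lt1// ltr1n.
apply/eqP; rewrite -normr_le0.
by apply: (cvgr_to_ge lim); apply: nearW => n; exact: bound.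
Qed.

Lemma exp_itg_shift g r : exp_itg g -> exp_itg (fun t => g (t + r)).
Proof.
move=> hg m; have hs := itg_shift r (itg_norm (hg `|m|)).
have mg := itg_measurable (exp_itg_itg hg).
apply: (itg_le (itgZl (expR (`|m| * `|r|)) hs)) => [|t].
  apply: measurable_funM; last exact: (measurableT_comp mg (measurable_shift r)).
  by have := measurable_expN (- m); rewrite opprK.
rewrite !normrM !(ger0_norm (expR_ge0 _)) mulrA ler_wpM2r// -expRD ler_expR.
rewrite -mulrDr (@le_trans _ _ (`|m| * `|t|))//.
  by rewrite ler_wpM2r// ler_norm.
rewrite ler_wpM2l// -{1}(addrK r t) (addrC `|r|).
exact: ler_normB.
Qed.

(** The transform of a translate vanishes with the transform, so that the phase
   can be centred at r. *)
Lemma laplace_shift_cos g (S r s : R) : exp_itg g -> 0 < S ->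
  (forall xi, 0 < xi < S -> \int[leb]_t (expR (xi * t) * g t) = 0) ->
  \int[leb]_t (cos (s * (t - r)) * g t) = 0.
Proof.
move=> hg S0 L0; have hg' := exp_itg_shift r hg.
have ic : itg leb (fun t => cos (s * (t - r)) * g t).
  apply: (itgMb (C := 1) (exp_itg_itg hg)) => [|t]; last exact: cos_max.
  exact: measurable_cosM (measurableT_comp (measurable_mulc s) (measurable_shift (- r))).
rewrite -(Rint_shift r ic).
transitivity (\int[leb]_t (cos (s * t) * g (t + r))).
  by apply: eq_Rint => t; rewrite addrK.
apply: moments_cos => // n; apply: (laplace_moments n hg' S0) => xi xiS.
have := L0 xi xiS; set h := fun t => _ => h0.
have ih : itg leb h.
  apply: (itg_le (itg_norm (hg `|xi|))) => [|t].
    apply: measurable_funM; last exact: itg_measurable (exp_itg_itg hg).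
    exact: measurable_expM (measurable_mulc xi).
  rewrite !normrM !(ger0_norm (expR_ge0 _)) ler_wpM2r// ler_expR.
  by rewrite -normrM ler_norm.
have := Rint_shift r ih; rewrite h0 => h1.
transitivity (\int[leb]_t (expR (- (xi * r)) * h (t + r))).
  by apply: eq_Rint => t; rewrite /h mulrA -expRD; congr (expR _ * _); ring.
by rewrite RintZl ?h1 ?mulr0//; exact: itg_shift.
Qed.

Lemma atan_scale_cvg (c : R) : atan (c / n.+1%:R^-1) @[n --> \oo] --> Num.sg c * (pi / 2).
Proof.
have pos (d : R) : 0 < d -> atan (d / n.+1%:R^-1) @[n --> \oo] --> pi / 2.
  move=> d0; have h : (d / n.+1%:R^-1 : R) @[n --> \oo] --> +oo%R.
    apply/cvgryPge => A; near=> n.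
    rewrite invrK mulrC -ler_pdivrMr//; apply: (le_trans (ler_norm _)).
    have : `|A / d| <= n%:R by near: n; exact: nbhs_infty_ger.
    by move/le_trans; apply; rewrite ler_nat.
  exact: (cvg_comp _ (@atan R) h (@cvgy_atan R)).
case: sgrP => c0.
- rewrite mul0r c0; under eq_cvg => n do rewrite mul0r atan0.
  exact: cvg_cst.
- by rewrite mul1r; exact: pos.
- rewrite mulN1r (_ : (fun n : nat => _) = (fun n : nat => - atan (- c / n.+1%:R^-1))).
    2: by apply/funext => n; rewrite mulNr atanN opprK.
  by apply: cvgN; apply: pos; rewrite oppr_gt0.
Unshelve. all: end_near. Qed.

Lemma norm_cauchyK_le (e q : R) : 0 < e -> `|cauchyK e q| <= e^-1.
Proof.
move=> e0; have h := sqrD_gt0 q e0.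
rewrite /cauchyK ger0_norm; last by rewrite divr_ge0// ltW.
by rewrite ler_pdivrMr// mulrC ler_pdivlMr// -expr2 lerDl sqr_ge0.
Qed.

Lemma norm_atan_le x : `|atan x| <= (pi / 2 : R).
Proof. by rewrite ler_norml ltW ?atan_gtNpi2// ltW// atan_ltpi2. Qed.

(** A function is determined, up to a null set, by the values of its Laplace
    transform on a small interval. All its moments vanish, hence so does its
    Fourier transform; its Poisson integrals then vanish, and integrating them
    over an interval leaves the integral of the function in the limit. *)
Lemma laplace_uniq g (S : R) : exp_itg g -> 0 < S ->
  (forall xi, 0 < xi < S -> \int[leb]_t (expR (xi * t) * g t) = 0) ->
  {ae (@lebesgue_measure R), forall t, g t = 0}.
Proof.
move=> hg S0 L0; have ig := exp_itg_itg hg; have mg := itg_measurable ig.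
apply: ae_eq0_oitv => // a b ab.
(* The Poisson kernel is a superposition of cosines. *)
have poisson e r : 0 < e -> \int[leb]_t (cauchyK e (t - r) * g t) = 0.
  move=> e0.
  pose h (p : R * R) := expR (- e * `|p.1|) * g p.2 * cos (p.1 * (p.2 - r)).
  have hh : itg (leb \x leb)%E h.
    have m1 : measurable_fun setT (fun p : R * R => cos (p.1 * (p.2 - r))).
      apply: (measurableT_comp measurable_cos); apply: measurable_funM.
        exact: measurable_fst.
      by apply: measurable_funB => //; exact: measurable_snd.
    apply: (eq_itg (itgMb (C := 1) (itg_prod (itg_expN e0) ig) m1 _)) => [p|p].
      exact: cos_max.
    by rewrite mulrC.
  have : \int[leb]_s \int[leb]_t h (s, t) = 0.
    rewrite -[RHS](Rint0 leb); apply: eq_Rint => s; rewrite /h /=.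
    transitivity (\int[leb]_t (expR (- e * `|s|) * (cos (s * (t - r)) * g t))).
      by apply: eq_Rint => t; ring.
    rewrite RintZl ?(laplace_shift_cos _ _ hg S0 L0) ?mulr0//.
    apply: (itgMb (C := 1) ig) => [|t]; last exact: cos_max.
    exact: measurable_cosM (measurableT_comp (measurable_mulc s) (measurable_shift (- r))).
  rewrite (Rint_Fubini hh) => h0.
  rewrite -[RHS](mulr0 2^-1) -h0 -RintZl; last first.
    exact: itg_Rint_section (itg_swap hh).
  apply: eq_Rint => t; rewrite /h /=.
  transitivity (2^-1 * \int[leb]_s (g t * (expR (- e * `|s|) * cos ((t - r) * s)))).
    rewrite RintZl; last exact: itg_expN_cos.
    by rewrite Rint_expN_cos// /cauchyK; field; rewrite gt_eqF// sqrD_gt0.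
  by congr (_ * _); apply: eq_Rint => s; rewrite (mulrC (t - r)); ring.
(* A primitive in r of the Poisson kernel of t - r at scale 1 / (n + 1); as n
   grows, A b - A a tends to pi times the oriented interval. *)
pose A c n t := atan ((c - t) / n.+1%:R^-1).
have mA c n : measurable_fun setT (A c n).
  apply: (measurableT_comp (continuous_measurable_fun (@continuous_atan R))).
  by apply: measurable_funM => //; exact: measurable_funB.
have zero n : \int[leb]_t ((A b n t - A a n t) * g t) = 0.
  pose e : R := n.+1%:R^-1; have e0 : 0 < e by rewrite invr_gt0.
  have cK t : continuous (fun r => cauchyK e (t - r)).
    apply: derivable_cont => q; apply: derivableM; first exact: derivable_cst.
    by apply: derivableV; [rewrite gt_eqF// sqrD_gt0|exact: ex_derive].
  have dA t r : is_derive r 1 (fun r => atan ((r - t) / e)) (cauchyK e (t - r)).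
    apply: is_derive_eq; rewrite /GRing.scale/= /cauchyK.
    rewrite -(sqrrN (t - r)) opprB; move: (r - t) => q.
    by have h := sqrD_gt0 q e0; field; rewrite !gt_eqF.
  pose h (p : R * R) := \1_`[a, b] p.1 * g p.2 * cauchyK e (p.2 - p.1).
  have hh : itg (leb \x leb)%E h.
    have m1 : measurable_fun setT (fun p : R * R => cauchyK e (p.2 - p.1)).
      have mk : measurable_fun setT (cauchyK e).
        by have [/itg_measurable] := itg_cauchy e0.
      apply: (measurableT_comp mk); apply: measurable_funB.
        exact: measurable_snd.
      exact: measurable_fst.
    apply: (eq_itg (itgMb (C := e^-1) (itg_prod (integrable_indic_itv a b true false) ig) m1 _)) => [p|p].
      exact: norm_cauchyK_le.
    by rewrite mulrC.
  have : \int[leb]_r \int[leb]_t h (r, t) = 0.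
    rewrite -[RHS](Rint0 leb); apply: eq_Rint => r; rewrite /h /=.
    transitivity (\int[leb]_t (\1_`[a, b] r * (cauchyK e (t - r) * g t))).
      by apply: eq_Rint => t; ring.
    rewrite RintZl ?poisson ?mulr0//.
    have [/itg_measurable mk _] := itg_cauchy e0.
    apply: (itgMb (C := e^-1) ig) => [|t].
      by apply: (measurableT_comp mk); exact: measurable_funB.
    exact: norm_cauchyK_le.
  rewrite (Rint_Fubini hh) => <-; apply: eq_Rint => t; rewrite /h /=.
  transitivity (\int[leb]_r (g t * (\1_`[a, b] r * cauchyK e (t - r)))).
    rewrite RintZl; last exact: itg_cont_itv (cK t).
    by rewrite (Rint_FTC (ltW ab) (cK t) (dA t)) mulrC.
  by apply: eq_Rint => r; ring.
have lim : \int[leb]_t ((A b n t - A a n t) * g t) @[n --> \oo] -->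
    \int[leb]_t (pi * (oitv a b t * g t)).
  apply: (@Rint_dominated_cvg _ _ _ leb (fun n t => (A b n t - A a n t) * g t)
    (fun t => pi * (oitv a b t * g t)) (fun t => pi * `|g t|)).
  - move=> n; apply: measurable_funM; last exact: mg.
    by apply: measurable_funB; exact: mA.
  - by apply: measurable_funM => //; exact: itg_measurable (itg_oitv a b ig).
  - by apply: itgZl; exact: itg_norm.
  - move=> n t; rewrite normrM ler_wpM2r// (le_trans (ler_normB _ _))//.
    by rewrite [leRHS]splitr lerD// norm_atan_le.
  - apply: aeW => t; rewrite mulrA; apply: cvgMl.
    rewrite (_ : pi * oitv a b t =
        Num.sg (b - t) * (pi / 2) - Num.sg (a - t) * (pi / 2)); last first.
      by rewrite /oitv; field.
    by apply: cvgB; exact: atan_scale_cvg.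
have : \int[leb]_t (pi * (oitv a b t * g t)) = 0.
  have lim0 : \int[leb]_t ((A b n t - A a n t) * g t) @[n --> \oo] --> (0 : R).
    by under eq_cvg => n do rewrite zero; exact: cvg_cst.
  exact: (cvg_unique _ lim lim0).
rewrite RintZl; last exact: itg_oitv.
by move/eqP; rewrite mulf_eq0 gt_eqF ?pi_gt0// => /eqP.
Qed.

End Laplace.

(** * Gaussian convolutions *)

Definition gam0 (R : realType) : R := (Num.sqrt (2 * pi))^-1.

(** The Gaussian, its antiderivative and the envelope are locked, so that
    products of them are not unfolded in the estimates. *)
HB.lock Definition gam (R : realType) (x : R) : R :=
  gam0 R * expR (- x ^+ 2 / 2).

(** The supremum of the Gaussians centred in [-A, A], up to a factor
    bounded in terms of A. *)
HB.lock Definition env (R : realType) (A t : R) : R :=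
  gam0 R * expR (- t ^+ 2 / 2 + A * `|t|).

HB.lock Definition GG (R : realType) (x : R) : R :=
  \int[leb]_(t in `]-oo, x]) gam t.

Section Gauss.
Context {R : realType}.
Implicit Types (f k : R -> R) (A S a b s t u v x xi : R).

Local Notation gam0 := (gam0 R).

Lemma gamE : @gam R = fun x => gam0 * expR (- x ^+ 2 / 2).
Proof. by rewrite gam.unlock. Qed.

Lemma envE : @env R = fun A t => gam0 * expR (- t ^+ 2 / 2 + A * `|t|).
Proof. by rewrite env.unlock. Qed.

Lemma gam0_gt0 : 0 < gam0.
Proof. by rewrite invr_gt0 sqrtr_gt0 mulr_gt0// pi_gt0. Qed.

Lemma gam_gt0 x : 0 < gam x.
Proof. by rewrite gamE mulr_gt0 ?gam0_gt0 ?expR_gt0. Qed.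

Lemma env_gt0 A t : 0 < env A t.
Proof. by rewrite envE mulr_gt0 ?gam0_gt0 ?expR_gt0. Qed.

Lemma norm_gamM x y : `|gam x * y| = gam x * `|y|.
Proof. by rewrite normrM (gtr0_norm (gam_gt0 x)). Qed.

Lemma norm_envM A t y : `|env A t * y| = env A t * `|y|.
Proof. by rewrite normrM (gtr0_norm (env_gt0 A t)). Qed.

Lemma gamN x : gam (- x) = gam x.
Proof. by rewrite gamE sqrrN. Qed.

Lemma is_derive_gam x : is_derive x 1 (@gam R) (- x * gam x).
Proof. by rewrite gamE; apply: is_derive_eq; rewrite /GRing.scale/=; field. Qed.

Lemma is_derive_gamB t x : is_derive x 1 (fun x => gam (x - t)) (- (x - t) * gam (x - t)).
Proof. by rewrite gamE; apply: is_derive_eq; rewrite /GRing.scale/=; field. Qed.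

Lemma continuous_gam : continuous (@gam R).
Proof. exact: derive_continuous is_derive_gam. Qed.

Lemma measurable_gam : measurable_fun setT (@gam R).
Proof. exact: continuous_measurable_fun continuous_gam. Qed.

Lemma measurable_gamB xi : measurable_fun setT (fun t => gam (xi - t)).
Proof. by apply: (measurableT_comp measurable_gam); exact: measurable_funB. Qed.

Lemma measurable_env A : measurable_fun setT (env A).
Proof.
rewrite envE.
apply: measurable_funM => //; apply: measurable_expM; apply: measurable_funD.
  by apply: measurable_funM => //; apply: measurableT_comp => //; exact: measurable_funX.
exact: (measurableT_comp (measurable_mulc A) (@normr_measurable R setT)).
Qed.

Lemma gam_le_env xi A t : `|xi| <= A -> gam (xi - t) <= env A t.
Proof.
move=> xiA; rewrite gamE envE ler_pM2l ?gam0_gt0// ler_expR.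
have h1 : xi * t <= A * `|t|.
  by rewrite (le_trans (ler_norm _))// normrM ler_wpM2r.
have h2 := sqr_ge0 xi; nra.
Qed.

Lemma gam_env_shift xi t : gam (xi - t) = expR (- xi ^+ 2 / 2) * expR (xi * t) * gam t.
Proof.
rewrite gamE (mulrC _ (gam0 * _)) -!mulrA -!expRD.
by congr (_ * expR _); field.
Qed.

Lemma env_le_gam A t : 0 <= A ->
  env A t <= expR (A ^+ 2 / 2) * (gam (A - t) + gam (- A - t)).
Proof.
move=> A0; rewrite mulrDr.
have [t0|t0] := leP 0 t.
- apply: (@le_trans _ _ (expR (A ^+ 2 / 2) * gam (A - t))); last first.
    by rewrite lerDl mulr_ge0 ?expR_ge0// ltW// gam_gt0.
  rewrite envE gamE mulrCA -expRD ler_pM2l ?gam0_gt0// ler_expR ger0_norm//.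
  by rewrite le_eqVlt; apply/orP; left; apply/eqP; field.
- apply: (@le_trans _ _ (expR (A ^+ 2 / 2) * gam (- A - t))); last first.
    by rewrite lerDr mulr_ge0 ?expR_ge0// ltW// gam_gt0.
  rewrite envE gamE mulrCA -expRD ler_pM2l ?gam0_gt0// ler_expR ltr0_norm//.
  by rewrite le_eqVlt; apply/orP; left; apply/eqP; field.
Qed.

Lemma le_env A B t : A <= B -> env A t <= env B t.
Proof.
by move=> AB; rewrite envE ler_pM2l ?gam0_gt0// ler_expR lerD2l ler_wpM2r.
Qed.

(** The factor |t| costs an arbitrarily small widening of the strip. *)
Lemma norm_mul_env A B t : A < B -> `|t| * env A t <= (B - A)^-1 * env B t.
Proof.
move=> AB; have d0 : 0 < B - A by rewrite subr_gt0.
rewrite -ler_pdivrMl ?invr_gt0// invrK mulrA envE mulrCA ler_pM2l ?gam0_gt0//.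
have -> : - t ^+ 2 / 2 + B * `|t| = (B - A) * `|t| + (- t ^+ 2 / 2 + A * `|t|) by ring.
rewrite [leRHS]expRD ler_wpM2r ?expR_ge0//.
by rewrite (le_trans _ (expR_ge1Dx _))// lerDr.
Qed.

Lemma itg_env A : itg leb (env A).
Proof.
have h : itg leb (fun t => gam0 * expR ((A + 1) ^+ 2 / 2) * expR (- 1 * `|t|)).
  exact/itgZl/itg_expN.
apply: (itg_le h (measurable_env A)) => t.
rewrite (gtr0_norm (env_gt0 _ _)) envE -mulrA ler_pM2l ?gam0_gt0// -expRD ler_expR.
have e : t ^+ 2 = `|t| ^+ 2 by rewrite real_normK ?num_real.
have h2 := sqr_ge0 (`|t| - (A + 1)); nra.
Qed.

(** Functions whose convolution with the Gaussian converges, together with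
    all its derivatives, on the strip of half-width S. *)
Definition adm S f := measurable_fun setT f /\
  forall A, 0 <= A < S -> itg leb (fun t => env A t * f t).

Definition conv f xi := \int[leb]_t (gam (xi - t) * f t).

Lemma adm_gam S f xi : adm S f -> `|xi| < S -> itg leb (fun t => gam (xi - t) * f t).
Proof.
move=> [mf hf] xiS; have hA : 0 <= `|xi| < S by rewrite normr_ge0.
apply: (itg_le (itg_norm (hf _ hA))) => [|t].
  by apply: measurable_funM; [exact: measurable_gamB|exact: mf].
by rewrite norm_gamM norm_envM ler_wpM2r// gam_le_env.
Qed.

Lemma adm_of_gam S f : measurable_fun setT f ->
  (forall xi, `|xi| < S -> itg leb (fun t => gam (xi - t) * f t)) -> adm S f.
Proof.
move=> mf hf; split => // A /andP[A0 AS].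
have h1 := itg_norm (hf A _); have h2 := itg_norm (hf (- A) _).
rewrite normrN (ger0_norm A0) in h1 h2.
apply: (itg_le (itgZl (expR (A ^+ 2 / 2)) (itgD (h1 AS) (h2 AS)))) => [|t].
  by apply: measurable_funM; [exact: measurable_env|exact: mf].
rewrite (norm_gamM (A - t)) (norm_gamM (- A - t)) norm_envM -mulrDl mulrA.
by rewrite ler_wpM2r// env_le_gam.
Qed.

Lemma adm_mulX S f : adm S f -> adm S (fun t => t * f t).
Proof.
move=> [mf hf]; split => [|A /andP[A0 AS]]; first exact: measurable_funM.
have AB : A < (A + S) / 2 by lra.
have hB : 0 <= (A + S) / 2 < S by apply/andP; split; lra.
apply: (itg_le (itgZl ((A + S) / 2 - A)^-1 (itg_norm (hf _ hB)))) => [|t].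
  by apply: measurable_funM; [exact: measurable_env|exact: measurable_funM].
rewrite (norm_envM A) (norm_envM ((A + S) / 2)) normrM mulrA mulrA ler_wpM2r//.
by rewrite mulrC norm_mul_env.
Qed.

Lemma admZ S f (c : R) : adm S f -> adm S (fun t => c * f t).
Proof.
move=> [mf hf]; split => [|A AS]; first exact: measurable_funM.
by apply: (eq_itg (itgZl c (hf A AS))) => t; ring.
Qed.

Lemma admD S f k : adm S f -> adm S k -> adm S (fun t => f t + k t).
Proof.
move=> [mf hf] [mk hk]; split => [|A AS]; first exact: measurable_funD.
by apply: (eq_itg (itgD (hf A AS) (hk A AS))) => t; ring.
Qed.

Lemma is_derive_under (h h' : R -> R -> R) u v a (G : R -> R) :
  u < a < v -> (forall x, u < x < v -> itg leb (h x)) ->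
  (forall x t, u < x < v -> is_derive x 1 (h^~ t) (h' x t)) ->
  itg leb G -> (forall x t, u < x < v -> `|h' x t| <= G t) ->
  is_derive a 1 (fun x => \int[leb]_t h x t) (\int[leb]_t h' a t).
Proof.
move=> uav hi hd hG hb.
have E x t : u < x < v -> partial1of2 h x t = h' x t.
  by move=> xuv; rewrite partial1of2E; have [_] := hd x t xuv.
have Ia : [set` `]u, v[] a by rewrite /= in_itv.
have G0 t : 0 <= G t by rewrite (le_trans _ (hb _ t uav)).
have I x : [set` `]u, v[] x -> u < x < v by rewrite /= in_itv.
have ih x : [set` `]u, v[] x -> leb.-integrable setT (EFin \o h x).
  by move=> /I; exact: hi.
have dh x t : [set` `]u, v[] x -> setT t -> derivable (h^~ t) x 1.
  by move=> /I xuv _; have [] := hd x t xuv.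
have bh x t : [set` `]u, v[] x -> setT t -> `|partial1of2 h x t| <= G t.
  by move=> /I xuv _; rewrite E//; exact: hb.
split.
  exact: (derivable_under_integral measurableT Ia ih dh G0 hG bh).
rewrite -derive1E (differentiation_under_integral measurableT Ia ih dh G0 hG bh).
by apply: eq_Rint => t; rewrite E.
Qed.

(** Differentiating the Gaussian gives the factor t - xi, so that the derivative
    is again expressed by convolutions. *)
Lemma is_derive_conv S f xi : adm S f -> `|xi| < S ->
  is_derive xi 1 (conv f) (conv (fun t => t * f t) xi - xi * conv f xi).
Proof.
move=> af xiS; pose A := (`|xi| + S) / 2.
have AS : `|xi| < A < S by rewrite /A; apply/andP; split; lra.
have A0 : 0 <= A < S by case/andP: AS => h1 h2; rewrite (le_trans (normr_ge0 xi) (ltW h1)).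
have [mf hf] := af; have [_ htf] := adm_mulX af.
have b x : - A < x < A -> `|x| <= A by rewrite -ltr_norml => /ltW.
have bS x : - A < x < A -> `|x| < S.
  by rewrite -ltr_norml => /lt_trans; apply; case/andP: AS.
have := @is_derive_under (fun x t => gam (x - t) * f t)
  (fun x t => - (x - t) * gam (x - t) * f t) (- A) A xi
  (fun t => A * `|env A t * f t| + `|env A t * (t * f t)|).
have -> : conv (fun t => t * f t) xi - xi * conv f xi =
    \int[leb]_t (- (xi - t) * gam (xi - t) * f t).
  rewrite /conv -RintZl; last exact: adm_gam af xiS.
  rewrite -RintB; last 2 first.
  - exact: adm_gam (adm_mulX af) xiS.
  - exact/itgZl/(adm_gam af xiS).
  by apply: eq_Rint => t; ring.
apply.
- by case/andP: AS => + _; rewrite ltr_norml.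
- by move=> x xA; exact: adm_gam af (bS x xA).
- move=> x t _; have := is_deriveM (is_derive_gamB t x) (is_derive_cst (f t) x 1).
  by move=> h; apply: is_derive_eq; rewrite /GRing.scale/=; ring.
- by apply: itgD; [apply/itgZl/itg_norm/hf|apply/itg_norm/htf].
- move=> x t xA; rewrite -mulrA normrM normrN (norm_gamM (x - t)).
  rewrite (norm_envM A t (f t)) (norm_envM A t (t * f t)) normrM.
  rewrite !mulrA -mulrDl ler_wpM2r//.
  have h1 : `|x - t| <= A + `|t| by rewrite (le_trans (ler_normB _ _))// lerD2r b.
  have g0 := ltW (gam_gt0 (x - t)).
  rewrite (le_trans (ler_pM _ g0 h1 (gam_le_env t (b x xA))))//.
  by rewrite mulrDl (mulrC (env A t)).
Qed.

Lemma itg_gam : itg leb (@gam R).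
Proof.
apply: (itg_le (itg_env 0) measurable_gam) => t.
by rewrite (gtr0_norm (gam_gt0 _)) -gamN -[- t]add0r gam_le_env// normr0.
Qed.

Lemma is_derive_GG x : is_derive x 1 (@GG R) (gam x).
Proof.
rewrite GG.unlock.
have hx : leb.-integrable [set` Interval -oo%O (BRight (x + 1))] (EFin \o @gam R).
  exact: (integrableS _ _ _ itg_gam).
have xx : x < x + 1 by rewrite ltrDl.
have [d e] := @continuous_FTC1 R (@gam R) -oo%O x (x + 1) xx hx (ltNyr x) (@continuous_gam x).
by split; [exact: d|rewrite -derive1E; exact: e].
Qed.

Lemma continuous_GG : continuous (@GG R).
Proof. exact: derive_continuous is_derive_GG. Qed.

Lemma measurable_GG : measurable_fun setT (@GG R).
Proof. exact: continuous_measurable_fun continuous_GG. Qed.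

Lemma measurable_GGB xi : measurable_fun setT (fun t => GG (xi - t)).
Proof. by apply: (measurableT_comp measurable_GG); exact: measurable_funB. Qed.

Lemma GG_MVT a b : a <= b ->
  exists2 c, a <= c <= b & GG b - GG a = gam c * (b - a).
Proof.
move=> ab; have [c cab e] := MVT_segment ab (fun x _ => is_derive_GG x)
  (continuous_subspaceT continuous_GG).
by exists c => //; move: cab; rewrite in_itv.
Qed.

Lemma GG_MVTB a b t : a <= b ->
  exists2 c, a <= c <= b & GG (b - t) - GG (a - t) = gam (c - t) * (b - a).
Proof.
move=> ab; have [|c cab e] := @GG_MVT (a - t) (b - t); first by rewrite lerD2r.
exists (c + t); first by move: cab; rewrite lerBlDr lerBrDr.
by rewrite e addrK; congr (_ * _); ring.
Qed.

End Gauss.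

(** * The integral over a vertical line, and then over the strip *)

Section Kernel.
Context {R : realType}.
Variables (T : R) (f : R -> R).
Implicit Types (A B S a b s t u v x xi : R).
Local Notation S := (2 * T).

(** F_T on the real line, through the antiderivative of the Gaussian. *)
Definition FF t := GG (S - t) - GG (- S - t).

(** W is, up to an additive constant, the primitive of f F (W_increment). The
    constant is distributed over t' in such a way that Wk decays in t' for
    every t: Wk t t' is GG (S - t') - GG (- t') for t' < t, and
    GG (- S - t') - GG (- t') for t < t'. *)
Definition Wk t t' := 2^-1 * (GG (S - t') + GG (- S - t'))
  + 2^-1 * FF t' * Num.sg (t - t') - GG (- t').

Definition W t := \int[leb]_t' (f t' * Wk t t').

(** The primitive of conv f that vanishes at 0. *)
Definition MM xi := \int[leb]_t (f t * (GG (xi - t) - GG (- t))).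

(** What integration over the strip leaves of a pair (t, t'), with t recentred
    at xi. The difference separates the term that depends on xi through the
    upper limit of a Gaussian integral, which sums up to MM, from Wk. *)
Definition k1 xi t t' := gam (xi - t) * ((GG (xi - t') - GG (- t')) - Wk t t').

Lemma GGB_env A a b t : `|a| <= A -> `|b| <= A ->
  `|GG (a - t) - GG (b - t)| <= 2 * A * env A t.
Proof.
move=> aA bA; wlog ab : a b aA bA / b <= a.
  by move=> h; have [ab|/ltW ab] := leP b a; [exact: h|rewrite distrC; exact: h].
have [c /andP[bc ca] ->] := GG_MVTB t ab.
rewrite norm_gamM mulrC ler_pM ?(ltW (gam_gt0 _))//.
  by rewrite (le_trans (ler_normB _ _))// -[2]/(1 + 1) mulrDl mul1r lerD.
apply: gam_le_env; move: aA bA; rewrite !ler_norml => /andP[a1 a2] /andP[b1 b2].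
by rewrite (le_trans b1 bc) (le_trans ca a2).
Qed.

Lemma itg_MM xi : adm S f -> `|xi| < S ->
  itg leb (fun t => f t * (GG (xi - t) - GG (- t))).
Proof.
move=> [mf hf] xiS.
have hA : 0 <= `|xi| < S by rewrite normr_ge0.
apply: (itg_le (itgZl (2 * `|xi|) (itg_norm (hf _ hA)))) => [|t].
  apply: measurable_funM; first exact: mf.
  apply: measurable_funB; first exact: measurable_GGB.
  by apply: (measurableT_comp measurable_GG); exact: oppr_measurable.
rewrite norm_envM normrM mulrA mulrC ler_wpM2r//.
have := @GGB_env `|xi| xi 0 t (lexx _).
by rewrite sub0r normr0; apply.
Qed.

Lemma is_derive_MM xi : adm S f -> `|xi| < S -> is_derive xi 1 MM (conv f xi).
Proof.
move=> af xiS; pose A := (`|xi| + S) / 2; have [mf hf] := af.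
have AS : `|xi| < A < S by rewrite /A; apply/andP; split; lra.
have A0 : 0 <= A < S by case/andP: AS => h1 h2; rewrite (le_trans (normr_ge0 xi) (ltW h1)).
have b x : - A < x < A -> `|x| <= A by rewrite -ltr_norml => /ltW.
have bS x : - A < x < A -> `|x| < S.
  by rewrite -ltr_norml => /lt_trans; apply; case/andP: AS.
apply: (@is_derive_under _ (fun x t => f t * (GG (x - t) - GG (- t)))
  (fun x t => gam (x - t) * f t) (- A) A xi (fun t => `|env A t * f t|)).
- by case/andP: AS => + _; rewrite ltr_norml.
- by move=> x xA; exact: itg_MM af (bS x xA).
- move=> x t _; have dG : is_derive x 1 (fun x => GG (x - t)) (gam (x - t)).
    have h : is_derive x 1 (fun x => x - t) (1 : R).
      by apply: is_derive_eq; ring.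
    have := is_derive1_comp (f := @GG R) (g := fun x => x - t).
    by move=> /(_ x _ _ (is_derive_GG (x - t)) h); rewrite mulr1.
  by apply: is_derive_eq; rewrite /GRing.scale/=; ring.
- exact/itg_norm/hf.
- move=> x t xA; rewrite norm_gamM norm_envM ler_wpM2r//.
  exact: gam_le_env (b x xA).
Qed.

Lemma gamM x u : gam x * gam u = gam0 R ^+ 2 * expR (- x ^+ 2 / 2 - u ^+ 2 / 2).
Proof. by rewrite gamE mulrACA -expRD -expr2; congr (_ * expR _); ring. Qed.

Lemma envM A t t' : env A t * env A t' = gam0 R ^+ 2 *
  expR (- t ^+ 2 / 2 + A * `|t| + (- t' ^+ 2 / 2 + A * `|t'|)).
Proof. by rewrite envE mulrACA -expRD -expr2. Qed.

(** When centres and points are paired in opposite order, the rearrangement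
    inequality for the exponents bounds the product of the Gaussians by the
    product in which both centres are replaced by their mean. The mean lies
    inside the strip even if v is a boundary point. *)
Lemma gam2_le_env B xi v t t' : (xi - v) * (t - t') <= 0 -> `|xi + v| <= 2 * B ->
  gam (xi - t) * gam (v - t') <= env B t * env B t'.
Proof.
move=> h hB; rewrite gamM envM ler_pM2l ?exprn_gt0 ?gam0_gt0// ler_expR.
have h1 : (xi + v) * (t + t') <= 2 * B * (`|t| + `|t'|).
  rewrite (le_trans (ler_norm _))// normrM ler_pM//; exact: ler_normD.
have h2 := sqr_ge0 xi; have h3 := sqr_ge0 v; nra.
Qed.

(** The integrals of gam (v - t) for v in [-2T, xi] and in [xi, 2T]. *)
Let A' xi t := GG (xi - t) - GG (- S - t).
Let B' xi t := GG (S - t) - GG (xi - t).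

Lemma k1_lt xi t t' : t < t' -> k1 xi t t' = gam (xi - t) * A' xi t'.
Proof.
move=> tt'; rewrite /k1 /Wk /FF /A' ltr0_sg ?subr_lt0//.
by congr (_ * _); field.
Qed.

Lemma k1_gt xi t t' : t' < t -> k1 xi t t' = - (gam (xi - t) * B' xi t').
Proof.
move=> tt'; rewrite /k1 /Wk /FF /B' gtr0_sg ?subr_gt0// -[RHS]mulrN.
by congr (_ * _); field.
Qed.

Lemma k1_eq xi t : k1 xi t t = 2^-1 * (gam (xi - t) * A' xi t - gam (xi - t) * B' xi t).
Proof. by rewrite /k1 /Wk /FF /A' /B' subrr sgr0; field. Qed.

Lemma k1_bound xi : `|xi| < S -> forall t t',
  `|k1 xi t t'| <= 2 * S * (env ((`|xi| + S) / 2) t * env ((`|xi| + S) / 2) t').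
Proof.
move=> xiS t t'; set B := (_ / 2).
have [x1 x2] : - S < xi /\ xi < S by apply/andP; rewrite -ltr_norml.
have e0 : 0 <= env B t * env B t' by rewrite mulr_ge0// ltW// env_gt0.
have hA : t <= t' -> `|gam (xi - t) * A' xi t'| <= 2 * S * (env B t * env B t').
  move=> tt'; rewrite /A'; have [v /andP[v1 v2] ->] := GG_MVTB t' (ltW x1).
  have g0 : 0 <= gam (xi - t) * gam (v - t').
    by rewrite mulr_ge0// ltW// gam_gt0.
  rewrite mulrA normrM (ger0_norm g0) mulrC ler_pM//.
    by rewrite ger0_norm; lra.
  apply: gam2_le_env; first by rewrite mulr_ge0_le0// ?subr_ge0 ?subr_le0.
  rewrite (le_trans (ler_normD _ _))// /B mulrC divfK ?pnatr_eq0// lerD2l.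
  by rewrite ler_norml v1 (le_trans v2 (ltW x2)).
have hB : t' <= t -> `|gam (xi - t) * B' xi t'| <= 2 * S * (env B t * env B t').
  move=> tt'; rewrite /B'; have [v /andP[v1 v2] ->] := GG_MVTB t' (ltW x2).
  have g0 : 0 <= gam (xi - t) * gam (v - t').
    by rewrite mulr_ge0// ltW// gam_gt0.
  rewrite mulrA normrM (ger0_norm g0) mulrC ler_pM//.
    by rewrite ger0_norm; lra.
  apply: gam2_le_env; first by rewrite mulr_le0_ge0// ?subr_ge0 ?subr_le0.
  rewrite (le_trans (ler_normD _ _))// /B mulrC divfK ?pnatr_eq0// lerD2l.
  by rewrite ler_norml v2 (le_trans (ltW x1) v1).
have [tt'|tt'|tt'] := ltgtP t t'.
- by rewrite k1_lt// hA// ltW.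
- by rewrite k1_gt// normrN hB// ltW.
- rewrite -tt' k1_eq in hA hB *.
  have h1 := hA (lexx _); have h2 := hB (lexx _).
  rewrite normrM ger0_norm// ler_pdivrMl// (le_trans (ler_normB _ _))//.
  by rewrite -[2 in leRHS]/(1 + 1) mulrDl mul1r lerD.
Qed.

(** Completing the squares: the factor exp(-b^2 - b(t' - t)), b = x - u, turns
    two Gaussians centred at x + u into Gaussians centred at 2x and at 2u. *)
Lemma gauss_shear x u t t' :
  expR (- (x - u) ^+ 2 - (x - u) * (t' - t)) * (gam (x + u - t) * gam (x + u - t'))
  = gam (2 * x - t) * gam (2 * u - t').
Proof.
by rewrite !gamM mulrCA -expRD; congr (_ * expR _); field.
Qed.

(** The integrand of the Cauchy transform after integration over the
    imaginary part of w, for one pair (t, t'). *)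
Definition shear x u t t' := Num.sg (x - u) *
  expR (- (x - u) ^+ 2 - `|x - u| * `|t - t'|) *
  (gam (x + u - t) * gam (x + u - t')).

Lemma shearC x u t t' : shear x u t t' = shear x u t' t.
Proof. by rewrite /shear (distrC t); ring. Qed.

Lemma shear_le x u t t' : t <= t' -> shear x u t t' =
  (u < x)%R%:R * (gam (2 * x - t) * gam (2 * u - t')) -
  (x < u)%R%:R * (gam (2 * x - t') * gam (2 * u - t)).
Proof.
move=> tt'; have d : `|t - t'| = t' - t by rewrite distrC ger0_norm// subr_ge0.
rewrite /shear d; case: ltgtP => ux.
- rewrite gtr0_sg ?subr_gt0// gtr0_norm ?subr_gt0// mul1r gauss_shear.
  by rewrite mul1r mul0r subr0.
- rewrite ltr0_sg ?subr_lt0// ltr0_norm ?subr_lt0// mul0r sub0r mul1r mulN1r mulNr.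
  congr (- _); rewrite [X in _ * X]mulrC -gauss_shear.
  by congr (expR _ * _); ring.
- by rewrite ux subrr sgr0 !mul0r subrr.
Qed.

Lemma norm_sg_mul_le (c y : R) : `|Num.sg c * y| <= `|y|.
Proof. by rewrite normrM ler_piMl// norm_sg_le1. Qed.

Lemma shear_bound x u t t' : `|shear x u t t'| <=
  env `|x + u| t * env `|x + u| t'.
Proof.
rewrite /shear -mulrA (le_trans (norm_sg_mul_le _ _))//.
have g0 : 0 <= gam (x + u - t) * gam (x + u - t') by rewrite mulr_ge0// ltW// gam_gt0.
rewrite ger0_norm; last by rewrite mulr_ge0 ?expR_ge0.
apply: (@le_trans _ _ (gam (x + u - t) * gam (x + u - t'))).
  rewrite ler_piMl// -[leRHS]expR0 ler_expR -opprD oppr_le0.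
  by rewrite addr_ge0 ?sqr_ge0 ?mulr_ge0.
by rewrite ler_pM ?gam_le_env// ltW// gam_gt0.
Qed.

Lemma is_derive_GG2 t u : is_derive u 1 (fun u => 2^-1 * GG (2 * u - t)) (gam (2 * u - t)).
Proof.
have h : is_derive u 1 (fun u => 2 * u - t) (2 : R).
  by apply: is_derive_eq; rewrite /GRing.scale/=; ring.
have := is_derive1_comp (f := @GG R) (g := fun u => 2 * u - t).
move=> /(_ u _ _ (is_derive_GG (2 * u - t)) h) h'.
by apply: is_derive_eq; rewrite /GRing.scale/=; field.
Qed.

Lemma continuous_gam2 t : continuous (fun u => gam (2 * u - t)).
Proof.
apply: (cont_comp _ (@continuous_gam R)).
by apply: derivable_cont => u; exact: ex_derive.
Qed.

(** By gauss_shear the integral over u in [-T, x] and in [x, T] is elementary;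
    which of t, t' goes with 2x depends on the sign of x - u. *)
Lemma Rint_shear x t t' : - T < x < T ->
  \int[leb]_u (\1_`[- T, T] u * shear x u t t') =
  2^-1 * (k1 (2 * x) t t' + k1 (2 * x) t' t).
Proof.
move=> /andP[x1 x2]; wlog tt' : t t' / t <= t'.
  move=> h; have [tt'|/ltW tt'] := leP t t'; first exact: h.
  rewrite addrC -h//; apply: eq_Rint => u; by rewrite shearC.
transitivity (\int[leb]_u (
    gam (2 * x - t) * (\1_`[- T, x] u * gam (2 * u - t')) -
    gam (2 * x - t') * (\1_`[x, T] u * gam (2 * u - t)))).
  apply: eq_Rint => u; rewrite shear_le// !indic_itvE.
  case: (ltgtP u x) => ux /=.
  - have -> : (u <= T)%R = true by rewrite (le_trans (ltW ux) (ltW x2)).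
    by rewrite !andbT; ring.
  - have -> : (- T <= u)%R = true by rewrite (le_trans (ltW x1) (ltW ux)).
    by rewrite /=; ring.
  - have -> : (- T <= u)%R = true by rewrite ux ltW.
    have -> : (u <= T)%R = true by rewrite ux ltW.
    by rewrite /= ux; ring.
rewrite RintB; [|by apply: itgZl; exact: itg_cont_itv (@continuous_gam2 _)..].
rewrite !RintZl; [|by exact: itg_cont_itv (@continuous_gam2 _)..].
rewrite (Rint_FTC (ltW x1) (@continuous_gam2 t') (is_derive_GG2 t')).
rewrite (Rint_FTC (ltW x2) (@continuous_gam2 t) (is_derive_GG2 t)).
rewrite mulrN.
move: tt'; rewrite le_eqVlt => /predU1P[<-|tt'].
  by rewrite k1_eq /A' /B'; field.
by rewrite (k1_lt _ tt') (k1_gt _ tt') /A' /B'; field.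
Qed.

Lemma measurable_shear d (Z : measurableType d) x (U t t' : Z -> R) :
  measurable_fun setT U -> measurable_fun setT t -> measurable_fun setT t' ->
  measurable_fun setT (fun z => shear x (U z) (t z) (t' z)).
Proof.
move=> mU mt mt'.
have mxU : measurable_fun setT (fun z => x - U z) by exact: measurable_funB.
have mg (h : Z -> R) : measurable_fun setT h ->
    measurable_fun setT (fun z => gam (x + U z - h z)).
  move=> mh; apply: (measurableT_comp measurable_gam).
  by apply: measurable_funB => //; exact: measurable_funD.
apply: measurable_funM; last by apply: measurable_funM; exact: mg.
apply: measurable_funM; first exact: (measurableT_comp measurable_sg mxU).
apply: (measurableT_comp (@measurable_expR R)); apply: measurable_funB.
  by apply: measurableT_comp => //; exact: measurable_funX.
apply: measurable_funM; first exact: (measurableT_comp (@normr_measurable R setT) mxU).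
by apply: (measurableT_comp (@normr_measurable R setT)); exact: measurable_funB.
Qed.

Lemma itg_env2 B : adm S f -> 0 <= B < S ->
  itg (leb \x leb)%E (fun p : R * R => env B p.1 * f p.1 * (env B p.2 * f p.2)).
Proof. by move=> [mf hf] hB; exact: (itg_prod (hf _ hB) (hf _ hB)). Qed.

Let mf2 : measurable_fun setT f ->
  measurable_fun setT (fun p : R * R => f p.1 * f p.2).
Proof.
move=> mf; apply: measurable_funM.
  exact: (measurableT_comp mf measurable_fst).
exact: (measurableT_comp mf measurable_snd).
Qed.

Lemma measurable_Wk d (Z : measurableType d) (t t' : Z -> R) :
  measurable_fun setT t -> measurable_fun setT t' ->
  measurable_fun setT (fun z => Wk (t z) (t' z)).
Proof.
move=> mt mt'.
have mG a : measurable_fun setT (fun z => GG (a - t' z)).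
  by apply: (measurableT_comp measurable_GG); exact: measurable_funB.
apply: measurable_funB; last first.
  by apply: (measurableT_comp measurable_GG); exact: measurableT_comp.
apply: measurable_funD.
  by apply: measurable_funM => //; apply: measurable_funD; exact: mG.
apply: measurable_funM.
  by apply: measurable_funM => //; apply: measurable_funB; exact: mG.
by apply: (measurableT_comp measurable_sg); exact: measurable_funB.
Qed.

Lemma itg_k1 xi : adm S f -> `|xi| < S ->
  itg (leb \x leb)%E (fun p : R * R => f p.1 * f p.2 * k1 xi p.1 p.2).
Proof.
move=> af xiS; pose B := (`|xi| + S) / 2.
have hB : 0 <= B < S.
  by have := normr_ge0 xi; rewrite /B => h; apply/andP; split; lra.
apply: (itg_le (itgZl (2 * S) (itg_norm (itg_env2 af hB)))) => [|p].
  apply: measurable_funM; first exact: mf2 af.1.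
  apply: measurable_funM; first exact: (measurableT_comp (measurable_gamB xi) measurable_fst).
  apply: measurable_funB; last exact: measurable_Wk measurable_fst measurable_snd.
  apply: measurable_funB; first exact: (measurableT_comp (measurable_GGB xi) measurable_snd).
  exact: (measurableT_comp measurable_GG
    (measurableT_comp (@oppr_measurable R setT) measurable_snd)).
rewrite normrM [leRHS](_ : _ = `|f p.1 * f p.2| *
    (2 * S * (env B p.1 * env B p.2))); last first.
  rewrite normrM !norm_envM (normrM (f p.1)); ring.
by rewrite ler_wpM2l// k1_bound.
Qed.

Lemma itg_Wk t : adm S f -> 0 < T -> itg leb (fun t' => f t' * Wk t t').
Proof.
move=> af T0; have S0 : 0 < S by rewrite mulr_gt0.
have z : `|0 : R| < S by rewrite normr0.
pose B := (`|0 : R| + S) / 2; have hB : 0 <= B < S.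
  by rewrite /B normr0 add0r; apply/andP; split; lra.
pose C := (gam (0 - t))^-1 * (2 * S * env B t).
have g0 := gam_gt0 (0 - t).
apply: (itg_le (itgZl C (itg_norm (af.2 _ hB)))) => [|t'].
  apply: measurable_funM; first exact: af.1.
  by apply: measurable_Wk.
have := k1_bound z t t'; rewrite -/B /k1 !sub0r subrr sub0r norm_gamM normrN.
rewrite -ler_pdivlMl ?gam_gt0// => h.
rewrite normrM norm_envM [leRHS](_ : _ = `|f t'| *
   ((gam (- t))^-1 * (2 * S * (env B t * env B t')))); last first.
  by rewrite /C sub0r; ring.
by rewrite ler_wpM2l.
Qed.

Lemma Rint_k1 xi t : adm S f -> 0 < T -> `|xi| < S ->
  \int[leb]_t' (f t * f t' * k1 xi t t') = gam (xi - t) * (f t * (MM xi - W t)).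
Proof.
move=> af T0 xiS; rewrite /MM /W -RintB; [|exact: itg_MM|exact: itg_Wk].
rewrite -RintZl; last by apply: itgB; [exact: itg_MM|exact: itg_Wk].
rewrite -RintZl; last by apply/itgZl/itgB; [exact: itg_MM|exact: itg_Wk].
by apply: eq_Rint => t'; rewrite /k1; ring.
Qed.

Lemma measurable_W : adm S f -> measurable_fun setT W.
Proof.
move=> af; apply: (@measurable_Rint_param _ _ _ _ _ leb (fun p : R * R => f p.2 * Wk p.1 p.2)).
apply: measurable_funM; first exact: (measurableT_comp af.1 measurable_snd).
exact: measurable_Wk measurable_fst measurable_snd.
Qed.

Lemma adm_fW : adm S f -> 0 < T -> adm S (fun t => f t * W t).
Proof.
move=> af T0; apply: adm_of_gam => [|xi xiS].
  by apply: measurable_funM; [exact: af.1|exact: measurable_W].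
have h1 := itgZl (MM xi) (adm_gam af xiS).
have h2 := itg_Rint_section (itg_k1 af xiS).
apply: (eq_itg (itgB h1 h2)) => t /=.
by rewrite Rint_k1//; ring.
Qed.

Lemma itg_shear_u x t t' : itg leb (fun u => \1_`[- T, T] u * shear x u t t').
Proof.
have h := itgZl (gam0 R ^+ 2) (integrable_indic_itv (- T) T true false).
apply: (itg_le h) => [|u].
  apply: measurable_funM => //; apply: measurable_shear => //.
have i0 : 0 <= \1_`[- T, T] u :> R by rewrite indic_itvE.
rewrite normrM (ger0_norm i0) mulrC ler_wpM2r//.
rewrite /shear -mulrA (le_trans (norm_sg_mul_le _ _))// gamM mulrCA -expRD.
have g0 : 0 <= gam0 R ^+ 2 by rewrite exprn_ge0// ltW// gam0_gt0.
rewrite ger0_norm; last by rewrite mulr_ge0 ?expR_ge0.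
rewrite ler_piMr// -[leRHS]expR0 ler_expR.
have := sqr_ge0 (x - u); have := sqr_ge0 (x + u - t); have := sqr_ge0 (x + u - t').
have : 0 <= `|x - u| * `|t - t'| by rewrite mulr_ge0.
nra.
Qed.

Let itg_shear3 x : adm S f -> - T < x < T ->
  itg (@lebesgue_measure R \x prodm (@lebesgue_measure R) (@lebesgue_measure R))%E
    (fun p : R * (R * R) => \1_`[- T, T] p.1 * (f p.2.1 * f p.2.2 * shear x p.1 p.2.1 p.2.2)).
Proof.
move=> af xT; pose B := `|x| + T; have [x1 x2] : - T < x /\ x < T by apply/andP.
have xlt : `|x| < T by rewrite ltr_norml x1.
have hB : 0 <= B < S.
  by rewrite /B; have := normr_ge0 x => h; apply/andP; split; lra.
have h2 : itg (prodm (@lebesgue_measure R) (@lebesgue_measure R))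
    (fun p : R * R => `|env B p.1 * f p.1 * (env B p.2 * f p.2)|).
  exact: itg_norm (itg_env2 af hB).
have h := itg_prod (integrable_indic_itv (- T) T true false) h2.
apply: (itg_le h) => [|p].
  apply: measurable_funM; first exact: (measurableT_comp _ measurable_fst).
  apply: measurable_funM; first exact: (measurableT_comp (mf2 af.1) measurable_snd).
  apply: measurable_shear; first exact: measurable_fst.
    exact: (measurableT_comp measurable_fst measurable_snd).
  exact: (measurableT_comp measurable_snd measurable_snd).
rewrite /= indic_itvE; case: (boolP (- T <= p.1 <= T)) => pT; last by rewrite !mul0r normr0.
rewrite !mul1r normrM [leRHS](_ : _ = `|f p.2.1 * f p.2.2| *
    (env B p.2.1 * env B p.2.2)); last first.
  by rewrite normrM !norm_envM (normrM (f p.2.1)); ring.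
rewrite ler_wpM2l// (le_trans (shear_bound _ _ _ _))//.
have uB : `|x + p.1| <= B.
  by rewrite (le_trans (ler_normD _ _))// lerD2l ler_norml.
by rewrite ler_pM ?le_env// ltW// env_gt0.
Qed.

Let shear_section x u :
  \int[(leb \x leb)%E]_p (\1_`[- T, T] u * (f p.1 * f p.2 * shear x u p.1 p.2)) =
  \1_`[- T, T] u * \int[(leb \x leb)%E]_p (f p.1 * f p.2 * shear x u p.1 p.2).
Proof.
rewrite indic_itvE; case: (boolP (- T <= u <= T)) => uT.
  by rewrite mul1r; apply: eq_Rint => p; exact: mul1r.
rewrite mul0r -[RHS](Rint0 (leb \x leb)%E).
by apply: eq_Rint => p; exact: mul0r.
Qed.

Lemma itg_shear_total x : adm S f -> - T < x < T ->
  itg leb (fun u => \1_`[- T, T] u *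
     \int[(leb \x leb)%E]_p (f p.1 * f p.2 * shear x u p.1 p.2)).
Proof.
move=> af xT; apply: (eq_itg (itg_Rint_section (itg_shear3 af xT))) => u /=.
exact: shear_section.
Qed.

(** Since k1 carries the Gaussian gam (2x - t), integration over t' leaves a
    Gaussian convolution at 2x. *)
Lemma Rint_shear_total x : adm S f -> 0 < T -> - T < x < T ->
  \int[leb]_u (\1_`[- T, T] u *
     \int[(leb \x leb)%E]_p (f p.1 * f p.2 * shear x u p.1 p.2)) =
  MM (2 * x) * conv f (2 * x) - conv (fun t => f t * W t) (2 * x).
Proof.
move=> af T0 xT; have h3 := itg_shear3 af xT.
have xiS : `|2 * x| < S.
  by rewrite normrM ger0_norm// ltr_pM2l// ltr_norml.
transitivity (\int[leb]_u \int[(leb \x leb)%E]_p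
    (\1_`[- T, T] u * (f p.1 * f p.2 * shear x u p.1 p.2))).
  by apply: eq_Rint => u; rewrite shear_section.
rewrite (Rint_Fubini h3) /=.
have hk := itg_k1 af xiS.
transitivity (\int[(leb \x leb)%E]_p (2^-1 * (f p.1 * f p.2 * k1 (2 * x) p.1 p.2) +
    2^-1 * (f p.2 * f p.1 * k1 (2 * x) p.2 p.1))).
  apply: eq_Rint => p.
  transitivity (f p.1 * f p.2 * \int[leb]_u (\1_`[- T, T] u * shear x u p.1 p.2)).
    rewrite -RintZl; last exact: itg_shear_u.
    by apply: eq_Rint => u; ring.
  by rewrite Rint_shear//; ring.
have hs := itg_swap hk.
rewrite RintD; [|exact: itgZl hk|exact: itgZl hs].
rewrite RintZl// RintZl// (Rint_swap hk) Rint_Fubini1//.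
transitivity (\int[leb]_t (gam (2 * x - t) * (f t * (MM (2 * x) - W t)))).
  have halves (y : R) : 2^-1 * y + 2^-1 * y = y by field.
  rewrite halves.
  by apply: eq_Rint => t; rewrite /= Rint_k1.
have aW := adm_fW af T0.
rewrite /conv -RintZl; last exact: adm_gam af xiS.
rewrite -RintB; [|apply: itgZl; exact: adm_gam af xiS|exact: adm_gam aW xiS].
by apply: eq_Rint => t; ring.
Qed.

End Kernel.

(** * The power spectrum of an integrable window *)

Section Energy.
Context {R : realType}.
Implicit Types (g : R -> R) (a b s t : R).

Definition cosT g a s := \int[leb]_t (cos (s * (a - t)) * g t).
Definition sinT g a s := \int[leb]_t (sin (s * (a - t)) * g t).
(** The squared modulus of the Fourier transform of g at s. Counting the phase
    from a does not change the modulus. *)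
Definition energy g a s := cosT g a s ^+ 2 + sinT g a s ^+ 2.

Lemma measurable_phase a s : measurable_fun setT (fun t => s * (a - t)).
Proof. by apply: measurable_funM => //; exact: measurable_funB. Qed.

Lemma itg_cosT g a s : itg leb g -> itg leb (fun t => cos (s * (a - t)) * g t).
Proof.
move=> ig; apply: (itgMb (C := 1) ig) => [|t]; last exact: cos_max.
exact: (measurableT_comp measurable_cos (measurable_phase a s)).
Qed.

Lemma itg_sinT g a s : itg leb g -> itg leb (fun t => sin (s * (a - t)) * g t).
Proof.
move=> ig; apply: (itgMb (C := 1) ig) => [|t]; last exact: sin_max.
exact: (measurableT_comp measurable_sin (measurable_phase a s)).
Qed.

Lemma energy_ge0 g a s : 0 <= energy g a s.
Proof. by rewrite addr_ge0 ?sqr_ge0. Qed.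

Lemma energyN g a s : itg leb g -> energy g a (- s) = energy g a s.
Proof.
move=> ig; rewrite /energy; congr (_ ^+ 2 + _).
  by apply: eq_Rint => t; rewrite mulNr cosN.
rewrite -[RHS]sqrrN; congr (_ ^+ 2); rewrite -[RHS]RintN; last exact: itg_sinT.
by apply: eq_Rint => t; rewrite mulNr sinN mulNr.
Qed.

Lemma energyE g a s : itg leb g -> energy g a s =
  \int[(leb \x leb)%E]_p (cos (s * (p.1 - p.2)) * (g p.1 * g p.2)).
Proof.
move=> ig; have hc := itg_cosT a s ig; have hs := itg_sinT a s ig.
rewrite /energy !expr2 -(Rint_prod hc hc) -(Rint_prod hs hs).
rewrite -RintD; [|exact: (itg_prod hc hc)|exact: (itg_prod hs hs)].
apply: eq_Rint => p.
have -> : s * (p.1 - p.2) = s * (a - p.2) - s * (a - p.1) by ring.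
by rewrite cosB; ring.
Qed.

Lemma energy_le g a s : itg leb g -> energy g a s <= (\int[leb]_t `|g t|) ^+ 2.
Proof.
move=> ig; have hn := itg_norm ig.
rewrite expr2 -(Rint_prod hn hn) energyE//.
apply: le_trans (ler_norm _) _.
apply: norm_Rint_le => [||p]; first exact: (itg_prod hn hn).
  apply: measurable_funM; last exact: itg_measurable (itg_prod ig ig).
  apply: (measurableT_comp measurable_cos); apply: measurable_funM => //.
  by apply: measurable_funB; [exact: measurable_fst|exact: measurable_snd].
by rewrite !normrM ler_piMl ?cos_max// mulr_ge0.
Qed.

Lemma measurable_energy (G : R * R -> R) (A : R -> R) :
  measurable_fun setT G -> measurable_fun setT A ->
  measurable_fun setT (fun p : R * R => energy (fun t => G (p.1, t)) (A p.1) p.2).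
Proof.
move=> mG mA.
have mP : measurable_fun setT (fun q : (R * R) * R => q.1.2 * (A q.1.1 - q.2)).
  apply: measurable_funM; first exact: (measurableT_comp measurable_snd measurable_fst).
  apply: measurable_funB; last exact: measurable_snd.
  exact: (measurableT_comp mA (measurableT_comp measurable_fst measurable_fst)).
have mG' : measurable_fun setT (fun q : (R * R) * R => G (q.1.1, q.2)).
  apply: (measurableT_comp mG); apply/measurable_fun_pairP; split.
    exact: (measurableT_comp measurable_fst measurable_fst).
  exact: measurable_snd.
apply: measurable_funD; apply: measurable_funX.
- apply: (@measurable_Rint_param _ _ _ _ _ leb
    (fun q : (R * R) * R => cos (q.1.2 * (A q.1.1 - q.2)) * G (q.1.1, q.2))).
  by apply: measurable_funM => //; exact: (measurableT_comp measurable_cos mP).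
- apply: (@measurable_Rint_param _ _ _ _ _ leb
    (fun q : (R * R) * R => sin (q.1.2 * (A q.1.1 - q.2)) * G (q.1.1, q.2))).
  by apply: measurable_funM => //; exact: (measurableT_comp measurable_sin mP).
Qed.

Lemma itg_cauchyK b : itg leb (cauchyK b).
Proof.
by apply: (eq_itg (itg_cauchyK_cos b 0)) => s; rewrite mul0r cos0 mulr1.
Qed.

(** The triple integral over s, t and t' converges absolutely, because the
   Cauchy kernel is integrable in s. *)
Let itg3 b g : itg leb g ->
  itg (@lebesgue_measure R \x prodm (@lebesgue_measure R) (@lebesgue_measure R))%E
  (fun p : R * (R * R) =>
    cos (p.1 * (p.2.1 - p.2.2)) * (cauchyK b p.1 * (g p.2.1 * g p.2.2))).
Proof.
move=> ig.
have h2 : itg (prodm (@lebesgue_measure R) (@lebesgue_measure R))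
  (fun p => g p.1 * g p.2) by exact: itg_prod.
apply: (itgMb (C := 1) (itg_prod (itg_cauchyK b) h2)) => [|p]; last exact: cos_max.
apply: (measurableT_comp measurable_cos); apply: measurable_funM; first exact: measurable_fst.
apply: measurable_funB.
  exact: (measurableT_comp measurable_fst measurable_snd).
exact: (measurableT_comp measurable_snd measurable_snd).
Qed.

Let section3 a b g s : itg leb g ->
  \int[prodm leb leb]_p
    (cos (s * (p.1 - p.2)) * (cauchyK b s * (g p.1 * g p.2))) =
  cauchyK b s * energy g a s.
Proof.
move=> ig; rewrite energyE// -RintZl.
  by apply: eq_Rint => p; ring.
apply: (itgMb (C := 1) (itg_prod ig ig)) => [|p]; last exact: cos_max.
apply: (measurableT_comp measurable_cos); apply: measurable_funM => //.
by apply: measurable_funB; [exact: measurable_fst|exact: measurable_snd].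
Qed.

Lemma itg_cauchyK_energy a b g : itg leb g ->
  itg leb (fun s => cauchyK b s * energy g a s).
Proof.
move=> ig; apply: (eq_itg (itg_Rint_section (itg3 b ig))) => s /=.
exact: section3.
Qed.

Lemma itg_laplace_pair b g : itg leb g -> itg (@lebesgue_measure R \x @lebesgue_measure R)%E
  (fun p => Num.sg b * expR (- (`|b| * `|p.1 - p.2|)) * (g p.1 * g p.2)).
Proof.
move=> ig; apply: (itgMb (C := 1) (itg_prod ig ig)) => [|p]; last first.
  by rewrite (le_trans (norm_sg_mul_le _ _))// ger0_norm ?expR_ge0.
apply: measurable_funM => //; apply: (measurableT_comp (@measurable_expR R)).
apply: (measurableT_comp (@oppr_measurable R setT)); apply: measurable_funM => //.
apply: (measurableT_comp (@normr_measurable R setT)).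
by apply: measurable_funB; [exact: measurable_fst|exact: measurable_snd].
Qed.

(** The energy is a superposition of the cosines of s (t - t'), each of which
    integrates against the Cauchy kernel to an exponential. *)
Lemma Rint_cauchyK_energy a b g : itg leb g ->
  \int[leb]_s (cauchyK b s * energy g a s) =
  pi * \int[(leb \x leb)%E]_p
    (Num.sg b * expR (- (`|b| * `|p.1 - p.2|)) * (g p.1 * g p.2)).
Proof.
move=> ig; transitivity (\int[leb]_s \int[prodm leb leb]_p
    (cos (s * (p.1 - p.2)) * (cauchyK b s * (g p.1 * g p.2)))).
  by apply: eq_Rint => s; rewrite -section3.
rewrite (Rint_Fubini (itg3 b ig)) /= -RintZl; last exact: itg_laplace_pair.
apply: eq_Rint => p.
transitivity (\int[leb]_s (g p.1 * g p.2 * (cauchyK b s * cos ((p.1 - p.2) * s)))).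
  by apply: eq_Rint => s; rewrite (mulrC s); ring.
by rewrite RintZl ?Rint_cauchyK_cos; [ring|exact: itg_cauchyK_cos].
Qed.

Lemma itg_expN_diff e g : 0 < e -> itg leb g ->
  itg (@lebesgue_measure R \x @lebesgue_measure R)%E
    (fun p => expR (- e * `|p.2 - p.1|) * g p.1) /\
  \int[(leb \x leb)%E]_p (expR (- e * `|p.2 - p.1|) * g p.1) = 2 / e * \int[leb]_t g t.
Proof.
move=> e0 ig.
have h x : itg leb (fun y => expR (- e * `|y - x|)) := itg_shift (- x) (itg_expN e0).
have hE x : \int[leb]_y expR (- e * `|y - x|) = 2 / e.
  rewrite (Rint_shift (- x) (itg_expN e0)).
  transitivity (\int[leb]_s (expR (- e * `|s|) * cos (0 * s))).
    by apply: eq_Rint => s; rewrite mul0r cos0 mulr1.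
  by rewrite Rint_expN_cos//; field; rewrite gt_eqF.
have mE : measurable_fun setT (fun p : R * R => expR (- e * `|p.2 - p.1|)).
  apply: (measurableT_comp (@measurable_expR R)).
  apply: measurable_funM => //; apply: (measurableT_comp (@normr_measurable R setT)).
  by apply: measurable_funB; [exact: measurable_snd|exact: measurable_fst].
have hp : itg (leb \x leb)%E (fun p : R * R => expR (- e * `|p.2 - p.1|) * g p.1).
  apply: (itg_Tonelli _ _ (itgZl (2 / e) (itg_norm ig))) => [|x|x].
  - apply: measurable_funM => //.
    exact: (measurableT_comp (itg_measurable ig) measurable_fst).
  - by apply: (eq_itg (itgZl (g x) (h x))) => y; rewrite mulrC.
  - rewrite -(hE x) mulrC -RintZl//; apply: Rint_le => [||y].
    + by apply: itg_norm; apply: (eq_itg (itgZl (g x) (h x))) => y; rewrite mulrC.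
    + exact: itgZl.
    + by rewrite normrM (ger0_norm (expR_ge0 _)) mulrC.
split => //; rewrite Rint_Fubini1// -RintZl//; apply: eq_Rint => x /=.
rewrite -(hE x) mulrC -RintZl//; by apply: eq_Rint => y; rewrite mulrC.
Qed.

Lemma cauchyK_scaleE (n : nat) s :
  n.+1%:R * cauchyK n.+1%:R s = 1 - s ^+ 2 / (n.+1%:R ^+ 2 + s ^+ 2) :> R.
Proof. by rewrite /cauchyK; field; rewrite gt_eqF// sqrD_gt0. Qed.

(** A Bessel inequality: Poisson's formula at scale b bounds the integral of
    b^2 / (b^2 + s^2) times the energy, uniformly in b. *)
Lemma itg_energy a g M : itg leb g -> (forall t, `|g t| <= M) ->
  itg leb (energy g a) /\
  \int[leb]_s energy g a s <= 2 * pi * M * \int[leb]_t `|g t|.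
Proof.
move=> ig gM.
apply: (@itg_monotone_limit _ _ R leb
  (fun n s => n.+1%:R * (cauchyK n.+1%:R s * energy g a s)) (energy g a)) => [n|n s|s n m nm|s|n].
- exact/itgZl/itg_cauchyK_energy.
- by rewrite mulr_ge0// mulr_ge0 ?energy_ge0// /cauchyK divr_ge0// addr_ge0 ?sqr_ge0.
- rewrite (mulrA n.+1%:R (cauchyK _ _)) (mulrA m.+1%:R (cauchyK _ _)).
  apply: ler_wpM2r; first exact: energy_ge0.
  rewrite (cauchyK_scaleE n) (cauchyK_scaleE m) lerB//; apply: ler_wpM2l; first exact: sqr_ge0.
  by rewrite lef_pV2 ?posrE ?sqrD_gt0// lerD2r ler_pXn2r ?nnegrE// ler_nat ltnS.
- rewrite -[X in _ --> X]mul1r; under eq_cvg do rewrite (mulrA _ (cauchyK _ _)).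
  apply: cvgM; last exact: cvg_cst.
  rewrite [X in X @ _](_ : _ = fun n => 1 - s ^+ 2 / (n.+1%:R ^+ 2 + s ^+ 2)); last first.
    by apply/funext => n; exact: cauchyK_scaleE.
  rewrite -[X in _ --> X]subr0; apply: cvgB; first exact: cvg_cst.
  apply: (cvg0_squeeze (v := fun n => s ^+ 2 * n.+1%:R^-1)) => [n|].
    rewrite normrM (ger0_norm (sqr_ge0 _)) ler_wpM2l ?sqr_ge0//.
    rewrite gtr0_norm ?invr_gt0 ?sqrD_gt0// lef_pV2 ?posrE ?sqrD_gt0//.
    rewrite (@le_trans _ _ (n.+1%:R ^+ 2))//; last by rewrite lerDl sqr_ge0.
    by rewrite expr2 ler_peMr// ler1n.
  rewrite -[X in _ --> X](mulr0 (s ^+ 2)); apply: cvgMr; exact: cvg_harmonic0.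
- have n0 : 0 < n.+1%:R :> R by [].
  rewrite RintZl; last exact: itg_cauchyK_energy.
  rewrite Rint_cauchyK_energy// gtr0_sg//.
  have [hp hE] := itg_expN_diff n0 (itg_norm ig).
  have : \int[(leb \x leb)%E]_p (1 * expR (- (`|n.+1%:R : R| * `|p.1 - p.2|)) * (g p.1 * g p.2))
      <= M * (2 / n.+1%:R * \int[leb]_t `|g t|).
    rewrite -hE -RintZl//; apply: le_trans (ler_norm _) _.
    apply: norm_Rint_le => [||p]; first exact: itgZl.
      apply: measurable_funM; last exact: itg_measurable (itg_prod ig ig).
      apply: measurable_funM => //; apply: (measurableT_comp (@measurable_expR R)).
      apply: (measurableT_comp (@oppr_measurable R setT)); apply: measurable_funM => //.
      apply: (measurableT_comp (@normr_measurable R setT)).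
      by apply: measurable_funB; [exact: measurable_fst|exact: measurable_snd].
    rewrite mul1r (gtr0_norm n0) (distrC p.1) -mulNr normrM (ger0_norm (expR_ge0 _)) normrM.
    rewrite [leRHS]mulrCA; apply: ler_wpM2l; first exact: expR_ge0.
    by rewrite mulrC; apply: ler_wpM2r.
  rewrite -(ler_pM2l (pi_gt0 R)) -(ler_pM2l n0) => /le_trans; apply.
  rewrite le_eqVlt; apply/orP; left; apply/eqP; field; exact: lt0r_neq0.
Qed.

End Energy.

(** * The Ward equation along the real axis *)

Section DeriveTools.
Context {R : realType}.
Implicit Types (f g : R -> R) (a b x : R).

Lemma is_derive_div f g x a b : is_derive x 1 f a -> is_derive x 1 g b ->
  g x != 0 -> is_derive x 1 (fun x => f x / g x) ((a * g x - f x * b) / g x ^+ 2).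
Proof.
move=> df dg g0; have dV := is_deriveV g0 dg.
have h := is_deriveM df dV.
by apply: is_derive_eq; rewrite /GRing.scale/=; field.
Qed.

Lemma is_derive_dilate f x a : is_derive (2 * x) 1 f a ->
  is_derive x 1 (fun x => f (2 * x)) (2 * a).
Proof.
move=> df; have h : is_derive x 1 (fun x : R => 2 * x) (2 : R).
  by apply: is_derive_eq; rewrite /GRing.scale/=; ring.
by have := is_derive1_comp (f := f) (g := fun x => 2 * x) df h; rewrite mulrC.
Qed.

Lemma is_derive_near f g x a : (\forall y \near x, f y = g y) ->
  is_derive x 1 g a -> is_derive x 1 f a.
Proof.
move=> fg [dg eg]; split; last by rewrite -eg; exact: near_eq_derive.
by apply: near_eq_derivable dg => //; apply: filterS fg => y ->.
Qed.

Lemma itv_near (a b x : R) : a < x < b -> \forall y \near x, a < y < b.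
Proof.
move=> xab; have : x \in `]a, b[ by rewrite in_itv.
by move=> /near_in_itvoo; apply: filterS => y; rewrite in_itv.
Qed.

Lemma derive0_itv_cst f a b : (forall x, a < x < b -> is_derive x 1 f 0) ->
  forall x y, a < x < b -> a < y < b -> f x = f y.
Proof.
move=> df; suff le x y : a < x < b -> a < y < b -> x <= y -> f x = f y.
  by move=> x y hx hy; have [xy|/ltW yx] := leP x y; [exact: le|apply/esym/le].
move=> /andP[ax xb] /andP[ay yb] xy.
have inab z : x <= z <= y -> a < z < b.
  by move=> /andP[xz zy]; rewrite (lt_le_trans ax xz) (le_lt_trans zy yb).
have [||c _] := @MVT_segment R f (fun=> 0) x y xy.
- by move=> z; rewrite in_itv/= => /andP[xz zy]; apply: df; rewrite inab// !ltW.
- apply: derivable_within_continuous => z; rewrite in_itv/= => /inab hz.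
  by have [] := df z hz.
by rewrite mul0r => /eqP; rewrite subr_eq0 => /eqP.
Qed.

End DeriveTools.

Section WardReal.
Context {R : realType}.
Implicit Types x xi c : R.
Variables (T : R) (f : R -> R).
Hypotheses (T0 : 0 < T) (af : adm (2 * T) f).
Local Notation S := (2 * T).
Local Notation P := (conv f).
Local Notation N := (conv (fun t => t * f t)).
Local Notation Q := (conv (fun t => f t * W T f t)).
Hypothesis P0 : forall xi, `|xi| < S -> 0 < P xi.

(** The derivatives of Q / P and N / P, by is_derive_conv. *)
Definition dQP xi := ((conv (fun t => t * (f t * W T f t)) xi - xi * Q xi) * P xi -
  Q xi * (N xi - xi * P xi)) / P xi ^+ 2.
Definition dNP xi := ((conv (fun t => t * (t * f t)) xi - xi * N xi) * P xi -
  N xi * (N xi - xi * P xi)) / P xi ^+ 2.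

Lemma is_derive_QP xi : `|xi| < S -> is_derive xi 1 (fun xi => Q xi / P xi) (dQP xi).
Proof.
move=> xiS; apply: is_derive_div; [| |exact/lt0r_neq0/P0].
  exact: is_derive_conv (adm_fW af T0) xiS.
exact: is_derive_conv af xiS.
Qed.

Lemma is_derive_NP xi : `|xi| < S -> is_derive xi 1 (fun xi => N xi / P xi) (dNP xi).
Proof.
move=> xiS; apply: is_derive_div; [| |exact/lt0r_neq0/P0].
  exact: is_derive_conv (adm_mulX af) xiS.
exact: is_derive_conv af xiS.
Qed.

(** The Cauchy transform of the Berezin kernel, as a function of Re z. *)
Definition ctrans x := MM f (2 * x) - Q (2 * x) / P (2 * x).

Lemma norm2 x : - T < x < T -> `|2 * x| < S.
Proof. by move=> xT; rewrite normrM ger0_norm// ltr_pM2l// ltr_norml. Qed.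

Lemma is_derive_ctrans x : - T < x < T ->
  is_derive x 1 ctrans (2 * (P (2 * x) - dQP (2 * x))).
Proof.
move=> /norm2 xS.
apply: (@is_derive_dilate _ (fun xi => MM f xi - Q xi / P xi)).
exact: (is_deriveB (is_derive_MM af xS) (is_derive_QP xS)).
Qed.

Lemma is_derive_lnP x : - T < x < T ->
  is_derive x 1 (fun x => ln (P (2 * x))) (2 * (N (2 * x) / P (2 * x) - 2 * x)).
Proof.
move=> /norm2 xS; have p0 := P0 xS.
apply: (@is_derive_dilate _ (fun xi => ln (P xi))).
have := is_derive1_comp (f := @ln R) (is_derive1_ln p0) (is_derive_conv af xS).
move=> h; apply: is_derive_eq; field; exact: lt0r_neq0.
Qed.

Lemma is_derive_dlnP x : - T < x < T ->
  is_derive x 1 (fun x => 2 * (N (2 * x) / P (2 * x) - 2 * x)) (4 * (dNP (2 * x) - 1)).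
Proof.
move=> /norm2 xS.
have h : is_derive (2 * x) 1 (fun xi => 2 * (N xi / P xi - xi)) (2 * (dNP (2 * x) - 1)).
  have d := is_derive_NP xS.
  by apply: is_derive_eq; rewrite /GRing.scale/=; ring.
have := is_derive_dilate h; rewrite mulrA -natrM; exact.
Qed.

(** If (Q - N) / P has derivative 0 it equals a constant c, and Q - N - c P is
    the Gaussian convolution of f (W - t - c). *)
Lemma ward_defect : (forall xi, `|xi| < S -> dQP xi = dNP xi) <->
  exists c, forall xi, `|xi| < S -> conv (fun t => f t * (W T f t - t - c)) xi = 0.
Proof.
have aW := adm_fW af T0.
have E c xi : `|xi| < S ->
    conv (fun t => f t * (W T f t - t - c)) xi = Q xi - N xi - c * P xi.
  move=> xiS; rewrite /conv -RintZl; last exact: adm_gam af xiS.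
  rewrite -RintB; [|exact: adm_gam aW xiS|exact: adm_gam (adm_mulX af) xiS].
  rewrite -RintB; [|apply: itgB|apply: itgZl]; last 3 first.
  - exact: adm_gam aW xiS.
  - exact: adm_gam (adm_mulX af) xiS.
  - exact: adm_gam af xiS.
  by apply: eq_Rint => t; ring.
pose V xi := Q xi / P xi - N xi / P xi.
have VE c xi : `|xi| < S -> V xi = c <->
    conv (fun t => f t * (W T f t - t - c)) xi = 0.
  move=> xiS; rewrite E// /V -mulrBl; have p0 := lt0r_neq0 (P0 xiS); split.
    by move=> <-; rewrite mulfVK// subrr.
  by move=> /subr0_eq ->; rewrite mulfK.
have dV (xi : R) : `|xi| < S -> is_derive xi 1 V (dQP xi - dNP xi).
  by move=> xiS; exact: (is_deriveB (is_derive_QP xiS) (is_derive_NP xiS)).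
have S0 : `|0 : R| < S by rewrite normr0 mulr_gt0.
split=> [h|[c hc] xi xiS].
  exists (V 0) => xi xiS; apply/(VE _ _ xiS).
  apply: (@derive0_itv_cst _ V (- S) S); rewrite -?ltr_norml// => x.
  by rewrite -ltr_norml => xS; have := dV x xS; rewrite h// subrr.
apply: subr0_eq; have [_ <-] := dV xi xiS.
have Vc : \forall x \near xi, V x = c.
  move: (xiS); rewrite ltr_norml => /itv_near; apply: filterS => x.
  by rewrite -ltr_norml => xS; exact/(VE _ _ xS)/hc.
by have [_ ->] := is_derive_near Vc (is_derive_cst c xi 1).
Qed.

End WardReal.

(** * The complex picture *)

Local Open Scope complex_scope.

Section ComplexTools.
Context {R : realType}.
Implicit Types (a b c d x y s t u v : R) (z w : R[i]).

Lemma mulcE a b c d : (a +i* b) * (c +i* d) = (a * c - b * d) +i* (a * d + b * c) :> R[i].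
Proof. by []. Qed.

Lemma addcE a b c d : (a +i* b) + (c +i* d) = (a + c) +i* (b + d) :> R[i].
Proof. by []. Qed.

Lemma mulrcE x c d : x%:C * (c +i* d) = (x * c) +i* (x * d) :> R[i].
Proof. by rewrite mulcE !mul0r subr0 addr0. Qed.

Lemma oppcE a b : - (a +i* b) = (- a) +i* (- b) :> R[i].
Proof. by []. Qed.

Lemma invcE a b : (a +i* b)^-1 = (a / (a ^+ 2 + b ^+ 2)) -i* (b / (a ^+ 2 + b ^+ 2)) :> R[i].
Proof. by []. Qed.

Lemma halfcE : 2^-1 = (2^-1 : R)%:C :> R[i].
Proof. by rewrite fmorphV rmorph_nat. Qed.

Lemma realcM a b : a%:C * b%:C = (a * b)%:C :> R[i].
Proof. by rewrite mulrcE mulr0. Qed.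

Lemma realcB a b : a%:C - b%:C = (a - b)%:C :> R[i].
Proof. by rewrite rmorphB. Qed.

Lemma halfc_real a : a%:C / 2 = (a / 2)%:C :> R[i].
Proof. by rewrite halfcE realcM. Qed.

Lemma eqcP a b c d : a = c -> b = d -> a +i* b = c +i* d :> R[i].
Proof. by move=> -> ->. Qed.

Lemma sqr_normcE a b : `|a +i* b| ^+ 2 = (a ^+ 2 + b ^+ 2)%:C :> R[i].
Proof. by rewrite -add_Re2_Im2. Qed.

Lemma sqr_norm_cexp z : `|cexp z| ^+ 2 = (expR (2 * complex.Re z))%:C.
Proof.
rewrite /cexp mulrcE sqr_normcE !exprMn -mulrDr cos2Dsin2 mulr1 -expRM_natl.
by rewrite mulr_natl.
Qed.

Lemma gaussianE a s t : gaussian ((a +i* s) - t%:C) =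
  (expR (s ^+ 2 / 2) * gam (a - t))%:C * (cos (s * (a - t)) -i* sin (s * (a - t))).
Proof.
rewrite /gaussian.
have -> : - (((a +i* s) - t%:C) ^+ 2) / 2 =
    (- ((a - t) ^+ 2 - s ^+ 2) / 2) -i* (s * (a - t)).
  rewrite halfcE expr2 [_ - t%:C](_ : _ = (a - t) +i* s); last first.
    by rewrite addcE oppr0 addr0.
  rewrite (mulcE (a - t) s) oppcE [LHS]mulrC mulrcE.
  by apply: eqcP; field.
rewrite /cexp /= cosN sinN mulrA -rmorphM/=; congr (_%:C * _).
by rewrite gamE /gam0 mulrCA -expRD; congr (_ * expR _); field.
Qed.

End ComplexTools.

Section GaussConv.
Context {R : realType}.
Implicit Types (phi : R -> R[i]) (f : R -> R) (S a s t : R) (z : R[i]).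

Definition win f a t : R := gam (a - t) * f t.

Lemma itg_win S f a : adm S f -> `|a| < S -> itg leb (win f a).
Proof. exact: adm_gam. Qed.

(** The Gaussian convolution of a real window f at a + is. *)
Definition wave f a s : R[i] := (expR (s ^+ 2 / 2))%:C *
  (cosT (win f a) a s -i* sinT (win f a) a s).

Lemma gauss_convE S phi a s :
  adm S (fun t => complex.Re (phi t)) -> adm S (fun t => complex.Im (phi t)) -> `|a| < S ->
  gauss_conv phi (a +i* s) = wave (fun t => complex.Re (phi t)) a s +
    'i * wave (fun t => complex.Im (phi t)) a s.
Proof.
move=> aR aI aS; rewrite /wave /gauss_conv /cintegral.
set fr := fun t => complex.Re _; set fi := fun t => complex.Im _.
have hr := itg_win aR aS; have hi := itg_win aI aS.
have E t : gaussian ((a +i* s) - t%:C) * phi t =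
    (expR (s ^+ 2 / 2) * (cos (s * (a - t)) * win fr a t + sin (s * (a - t)) * win fi a t)) +i*
    (expR (s ^+ 2 / 2) * (cos (s * (a - t)) * win fi a t - sin (s * (a - t)) * win fr a t)).
  rewrite gaussianE mulrcE [phi t](_ : _ = fr t +i* fi t); last first.
    by rewrite /fr /fi; case: (phi t).
  by rewrite mulcE /win; apply: eqcP; ring.
have E1 : (fun t => complex.Re (gaussian ((a +i* s) - t%:C) * phi t)) = fun t =>
    expR (s ^+ 2 / 2) * (cos (s * (a - t)) * win fr a t + sin (s * (a - t)) * win fi a t).
  by apply/funext => t; rewrite E.
have E2 : (fun t => complex.Im (gaussian ((a +i* s) - t%:C) * phi t)) = fun t =>
    expR (s ^+ 2 / 2) * (cos (s * (a - t)) * win fi a t - sin (s * (a - t)) * win fr a t).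
  by apply/funext => t; rewrite E.
rewrite E1 E2.
have cr := itg_cosT a s hr; have ci := itg_cosT a s hi.
have sr := itg_sinT a s hr; have si := itg_sinT a s hi.
rewrite RintZl; last exact: itgD cr si.
rewrite RintZl; last exact: itgB ci sr.
rewrite RintD// RintB// !mulrcE mulcE addcE /cosT /sinT.
by apply: eqcP; ring.
Qed.

Lemma wave_real f a : itg leb (win f a) -> wave f a 0 = (conv f a)%:C.
Proof.
move=> hf; rewrite /wave expr0n/= mul0r expR0 mul1r; congr (_ +i* _).
  by apply: eq_Rint => t; rewrite mul0r cos0 mul1r.
apply/eqP; rewrite oppr_eq0 /sinT; apply/eqP.
rewrite -[RHS](Rint0 leb); apply: eq_Rint => t.
by rewrite mul0r sin0 mul0r.
Qed.

Lemma sqr_norm_wave f a s : `|wave f a s| ^+ 2 = (expR (s ^+ 2) * energy (win f a) a s)%:C.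
Proof.
rewrite /wave mulrcE sqr_normcE; congr (_%:C).
rewrite !exprMn sqrrN -mulrDr -expRM_natl; congr (expR _ * _).
by rewrite -mulr_natl; field.
Qed.

End GaussConv.

Section Strip.
Context {R : realType}.
Variables (T : R).
Implicit Types (h : R[i] -> R[i]) (H : R -> R) (x d : R) (z : R[i]).

(** A real function that depends on Re z only: both Wirtinger derivatives are
    half its derivative. It is real on the open strip only, hence the
    neighbourhoods. *)
Lemma real_on_strip h H z d : (forall z, Int_strip T z -> h z = (H (complex.Re z))%:C) ->
  Int_strip T z -> is_derive (complex.Re z) 1 H d ->
  [/\ has_partials h z, dbar h z = (2^-1 * d)%:C & d_ h z = (2^-1 * d)%:C].
Proof.
move=> hH zT dH.
have nearT : \forall s \near complex.Re z, - T < s < T by exact: itv_near.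
have dxR : is_derive (complex.Re z) 1 (fun s : R => complex.Re (h (s +i* complex.Im z))) d.
  by apply: is_derive_near dH; apply: filterS nearT => s sT; rewrite hH.
have dxI : is_derive (complex.Re z) 1 (fun s : R => complex.Im (h (s +i* complex.Im z))) 0.
  apply: is_derive_near (is_derive_cst 0 _ _).
  by apply: filterS nearT => s sT; rewrite hH.
have dyR : is_derive (complex.Im z) 1 (fun s : R => complex.Re (h (complex.Re z +i* s))) 0.
  rewrite (_ : (fun s => _) = fun=> H (complex.Re z)); first exact: is_derive_cst.
  by apply/funext => s; rewrite hH.
have dyI : is_derive (complex.Im z) 1 (fun s : R => complex.Im (h (complex.Re z +i* s))) 0.
  rewrite (_ : (fun s => _) = fun=> 0); first exact: is_derive_cst.
  by apply/funext => s; rewrite hH.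
have [e1 v1] := dxR; have [e2 v2] := dxI; have [e3 v3] := dyR; have [e4 v4] := dyI.
have px : partial_x h z = d%:C by rewrite /partial_x !derive1E v1 v2.
have py : partial_y h z = 0 by rewrite /partial_y !derive1E v3 v4.
split; first exact: (And4 e1 e2 e3 e4).
  by rewrite /dbar px py mulr0 addr0 halfcE -rmorphM.
by rewrite /d_ px py mulr0 subr0 halfcE -rmorphM.
Qed.

End Strip.

(** * The Cauchy transform of the Berezin kernel, computed *)

Section Berezin.
Context {R : realType}.
Variables (T : R) (f : R -> R) (Phi : R[i] -> R[i]).
Local Notation S := (2 * T).
Local Notation P := (conv f).
Implicit Types (x y u v s : R) (z w : R[i]).
Hypotheses (T0 : 0 < T) (af : adm S f).
Hypothesis PhiE : forall a s, `|a| < S -> Phi (a +i* s) = wave f a s.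

(** The squared modulus of K(z, w), with x = Re z, u = Re w, s = Im z - Im w. *)
Definition kern x u s := expR (- (x - u) ^+ 2) * energy (win f (x + u)) (x + u) s.

Lemma mem_strip w : strip T w -> \1_(strip T) w = 1 :> R[i].
Proof. by move=> wT; rewrite indicE mem_set. Qed.

Lemma Int_stripW z : Int_strip T z -> strip T z.
Proof. by move=> /andP[h1 h2]; apply/andP; split; exact: ltW. Qed.

Lemma one_pointE z : Int_strip T z -> one_point T Phi z = (P (2 * complex.Re z))%:C.
Proof.
move=> zT; rewrite /one_point mem_strip ?mulr1; last exact: Int_stripW.
have xS := norm2 zT.
rewrite -(wave_real (itg_win af xS)) -PhiE//; congr Phi.
by case: z {zT xS} => x y; rewrite /= addcE subrr; apply: eqcP => //; rewrite mulr_natl mulr2n.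
Qed.

Lemma norm_sum x u : - T < x < T -> - T <= u <= T -> `|x + u| < S.
Proof.
move=> /andP[x1 x2] /andP[u1 u2]; rewrite ltr_norml.
by apply/andP; split; lra.
Qed.

Lemma Re_phase x y u v : complex.Re ((x +i* y) * (u +i* v)^* -
    `|x +i* y| ^+ 2 / 2 - `|u +i* v| ^+ 2 / 2) =
  x * u + y * v - (x ^+ 2 + y ^+ 2) / 2 - (u ^+ 2 + v ^+ 2) / 2.
Proof.
rewrite !sqr_normcE !halfc_real /=.
by rewrite mulrN opprK.
Qed.

Lemma sqr_norm_K z w : Int_strip T z -> strip T w ->
  `|K T Phi z w| ^+ 2 =
  (kern (complex.Re z) (complex.Re w) (complex.Im z - complex.Im w))%:C.
Proof.
move=> zT wT; have zw := norm_sum zT wT.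
rewrite /K (mem_strip wT) (mem_strip (Int_stripW zT)) !mulr1 normrM exprMn.
case: z w {zT wT} zw => [x y] [u v] zw.
have -> : (x +i* y) + (u +i* v)^* = (x + u) +i* (y - v) by [].
have zw' : `|x + u| < S := zw.
rewrite /G sqr_norm_cexp Re_phase (PhiE _ zw') sqr_norm_wave realcM.
rewrite [complex.Re _]/= [complex.Re (u +i* v)]/=.
congr (_%:C); rewrite /kern mulrA; congr (_ * _); rewrite -expRD; congr expR.
by rewrite /=; field.
Qed.

Lemma berezin_div z w : Int_strip T z -> strip T w ->
  let b := complex.Re z - complex.Re w in let s := complex.Im z - complex.Im w in
  berezin T Phi z w / (z - w) =
  ((P (2 * complex.Re z))^-1 *
     (cauchyK b s * kern (complex.Re z) (complex.Re w) s)) +i*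
  - ((P (2 * complex.Re z))^-1 *
     (s / (b ^+ 2 + s ^+ 2) * kern (complex.Re z) (complex.Re w) s)).
Proof.
move=> zT wT b s; rewrite /berezin one_pointE// sqr_norm_K// -/s -fmorphV -rmorphM/=.
rewrite [z - w](_ : _ = b +i* s); last by rewrite /b /s; case: z w {zT wT b s} => [x y] [u v].
rewrite invcE mulrcE /cauchyK; apply: eqcP; ring.
Qed.

Local Notation D := (@of_pair R @^-1` strip T).

Lemma indic_strip (p : R * R) : \1_D p = \1_`[- T, T] p.1 :> R.
Proof.
rewrite !indicE; congr (nat_of_bool _)%:R; apply/idP/idP; rewrite !inE/= in_itv//.
Qed.

Lemma measurable_strip : measurable (D : set (measurableTypeR R * measurableTypeR R)).
Proof.
have -> : D = fst @^-1` (`[- T, T]%classic : set R).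
  by apply/seteqP; split => p /=; rewrite in_itv.
by rewrite -[X in measurable X]setTI; apply: measurable_fst.
Qed.

(** The real part, and the imaginary part up to sign, of the integrand of the
    Cauchy transform, without the factor 1 / R(z). *)
Definition re_kern x y (p : R * R) := \1_`[- T, T] p.1 *
  (cauchyK (x - p.1) (y - p.2) * kern x p.1 (y - p.2)).
Definition im_kern x y (p : R * R) := \1_`[- T, T] p.1 *
  ((y - p.2) / ((x - p.1) ^+ 2 + (y - p.2) ^+ 2) * kern x p.1 (y - p.2)).

Lemma kernelE z (p : R * R) : Int_strip T z ->
  (\1_D p * complex.Re (berezin T Phi z (of_pair p) / (z - of_pair p)) =
   (P (2 * complex.Re z))^-1 * re_kern (complex.Re z) (complex.Im z) p) /\
  (\1_D p * complex.Im (berezin T Phi z (of_pair p) / (z - of_pair p)) =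
   - (P (2 * complex.Re z))^-1 * im_kern (complex.Re z) (complex.Im z) p).
Proof.
move=> zT; rewrite /re_kern /im_kern indic_strip indic_itvE.
case: (boolP (- T <= p.1 <= T)) => pT; last by rewrite !mul0r !mulr0.
have := @berezin_div z (of_pair p) zT pT => /= ->.
by rewrite !mul1r /= mulNr.
Qed.

Lemma dA_integrableE z : Int_strip T z -> P (2 * complex.Re z) != 0 ->
  dA_integrable (strip T) (fun w => berezin T Phi z w / (z - w)) <->
  itg (@lebesgue_measure R \x @lebesgue_measure R)%E (re_kern (complex.Re z) (complex.Im z)) /\
  itg (@lebesgue_measure R \x @lebesgue_measure R)%E (im_kern (complex.Re z) (complex.Im z)).
Proof.
move=> zT p0; rewrite /dA_integrable /cintegrable.
have mD := measurable_strip.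
split=> -[h1 h2].
- move/(itg_indic _ _ mD): h1 => h1; move/(itg_indic _ _ mD): h2 => h2; split.
    apply: (eq_itg (itgZl (P (2 * complex.Re z)) h1)) => p.
    by rewrite (kernelE p zT).1 mulrA mulfV// mul1r.
  apply: (eq_itg (itgZl (- P (2 * complex.Re z)) h2)) => p.
  by rewrite (kernelE p zT).2 mulrA mulrNN mulfV// mul1r.
- split; apply/(itg_indic _ _ mD).
    apply: (eq_itg (itgZl (P (2 * complex.Re z))^-1 h1)) => p.
    by rewrite (kernelE p zT).1.
  apply: (eq_itg (itgZl (- (P (2 * complex.Re z))^-1) h2)) => p.
  by rewrite (kernelE p zT).2.
Qed.

Lemma Rint_re_kern x y : - T < x < T ->
  itg (@lebesgue_measure R \x @lebesgue_measure R)%E (re_kern x y) ->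
  \int[(leb \x leb)%E]_p re_kern x y p =
  pi * (MM f (2 * x) * P (2 * x) - conv (fun t => f t * W T f t) (2 * x)).
Proof.
move=> xT hk; rewrite Rint_Fubini1// -(Rint_shear_total af T0 xT).
transitivity (\int[leb]_u (pi * (\1_`[- T, T] u *
     \int[(leb \x leb)%E]_p (f p.1 * f p.2 * shear x u p.1 p.2)))).
  apply: eq_Rint => u; rewrite /re_kern /= indic_itvE.
  case: (boolP (- T <= u <= T)) => uT; last first.
    rewrite !mul0r mulr0 -[RHS](Rint0 leb); apply: eq_Rint => v; exact: mul0r.
  have hw := itg_win af (norm_sum xT uT).
  have hs := itgZl (expR (- (x - u) ^+ 2)) (itg_cauchyK_energy (x + u) (x - u) hw).
  transitivity (\int[leb]_s (expR (- (x - u) ^+ 2) *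
      (cauchyK (x - u) s * energy (win f (x + u)) (x + u) s))).
    rewrite -(Rint_reflect y hs); apply: eq_Rint => v; rewrite mul1r /kern; ring.
  rewrite RintZl; last exact: itg_cauchyK_energy.
  rewrite Rint_cauchyK_energy// mul1r mulrCA; congr (_ * _).
  rewrite -RintZl.
    apply: eq_Rint => p; rewrite /shear /win expRD -[`|x - u|]opprK !mulNr opprK.
    ring.
  exact: itg_laplace_pair.
exact/RintZl/itg_shear_total.
Qed.

(** The imaginary part of the integrand is odd in s = y - v. *)
Lemma Rint_im_kern x y :
  (forall u, - T <= u <= T -> itg leb (win f (x + u))) ->
  itg (@lebesgue_measure R \x @lebesgue_measure R)%E (im_kern x y) ->
  \int[(leb \x leb)%E]_p im_kern x y p = 0.
Proof.
move=> hw hk; rewrite Rint_Fubini1// -[RHS](Rint0 leb).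
apply: ae_Rint => //; first exact: itg_Rint_section.
apply: ae_lebS (itg_section hk) => u hu.
have hr := itg_reflect y hu.
rewrite -(Rint_reflect y hu); apply: (Rint_odd hr) => s.
rewrite /im_kern /=.
have -> : y - (y - s) = s by ring.
have -> : y - (y - - s) = - s by ring.
rewrite indic_itvE; case: (boolP (- T <= u <= T)) => uT; last by rewrite !mul0r oppr0.
by rewrite /kern (energyN _ _ (hw u uT)) sqrrN; ring.
Qed.

End Berezin.

Section WardComplex.
Context {R : realType}.
Variables (T : R) (f : R -> R) (Phi : R[i] -> R[i]).
Local Notation S := (2 * T).
Local Notation P := (conv f).
Implicit Types (x y u v s : R) (z w : R[i]).
Hypotheses (T0 : 0 < T) (af : adm S f).
Hypothesis PhiE : forall a s, `|a| < S -> Phi (a +i* s) = wave f a s.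
Hypothesis P0 : forall xi, `|xi| < S -> 0 < P xi.
Hypothesis dAI : forall z, Int_strip T z ->
  dA_integrable (strip T) (fun w => berezin T Phi z w / (z - w)).

Lemma cauchyE z : Int_strip T z -> Defs.cauchy T Phi z = (ctrans T f (complex.Re z))%:C.
Proof.
move=> zT; have p0 := lt0r_neq0 (P0 (norm2 zT)).
have [hr hi] := (dA_integrableE af PhiE zT p0).1 (dAI zT).
rewrite /Defs.cauchy /dA_integral /cintegral mulrcE.
rewrite (Rint_indic leb2 (@of_pair R @^-1` strip T) (fun p => complex.Re _)).
rewrite (Rint_indic leb2 (@of_pair R @^-1` strip T) (fun p => complex.Im _)).
have -> : \int[leb2]_p (\1_(@of_pair R @^-1` strip T) p *
    complex.Re (berezin T Phi z (of_pair p) / (z - of_pair p))) =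
    (P (2 * complex.Re z))^-1 * (pi * (MM f (2 * complex.Re z) * P (2 * complex.Re z) -
       conv (fun t => f t * W T f t) (2 * complex.Re z))).
  rewrite -(Rint_re_kern T0 af zT hr) -RintZl//.
  by apply: eq_Rint => p; rewrite (kernelE af PhiE p zT).1.
have -> : \int[leb2]_p (\1_(@of_pair R @^-1` strip T) p *
    complex.Im (berezin T Phi z (of_pair p) / (z - of_pair p))) = 0.
  transitivity (- (P (2 * complex.Re z))^-1 *
      \int[(leb \x leb)%E]_p im_kern T f (complex.Re z) (complex.Im z) p).
    by rewrite -RintZl//; apply: eq_Rint => p; rewrite (kernelE af PhiE p zT).2.
  rewrite Rint_im_kern ?mulr0// => u uT.
  exact: (itg_win af (norm_sum zT uT)).
rewrite mulr0; congr (_ +i* _); rewrite /ctrans.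
by rewrite (mulrCA pi^-1) (mulKf (lt0r_neq0 (pi_gt0 R))); field.
Qed.

(** With C = MM - Q / P and log R = ln P, both at 2 Re z, the terms P and 1
    cancel and the equation becomes (Q / P)' = (N / P)'. *)
Lemma ward_equation z : Int_strip T z -> has_partials (Defs.cauchy T Phi) z /\
  (dbar (Defs.cauchy T Phi) z = one_point T Phi z - 1 -
     Delta (fun x : R[i] => (ln (complex.Re (one_point T Phi x)))%:C) z <->
   dQP T f (2 * complex.Re z) = dNP f (2 * complex.Re z)).
Proof.
move=> zT.
have [hp -> _] := real_on_strip cauchyE zT (is_derive_ctrans T0 af P0 zT).
split=> //.
pose L (x : R[i]) := (ln (complex.Re (one_point T Phi x)))%:C.
have LE w : Int_strip T w -> L w = (ln (P (2 * complex.Re w)))%:C.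
  by move=> wT; rewrite /L (one_pointE af PhiE).
pose dL x := 2^-1 * (2 * (conv (fun t => t * f t) (2 * x) / P (2 * x) - 2 * x)).
have dLE w : Int_strip T w -> dbar L w = (dL (complex.Re w))%:C.
  by move=> wT; have [] := real_on_strip LE wT (is_derive_lnP af P0 wT).
have ddL : is_derive (complex.Re z) 1 dL (2^-1 * (4 * (dNP f (2 * complex.Re z) - 1))).
  have d := is_derive_dlnP af P0 zT.
  by apply: is_derive_eq; rewrite /GRing.scale/=; ring.
have [_ _ e] := real_on_strip dLE zT ddL.
rewrite /Delta e (one_pointE af PhiE)//.
have -> : (P (2 * complex.Re z))%:C - 1 -
   (2^-1 * (2^-1 * (4 * (dNP f (2 * complex.Re z) - 1))))%:C =
   (P (2 * complex.Re z) - dNP f (2 * complex.Re z))%:C.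
  by rewrite (_ : 1 = (1 : R)%:C)// !realcB; congr (_%:C); field.
split=> [e2|->]; last by congr (_%:C); field.
  have h := complexI e2; have : 2^-1 * (2 * (P (2 * complex.Re z) - dQP T f (2 * complex.Re z))) =
    P (2 * complex.Re z) - dQP T f (2 * complex.Re z) by field.
  by rewrite h => /addrI/oppr_inj.
Qed.

End WardComplex.

(** * Windows of moderate increase, and the windows 1_I / F *)

Section Windows.
Context {R : realType}.
Implicit Types (f k psi : R -> R) (phi : R -> R[i]) (S t xi : R).

Lemma adm_bounded S f k C : adm S f -> measurable_fun setT k -> (forall t, `|k t| <= C) ->
  adm S (fun t => f t * k t).
Proof.
move=> [mf hf] mk kC; split => [|A hA]; first exact: measurable_funM.
by apply: (eq_itg (itgMb (hf A hA) mk kC)) => t; ring.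
Qed.

Lemma env_exp A m t : env A t * expR (m * `|t|) = env (A + m) t.
Proof. by rewrite envE -mulrA -expRD mulrDl addrA. Qed.

Lemma env_bounded A t : env A t <= gam0 R * expR (A ^+ 2 / 2).
Proof.
rewrite envE ler_pM2l ?gam0_gt0// ler_expR.
have e : t ^+ 2 = `|t| ^+ 2 by rewrite real_normK ?num_real.
by have h2 := sqr_ge0 (`|t| - A); nra.
Qed.

(** A power of 1 + |t| is absorbed by the exponential of |t|. *)
Lemma adm_moderate_real S f n : measurable_fun setT f ->
  itg leb (fun t => f t / (1 + `|t|) ^+ n) -> adm S f.
Proof.
move=> mf hf; split=> // A _.
have p0 t : 0 < (1 + `|t|) ^+ n by rewrite exprn_gt0// ltr_wpDr.
apply: (@eq_itg _ _ R leb (fun t => (env A t * (1 + `|t|) ^+ n) * (f t / (1 + `|t|) ^+ n))).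
  apply: (itgMb (C := gam0 R * expR ((A + n%:R) ^+ 2 / 2)) hf) => [|t].
    apply: measurable_funM; first exact: measurable_env.
    by apply: measurable_funX; apply: measurable_funD => //; exact: normr_measurable.
  rewrite norm_envM (gtr0_norm (p0 t)) (le_trans _ (env_bounded _ t))//.
  rewrite -env_exp ler_pM2l ?env_gt0// expRM_natl.
  have h : 1 + `|t| <= expR `|t| := expR_ge1Dx _.
  by apply: lerXn2r => //; rewrite nnegrE ?addr_ge0 ?expR_ge0.
by move=> t; rewrite -mulrA (mulrC (_ ^+ _)) mulfVK// lt0r_neq0.
Qed.

Lemma adm_moderate S phi : measurable_fun setT (fun t => complex.Re (phi t)) ->
  measurable_fun setT (fun t => complex.Im (phi t)) -> moderate_increase phi ->
  adm S (fun t => complex.Re (phi t)) /\ adm S (fun t => complex.Im (phi t)).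
Proof.
move=> mr mi [n [hr hi]].
have E t : phi t / ((1 + `|t|) ^+ n)%:C =
    (complex.Re (phi t) / (1 + `|t|) ^+ n) +i* (complex.Im (phi t) / (1 + `|t|) ^+ n).
  rewrite -fmorphV mulrC; case: (phi t) => a b; rewrite mulrcE; apply: eqcP; exact: mulrC.
have ER : (fun t => complex.Re (phi t / ((1 + `|t|) ^+ n)%:C)) =
    fun t => complex.Re (phi t) / (1 + `|t|) ^+ n by apply/funext => t; rewrite E.
have EI : (fun t => complex.Im (phi t / ((1 + `|t|) ^+ n)%:C)) =
    fun t => complex.Im (phi t) / (1 + `|t|) ^+ n by apply/funext => t; rewrite E.
rewrite ER in hr; rewrite EI in hi.
by split; [exact: adm_moderate_real mr hr|exact: adm_moderate_real mi hi].
Qed.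

Lemma exp_itg_adm psi : (forall S, adm S psi) -> exp_itg (fun t => gam t * psi t).
Proof.
move=> apsi m; have [mp hp] := apsi (`|m| + 1).
have hm : 0 <= `|m| < `|m| + 1 by rewrite normr_ge0 ltrDl ltr01.
apply: (itg_le (itg_norm (hp _ hm))) => [|t].
  apply: measurable_funM; last by apply: measurable_funM => //; exact: measurable_gam.
  by apply: measurable_expM; apply: measurable_funM => //; exact: normr_measurable.
rewrite normrM (ger0_norm (expR_ge0 _)) norm_gamM norm_envM mulrA ler_wpM2r//.
rewrite gamE envE mulrCA -expRD ler_pM2l ?gam0_gt0// ler_expR addrC lerD2l.
by rewrite ler_wpM2r// ler_norm.
Qed.

(** The Gaussian convolution of psi is, up to a Gaussian factor, the Laplace
    transform of the Gaussian times psi. *)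
Lemma conv_uniq psi S : (forall S, adm S psi) -> 0 < S ->
  (forall xi, `|xi| < S -> conv psi xi = 0) ->
  {ae (@lebesgue_measure R), forall t, psi t = 0}.
Proof.
move=> ap S0 h0.
have hQ xi : 0 < xi < S -> \int[leb]_t (expR (xi * t) * (gam t * psi t)) = 0.
  move=> /andP[xi0 xiS]; have := h0 xi; rewrite gtr0_norm// => /(_ xiS).
  have hx : `|xi| < S by rewrite gtr0_norm.
  have e0 := expR_gt0 (- xi ^+ 2 / 2).
  move=> /(congr1 ( *%R (expR (- xi ^+ 2 / 2))^-1)); rewrite mulr0 => {1}<-.
  rewrite /conv -RintZl; last exact: adm_gam (ap S) hx.
  apply: eq_Rint => t; rewrite gam_env_shift !mulrA mulVf ?mul1r//.
  exact: lt0r_neq0.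
apply: ae_lebS (laplace_uniq (exp_itg_adm ap) S0 hQ) => t /eqP.
by rewrite mulf_eq0 gt_eqF ?gam_gt0// => /eqP.
Qed.

End Windows.

Section Density.
Context {R : realType}.
Variable T : R.
Hypothesis T0 : 0 < T.
Local Notation S := (2 * T).
Local Notation F := (FF T).
Implicit Types (f k psi : R -> R) (t xi B : R) (I : set R).

Let S0 : 0 < S. Proof. by rewrite mulr_gt0. Qed.

Lemma GG_nondecreasing (a b : R) : a <= b -> GG a <= GG b.
Proof.
move=> ab; rewrite -subr_ge0; have [c _ ->] := GG_MVT ab.
by rewrite mulr_ge0 ?subr_ge0// ltW// gam_gt0.
Qed.

Lemma FF_gt0 t : 0 < F t.
Proof.
have SS : - S < S by rewrite (lt_trans _ S0)// oppr_lt0.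
have [c _] := GG_MVTB t (ltW SS).
by rewrite /FF => ->; rewrite mulr_gt0 ?gam_gt0// subr_gt0.
Qed.

Lemma FF_env t : `|F t| <= 2 * S * env S t.
Proof. by apply: GGB_env; rewrite ?normrN ger0_norm// ltW. Qed.

Lemma measurable_FF : measurable_fun setT F.
Proof. by apply: measurable_funB; exact: measurable_GGB. Qed.

Lemma FF_ge_mass t v1 v2 : - S <= v1 -> v1 <= v2 -> v2 <= S ->
  exists2 c, v1 <= c <= v2 & gam (c - t) * (v2 - v1) <= F t.
Proof.
move=> v1S v12 v2S; have [c cv e] := GG_MVTB t v12; exists c => //.
by rewrite -e /FF lerB// GG_nondecreasing// lerD2r.
Qed.

(** F decays like the Gaussians centred near the endpoints, hence more slowly
    than a Gaussian centred inside. *)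
Lemma gam_div_FF B xi t : `|xi| <= B -> B < S ->
  gam (xi - t) / F t <=
  2 / (S - B) * expR (S ^+ 2 / 2) * expR (- ((S - B) / 2) * `|t|).
Proof.
move=> xiB BS; set d := (S - B) / 2.
have d0 : 0 < d by rewrite /d; lra.
have -> : 2 / (S - B) = d^-1 by rewrite /d invf_div.
move: (xiB); rewrite ler_norml => /andP[xi1 xi2].
have B0 : 0 <= B by exact: le_trans xiB.
rewrite ler_pdivrMr ?FF_gt0//.
have [c [cS cm ct]] : exists c, [/\ `|c| <= S, gam (c - t) * d <= F t &
    d * `|t| <= (c - xi) * t].
  have [t0|t0] := leP 0 t.
    case: (@FF_ge_mass t (S - d) S); [by rewrite /d; lra|by rewrite /d; lra|by []|move=> c /andP[c1 c2] cm].
    exists c; split.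
    - by rewrite ler_norml; apply/andP; split; move: c1 c2; rewrite /d; lra.
    - by rewrite (_ : d = S - (S - d))//; ring.
    - rewrite (ger0_norm t0); apply: ler_wpM2r => //.
      by move: c1; rewrite /d; lra.
  case: (@FF_ge_mass t (- S) (- S + d)); [by []|by rewrite /d; lra|by rewrite /d; lra|move=> c /andP[c1 c2] cm].
  exists c; split.
  - by rewrite ler_norml; apply/andP; split; move: c1 c2; rewrite /d; lra.
  - by rewrite (_ : d = - S + d - - S)//; ring.
  - rewrite (ltr0_norm t0) mulrN -mulNr; apply: ler_wnM2r; first exact: ltW.
    by move: c2; rewrite /d; lra.
apply: (@le_trans _ _ (d^-1 * expR (S ^+ 2 / 2) * expR (- d * `|t|) * (gam (c - t) * d))); last first.
  by rewrite ler_wpM2l// !mulr_ge0 ?expR_ge0// invr_ge0 ltW.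
rewrite [leRHS](_ : _ = expR (S ^+ 2 / 2) * expR (- d * `|t|) * gam (c - t)); last first.
  by field; rewrite gt_eqF.
rewrite gamE mulrCA ler_pM2l ?gam0_gt0// -!expRD ler_expR.
have c2 : c ^+ 2 <= S ^+ 2.
  rewrite -[leLHS]real_normK ?num_real// ler_pXn2r ?nnegrE//; exact: le_trans cS.
by have h := sqr_ge0 xi; nra.
Qed.

(** The window of H_(I,T). *)
Definition wind I t : R := \1_I t / F t.

Lemma wind_ge0 I t : 0 <= wind I t.
Proof. by rewrite divr_ge0 ?(ltW (FF_gt0 t))// indicE. Qed.

(** An integrable bound for the windows gam (xi - t) wind I t, uniform in
    |xi| <= B < S. *)
Definition wbound B : R := 2 / (S - B) * expR (S ^+ 2 / 2).
Definition wdom B t : R := wbound B * expR (- ((S - B) / 2) * `|t|).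

Lemma wbound_gt0 B : B < S -> 0 < wbound B.
Proof. by move=> BS; rewrite mulr_gt0 ?expR_gt0// divr_gt0// subr_gt0. Qed.

Lemma itg_wdom B : B < S -> itg leb (wdom B).
Proof. by move=> BS; apply: itgZl; apply: itg_expN; lra. Qed.

Lemma wdom_le B t : B < S -> wdom B t <= wbound B.
Proof.
move=> BS; rewrite /wdom ler_piMr ?(ltW (wbound_gt0 BS))//.
by rewrite -[leRHS]expR0 ler_expR mulNr oppr_le0 mulr_ge0//; lra.
Qed.

Lemma win_wind_le I B xi t : `|xi| <= B -> B < S -> `|win (wind I) xi t| <= wdom B t.
Proof.
move=> xiB BS; rewrite /win norm_gamM ger0_norm ?wind_ge0// /wind mulrCA.
rewrite (le_trans _ (gam_div_FF t xiB BS))//.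
by rewrite ler_piMl ?divr_ge0 ?(ltW (gam_gt0 _)) ?(ltW (FF_gt0 _)).
Qed.

Lemma measurable_wind I : measurable I -> measurable_fun setT (wind I).
Proof.
move=> mI; apply: measurable_funM; first exact: measurable_indic.
apply: continuous_measurable_fun => t; apply: cvgV; first exact: lt0r_neq0 (FF_gt0 t).
have c a : continuous (fun u : R => GG (a - u)).
  apply: (cont_comp _ (@continuous_GG R)).
  by apply: derivable_cont => u; exact: ex_derive.
by apply: cvgB; exact: c.
Qed.

Lemma adm_wind I : measurable I -> adm S (wind I).
Proof.
move=> mI; apply: adm_of_gam => [|xi xiS]; first exact: measurable_wind.
apply: (itg_le (itg_wdom xiS)) => [|t].
  by apply: measurable_funM; [exact: measurable_gamB|exact: measurable_wind].
exact: win_wind_le.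
Qed.

Lemma norm_Wk t t' : `|Wk T t t'| <= 2 * S * env S t'.
Proof.
have e0 : 0 <= 2 * S * env S t' by rewrite mulr_ge0 ?(ltW (env_gt0 _ _))// mulr_ge0// ltW.
set s := Num.sg (t - t'); have : `|s| <= 1 := norm_sg_le1 _.
rewrite ler_norml => /andP[s1 s2].
have -> : Wk T t t' = 2^-1 * (1 + s) * (GG (S - t') - GG (0 - t')) +
    2^-1 * (1 - s) * (GG (- S - t') - GG (0 - t')).
  by rewrite /Wk /FF -/s sub0r; field.
have h1 : `|GG (S - t') - GG (0 - t')| <= 2 * S * env S t'.
  by apply: GGB_env; rewrite ?normr0 ?ger0_norm// ltW.
have h2 : `|GG (- S - t') - GG (0 - t')| <= 2 * S * env S t'.
  by apply: GGB_env; rewrite ?normr0 ?normrN ?ger0_norm// ltW.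
rewrite (le_trans (ler_normD _ _))// !normrM.
rewrite (@ger0_norm _ 2^-1)// (@ger0_norm _ (1 + s)); last by lra.
rewrite (@ger0_norm _ (1 - s)); last by lra.
set X := `|_ - _| in h1 *; set Y := `|_ - _| in h2 *; nra.
Qed.

Lemma norm_W_le f : (forall S, adm S f) -> exists C, forall t, `|W T f t| <= C.
Proof.
move=> af; have hS : 0 <= S < S + 1 by rewrite ltW//= ltrDl.
have [mf hf] := af (S + 1); have hn := itgZl (2 * S) (itg_norm (hf _ hS)).
exists (\int[leb]_t (2 * S * `|env S t * f t|)) => t.
apply: norm_Rint_le => [||t'] //.
  by apply: measurable_funM => //; exact: measurable_Wk.
rewrite normrM norm_envM mulrA mulrC ler_wpM2r//; exact: norm_Wk.
Qed.

Lemma itg_fFF f : (forall S, adm S f) -> itg leb (fun t => f t * F t).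
Proof.
move=> af; have hS : 0 <= S < S + 1 by rewrite ltW//= ltrDl.
have [mf hf] := af (S + 1); have hn := itgZl (2 * S) (itg_norm (hf _ hS)).
apply: (itg_le hn) => [|t]; first by apply: measurable_funM => //; exact: measurable_FF.
by rewrite normrM norm_envM mulrA mulrC ler_wpM2r// FF_env.
Qed.

Lemma W_increment f t t0 : adm S f -> W T f t - W T f t0 =
  \int[leb]_t' (oitv t0 t t' * (f t' * F t')).
Proof.
move=> af; rewrite /W -RintB; [|exact: itg_Wk af T0|exact: itg_Wk af T0].
by apply: eq_Rint => t'; rewrite /Wk /oitv; ring.
Qed.

End Density.

(** * The zero set of the defect is an interval *)

Section ZeroSet.
Context {R : realType}.
Implicit Types (h V : R -> R) (a b p q r t x : R).

Lemma norm_oitv_indic a b t : a <= b -> `|oitv a b t| <= \1_`[a, b] t.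
Proof.
move=> ab; rewrite indic_itvE; have [tab|] := boolP (a <= t <= b).
  exact: norm_oitv.
rewrite negb_and -!ltNge => /orP[ta|bt].
  by rewrite /oitv !gtr0_sg ?subr_gt0 ?(lt_le_trans ta)// subrr mulr0 normr0.
by rewrite /oitv !ltr0_sg ?subr_lt0 ?(le_lt_trans ab)// subrr mulr0 normr0.
Qed.

Lemma continuous_of_increment V h : itg leb h ->
  (forall x y, V y - V x = \int[leb]_t (oitv x y t * h t)) -> continuous V.
Proof.
move=> hh hV x; apply/cvgrPdist_lt => e e0.
have [d [d0 hd]] := integral_normr_continuous hh e0.
have small a b : a <= b -> b - a < d -> `|V b - V a| < e.
  move=> ab bad; rewrite hV.
  have ltd : (@lebesgue_measure R `[a, b]%classic < d%:E)%E.
    rewrite lebesgue_measure_itv/= lte_fin.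
    by case: ifP => _; rewrite ?lte_fin// -EFinD lte_fin.
  have := hd `[a, b]%classic (measurable_itv _) ltd.
  apply: le_lt_trans; rewrite (Rint_indic leb `[a, b]%classic).
  apply: norm_Rint_le => [||t].
  - by apply: itg_indicM => //; exact: itg_norm.
  - by apply: measurable_funM; [exact: measurable_oitv|exact: itg_measurable hh].
  - by rewrite normrM ler_wpM2r// norm_oitv_indic.
exists d => // y /= xyd.
have [xy|/ltW yx] := leP x y.
  by rewrite distrC small//; move: xyd; rewrite distrC ger0_norm ?subr_ge0.
by rewrite small//; move: xyd; rewrite ger0_norm ?subr_ge0.
Qed.

(** Where V does not vanish it decreases at unit speed. From the last point
    before r where V is not positive it could therefore not rise to V r > 0. *)
Lemma zero_set_le0 V p r : continuous V ->
  (forall a b, a < b -> (forall x, a < x < b -> V x != 0) -> V b = V a - (b - a)) ->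
  p <= r -> V p = 0 -> V r <= 0.
Proof.
move=> cV decr pr Vp; rewrite leNgt; apply/negP => Vr.
pose A := [set t | p <= t <= r /\ V t <= 0].
have Ap : A p by split; [rewrite lexx|rewrite Vp].
have hA : has_sup A by split; [exists p|exists r => t [/andP[]]].
have pA : p <= sup A by exact: sup_upper_bound.
have Ar : sup A <= r by apply: ge_sup; [exists p|move=> t [/andP[]]].
have VA : V (sup A) <= 0.
  rewrite leNgt; apply/negP => VA.
  have : \forall x \near sup A, 0 < V x by exact: (cvgr_gt _ (cV (sup A))).
  move=> [e /= e0 he]; have [t At lt] := sup_adherent e0 hA.
  have : 0 < V t.
    apply: he; rewrite /ball_/= ger0_norm; first by rewrite ltrBlDr -ltrBlDl.
    by rewrite subr_ge0; exact: sup_upper_bound.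
  by rewrite ltNge (proj2 At).
have ltr : sup A < r.
  by rewrite lt_neqAle Ar andbT; apply: contraTneq VA => ->; rewrite -ltNge.
have := decr _ _ ltr _; rewrite -/A => e.
have : V r = V (sup A) - (r - sup A).
  apply: e => x /andP[Ax xr]; apply/eqP => Vx.
  have : x <= sup A.
    by apply: sup_upper_bound => //; split; [rewrite (le_trans pA (ltW Ax)) ltW|rewrite Vx].
  by rewrite leNgt Ax.
move=> e'; move: Vr; rewrite e' ltNge; apply/negP/negPn.
by rewrite subr_le0 (le_trans VA)// subr_ge0 ltW.
Qed.

(** To the right of a zero V is not positive, and to the left of a zero it is
    not negative, since the hypothesis is invariant under
    V(t) -> - V(- t). Between two zeros V is both. *)
Lemma zero_set_interval V : continuous V ->
  (forall a b, a < b -> (forall x, a < x < b -> V x != 0) -> V b = V a - (b - a)) ->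
  is_interval [set t | V t = 0].
Proof.
move=> cV decr p q /= Vp Vq r /andP[pr rq]; apply/eqP; rewrite eq_le.
rewrite (zero_set_le0 cV decr pr Vp) /=.
have := @zero_set_le0 (fun t => - V (- t)) (- q) (- r); rewrite !opprK oppr_le0.
apply; rewrite ?Vq ?oppr0 ?lerN2//.
  move=> x; apply: cvgN; apply: (cont_comp _ cV) => y; exact: cvgN.
move=> a b ab hV; have := decr (- b) (- a); rewrite ltrN2 => /(_ ab) ->.
  by ring.
move=> x /andP[bx xa]; have := hV (- x); rewrite !opprK oppr_eq0; apply.
by rewrite ltrNr xa ltrNl.
Qed.

(** Only a least or a greatest point of an interval can fail to be interior. *)
Lemma ae_interval_interior (I : set R) : is_interval I ->
  {ae (@lebesgue_measure R), forall t, I t -> \forall x \near t, I x}.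
Proof.
move=> iI.
have ae1 (P : R -> Prop) : (forall s t, P s -> P t -> s = t) ->
    {ae (@lebesgue_measure R), forall t, ~ P t}.
  move=> uniqP; have [[s Ps]|nP] := pselect (exists s, P s).
    by apply: ae_lebS (ae_neq s) => t /eqP ts Pt; exact/ts/uniqP.
  by apply: aeW => t Pt; apply: nP; exists t.
have hmin : {ae (@lebesgue_measure R), forall t, ~ (I t /\ forall x, I x -> t <= x)}.
  by apply: ae1 => s t [Is hs] [It ht]; apply/eqP; rewrite eq_le hs// ht.
have hmax : {ae (@lebesgue_measure R), forall t, ~ (I t /\ forall x, I x -> x <= t)}.
  by apply: ae1 => s t [Is hs] [It ht]; apply/eqP; rewrite eq_le hs// ht.
apply: ae_lebS (ae_leb2 hmin hmax) => t [nmin nmax] It.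
have [a Ia at_] : exists2 a, I a & a < t.
  apply: contrapT => h; apply: nmin; split => // x Ix.
  by rewrite leNgt; apply/negP => xt; apply: h; exists x.
have [b Ib tb] : exists2 b, I b & t < b.
  apply: contrapT => h; apply: nmax; split => // x Ix.
  by rewrite leNgt; apply/negP => xt; apply: h; exists x.
have : a < t < b by rewrite at_.
move=> /itv_near; apply: filterS => x /andP[ax xb].
by apply: (iI a b) => //; rewrite !ltW.
Qed.

End ZeroSet.

Section Defect.
Context {R : realType}.
Variables (T : R) (f : R -> R) (c : R).
Hypotheses (T0 : 0 < T) (af : forall S, adm S f).
Local Notation S := (2 * T).
Local Notation V := (fun t => W T f t - t - c).
Local Notation h := (fun t => f t * FF T t).
Hypothesis fV : {ae (@lebesgue_measure R), forall t, f t * V t = 0}.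

(** On the zero set I of the defect W(t) - t - c the increments of W are those
    of t, so f F = 1 there; off I, f vanishes. *)
Lemma defect_window : exists2 I, is_interval I &
  {ae (@lebesgue_measure R), forall t, f t = wind T I t}.
Proof.
have ih := itg_fFF T0 af.
have incW x y : W T f y - W T f x = \int[leb]_t (oitv x y t * h t).
  exact: W_increment (af S).
have cW : continuous (W T f) := continuous_of_increment ih incW.
have cV : continuous V.
  move=> x; apply: cvgB; last exact: cvg_cst.
  by apply: cvgB; [exact: cW|exact: cvg_id].
pose I := [set t | V t = 0].
have f0 : {ae (@lebesgue_measure R), forall t, ~ I t -> f t = 0}.
  apply: ae_lebS fV => t /eqP; rewrite mulf_eq0 => /orP[/eqP//|/eqP Vt nI].
  by exfalso; exact: nI.
have decr a b : a < b -> (forall x, a < x < b -> V x != 0) -> V b = V a - (b - a).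
  move=> ab hV; have : W T f b - W T f a = 0.
    rewrite incW -[RHS](Rint0 leb); apply: ae_Rint; first exact: itg_oitv.
      exact: measurable_cst.
    apply: ae_lebS (ae_leb2 f0 (ae_leb2 (ae_neq a) (ae_neq b))) => t [ft [ta tb]].
    have [tab|] := boolP (a < t < b).
      by rewrite ft ?mul0r ?mulr0// => It; have := hV t tab; rewrite It eqxx.
    rewrite negb_and -!leNgt => /orP[t1|t1].
      have t2 : t < a by rewrite lt_neqAle ta.
      by rewrite /oitv !gtr0_sg ?subr_gt0 ?(lt_trans t2 ab)// subrr mulr0 mul0r.
    have t2 : b < t by rewrite lt_neqAle eq_sym tb.
    by rewrite /oitv !ltr0_sg ?subr_lt0 ?(lt_trans ab t2)// subrr mulr0 mul0r.
  by move=> /subr0_eq ->; ring.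
have iI : is_interval I := zero_set_interval cV decr.
exists I => //.
apply: ae_lebS (ae_leb2 f0 (ae_leb2 (ae_interval_interior iI) (ae_derive_primitive ih))).
move=> t [ft [It [_ dh]]]; rewrite /wind indicE.
have [tI|tI] := boolP (t \in I); last first.
  by rewrite mul0r ft// => It'; rewrite mem_set in tI.
have Ft := FF_gt0 T0 t.
suff : h t = 1 by move=> /(canRL (mulfK (lt0r_neq0 Ft))) ->.
rewrite -dh.
pose H x := \int[leb]_(s in `]-oo, x]) h s.
have HE : \forall x \near t, H x = x + (H t - t).
  apply: filterS (It (set_mem tI)) => x Ix.
  have : H x - H t = x - t.
    rewrite Rint_oitv// -incW.
    have e1 : W T f x = x + c by apply/eqP; rewrite -subr_eq0 opprD addrA; apply/eqP.
    have e2 : W T f t = t + c.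
      by apply/eqP; rewrite -subr_eq0 opprD addrA; apply/eqP; exact: set_mem tI.
    by rewrite e1 e2; ring.
  by move=> /(canRL (subrK _)) ->; ring.
rewrite derive1E.
have : is_derive t 1 (fun x => x + (H t - t)) (1 : R).
  by apply: is_derive_eq; rewrite addr0.
by move=> /(is_derive_near HE) [_ ->].
Qed.

End Defect.

(** * Absolute convergence of the Cauchy transform for the windows 1_I / F *)

Section MeasurableInverse.
Context {R : realType}.

(** The inverse, with value 0 at 0, is the limit of x / (x^2 + 1/n). *)
Lemma measurable_inv : measurable_fun setT (fun x : R => x^-1).
Proof.
pose u (n : nat) (x : R) := x * (x ^+ 2 + n.+1%:R^-1)^-1.
have D0 n x : x ^+ 2 + n.+1%:R^-1 != 0 :> R.
  by rewrite gt_eqF// ltr_wpDl ?sqr_ge0.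
apply: (measurable_fun_cvg (h := u)) => [n|x _].
  apply: measurable_funM => //; apply: continuous_measurable_fun => x.
  apply: cvgV => //; apply: cvgD; last exact: cvg_cst.
  exact: exprn_continuous.
have [->|x0] := eqVneq x 0.
  rewrite invr0; apply: cvg_near_cst; apply: nearW => n.
  by rewrite /u mul0r.
rewrite -[X in _ --> X](_ : x * (x ^+ 2 + 0)^-1 = _); last by rewrite addr0; field.
apply: cvgM; first exact: cvg_cst.
apply: cvgV; first by rewrite addr0 sqrf_eq0.
by apply: cvgD; [exact: cvg_cst|exact: cvg_harmonic0].
Qed.

Lemma measurable_cauchyK d (Z : measurableType d) (b s : Z -> R) :
  measurable_fun setT b -> measurable_fun setT s ->
  measurable_fun setT (fun z => cauchyK (b z) (s z)).
Proof.
move=> mb' ms'; apply: measurable_funM => //; apply: (measurableT_comp measurable_inv).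
by apply: measurable_funD; exact: measurable_funX.
Qed.

End MeasurableInverse.

Section WindKernel.
Context {R : realType}.
Variables (T : R) (I : set R).
Hypotheses (T0 : 0 < T) (mI : measurable I).
Local Notation S := (2 * T).
Local Notation f := (wind T I).
Variables x y : R.
Hypothesis xT : - T < x < T.
Implicit Types (b s u v t : R).

Let B := `|x| + T.

Let BS : B < S.
Proof. by rewrite /B mulr_natl mulr2n ltrD2r ltr_norml. Qed.

Let uB u : - T <= u <= T -> `|x + u| <= B.
Proof. by move=> uT; rewrite (le_trans (ler_normD _ _))// lerD2l ler_norml. Qed.

Let C1 := \int[leb]_t wdom T B t.
Let M := wbound T B.

Let itg_w u : - T <= u <= T -> itg leb (win f (x + u)).
Proof.
move=> uT; apply: (itg_win (adm_wind T0 mI)).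
exact: le_lt_trans (uB uT) BS.
Qed.

Let w_le u t : - T <= u <= T -> `|win f (x + u) t| <= wdom T B t.
Proof. by move=> uT; exact: win_wind_le (uB uT) BS. Qed.

Let norm_w u : - T <= u <= T -> \int[leb]_t `|win f (x + u) t| <= C1.
Proof.
move=> uT; apply: Rint_le => [||t]; first exact/itg_norm/itg_w.
  exact: itg_wdom.
exact: w_le.
Qed.

Let C1_ge0 : 0 <= C1.
Proof.
by apply: Rint_ge0 => t; rewrite mulr_ge0 ?expR_ge0// ltW// wbound_gt0.
Qed.

Let energy_w_le u s : - T <= u <= T -> energy (win f (x + u)) (x + u) s <= C1 ^+ 2.
Proof.
move=> uT; rewrite (le_trans (energy_le _ _ (itg_w uT)))//.
by apply: lerXn2r; rewrite ?nnegrE ?norm_w// Rint_ge0.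
Qed.

Let itg_energy_w u : - T <= u <= T ->
  itg leb (energy (win f (x + u)) (x + u)) /\
  \int[leb]_s energy (win f (x + u)) (x + u) s <= 2 * pi * M * C1.
Proof.
move=> uT; have wM t : `|win f (x + u) t| <= M.
  by rewrite (le_trans (w_le t uT))// wdom_le.
have [h1 h2] := itg_energy (x + u) (itg_w uT) wM; split => //.
rewrite (le_trans h2)//; apply: ler_wpM2l; last exact: norm_w.
have M0 : 0 <= M by rewrite ltW// wbound_gt0.
by rewrite mulr_ge0// mulr_ge0// pi_ge0.
Qed.

Let measurable_energy_w : measurable_fun setT
  (fun p : R * R => energy (win f (x + p.1)) (x + p.1) (y - p.2)).
Proof.
pose E (p : R * R) := energy (win f (x + p.1)) (x + p.1) p.2.
have mE : measurable_fun setT E.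
  apply: (@measurable_energy R (fun q => win f (x + q.1) q.2) (fun u => x + u)); last first.
    exact: measurable_funD.
  apply: measurable_funM; last exact: (measurableT_comp (measurable_wind T0 mI) measurable_snd).
  apply: (measurableT_comp measurable_gam); apply: measurable_funB; last exact: measurable_snd.
  by apply: measurable_funD => //; exact: measurable_fst.
apply: (measurableT_comp (f := E) (g := fun p : R * R => (p.1, y - p.2)) mE).
apply/measurable_fun_pairP; split; first exact: measurable_fst.
by apply: measurable_funB => //; exact: measurable_snd.
Qed.

Let kern_bounds u s : - T <= u <= T ->
  0 <= kern f x u s <= energy (win f (x + u)) (x + u) s.
Proof.
move=> uT; rewrite /kern mulr_ge0 ?expR_ge0 ?energy_ge0//=.
by rewrite ler_piMl ?energy_ge0// -[leRHS]expR0 ler_expR oppr_le0 sqr_ge0.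
Qed.

Let measurable_kern : measurable_fun setT (fun p : R * R => kern f x p.1 (y - p.2)).
Proof.
apply: measurable_funM => //; apply: (measurableT_comp (@measurable_expR R)).
apply: (measurableT_comp (@oppr_measurable R setT)); apply: measurable_funX.
by apply: measurable_funB => //; exact: measurable_fst.
Qed.

Let mb : measurable_fun setT (fun p : R * R => x - p.1).
Proof. by apply: measurable_funB => //; exact: measurable_fst. Qed.

Let ms : measurable_fun setT (fun p : R * R => y - p.2).
Proof. by apply: measurable_funB => //; exact: measurable_snd. Qed.

Let m1T : measurable_fun setT (fun p : R * R => \1_`[- T, T] p.1 : R).
Proof. exact: (measurableT_comp _ measurable_fst). Qed.

Lemma Rint_cauchyK_le b : \int[leb]_s cauchyK `|b| s <= pi.
Proof.
have := Rint_cauchyK_cos `|b| 0; rewrite normr0 mulr0 oppr0 expR0 mulr1 => e.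
rewrite (_ : \int[leb]_s _ = pi * Num.sg `|b|).
  by rewrite ler_piMr ?pi_ge0// (le_trans (ler_norm _))// norm_sg_le1.
by rewrite -e; apply: eq_Rint => s; rewrite mul0r cos0 mulr1.
Qed.

Lemma norm_cauchyK b s : `|cauchyK b s| = cauchyK `|b| s.
Proof.
rewrite /cauchyK normrM normfV real_normK ?num_real// (@ger0_norm _ (_ + _))//.
by rewrite addr_ge0 ?sqr_ge0.
Qed.

Lemma cauchyK_ge0 b s : 0 <= cauchyK `|b| s.
Proof. by rewrite -norm_cauchyK. Qed.

Let itg_1T : itg leb (fun u : R => \1_`[- T, T] u).
Proof. exact: integrable_indic_itv. Qed.

(** The energy is bounded, and the Cauchy kernel has mass at most pi on each
    vertical line. *)
Lemma itg_re_kern : itg (@lebesgue_measure R \x @lebesgue_measure R)%E (re_kern T f x y).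
Proof.
have bound u v : `|re_kern T f x y (u, v)| <=
    \1_`[- T, T] u * (C1 ^+ 2 * cauchyK `|x - u| (y - v)).
  rewrite /re_kern /= indic_itvE; case: (boolP (- T <= u <= T)) => uT; last first.
    by rewrite !mul0r normr0.
  have /andP[k0 kE] := kern_bounds (y - v) uT.
  rewrite !mul1r normrM (ger0_norm k0) norm_cauchyK mulrC.
  apply: ler_wpM2r; first exact: cauchyK_ge0.
  by rewrite (le_trans kE)// energy_w_le.
have hK u : itg leb (fun v => \1_`[- T, T] u * (C1 ^+ 2 * cauchyK `|x - u| (y - v))).
  exact/itgZl/itgZl/(itg_reflect y (itg_cauchyK _)).
have mk : measurable_fun setT (re_kern T f x y).
  apply: measurable_funM => //; apply: measurable_funM => //.
  exact: measurable_cauchyK.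
have hs u : itg leb (fun v => re_kern T f x y (u, v)).
  apply: (itg_le (hK u)) => [|v]; last exact: bound.
  exact: (measurableT_comp mk (measurable_pair1 u)).
apply: (itg_Tonelli _ _ (itgZl (C1 ^+ 2 * pi) itg_1T)) => [|u|u];
  [exact: mk|exact: hs|].
apply: (@le_trans _ _ (\int[leb]_v (\1_`[- T, T] u * (C1 ^+ 2 * cauchyK `|x - u| (y - v))))).
  by apply: Rint_le => [||v]; [exact: itg_norm|exact: hK|exact: bound].
have i0 : 0 <= \1_`[- T, T] u :> R by rewrite indic_itvE.
have hr := itg_reflect y (itg_cauchyK `|x - u|).
rewrite RintZl; last exact: itgZl.
rewrite RintZl// (Rint_reflect y (itg_cauchyK _)) mulrC; apply: ler_wpM2r => //.
by apply: ler_wpM2l; [exact: sqr_ge0|exact: Rint_cauchyK_le].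
Qed.

(** For |s| > 1 the kernel is at most 1 and the energy is integrable in s; for
   |s| <= 1 the kernel is cauchyK |s| b, of mass at most pi in the variable b. *)
Let im_split b s E : 0 <= E <= C1 ^+ 2 ->
  `|s / (b ^+ 2 + s ^+ 2) * E| <= E + C1 ^+ 2 * (\1_`[- 1, 1] s * cauchyK `|s| b).
Proof.
move=> /andP[E0 EC]; rewrite normrM (ger0_norm E0).
have -> : `|s / (b ^+ 2 + s ^+ 2)| = cauchyK `|s| b.
  by rewrite (addrC (_ ^+ 2)) -norm_cauchyK.
rewrite indic_itvE -ler_norml; have K0 := cauchyK_ge0 s b.
have [s1|s1] := leP `|s| 1; rewrite ?mul1r ?mul0r ?mulr0 ?addr0.
  rewrite mulrC; apply: (@le_trans _ _ (C1 ^+ 2 * cauchyK `|s| b)); first exact: ler_wpM2r.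
  by rewrite lerDr.
apply: ler_piMl => //; rewrite /cauchyK ler_pdivrMr ?mul1r.
  by rewrite (@le_trans _ _ (`|s| ^+ 2))// ?lerDl ?sqr_ge0// expr2 ler_peMl// ltW.
by apply: sqrD_gt0; exact: lt_trans s1.
Qed.

(** The kernel s / (b^2 + s^2) is not integrable in s at infinity, nor near s = 0
    uniformly in b. Near s = 0 the integral over u is taken first; at infinity
    the energy is integrable by Bessel's inequality. *)
Lemma itg_im_kern : itg (@lebesgue_measure R \x @lebesgue_measure R)%E (im_kern T f x y).
Proof.
pose D1 (p : R * R) := \1_`[- T, T] p.1 * energy (win f (x + p.1)) (x + p.1) (y - p.2).
pose D2 (p : R * R) := \1_`[- 1, 1] (y - p.2) * cauchyK `|y - p.2| (x - p.1).
have mD1 : measurable_fun setT D1 by exact: measurable_funM.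
have h1 : itg (@lebesgue_measure R \x @lebesgue_measure R)%E D1.
  apply: (itg_Tonelli _ _ (itgZl (2 * pi * M * C1) itg_1T)) => [|u|u];
    [exact: mD1|rewrite /D1 /= indic_itvE..].
    case: (boolP (- T <= u <= T)) => uT; last first.
      by apply: (eq_itg (itg0 leb)) => v; rewrite mul0r.
    exact/itgZl/(itg_reflect y (itg_energy_w uT).1).
  case: (boolP (- T <= u <= T)) => uT; last first.
    rewrite mulr0 (eq_Rint leb (g := fun=> 0)) ?Rint0// => v.
    by rewrite mul0r normr0.
  rewrite mulr1 -[leLHS]/(\int[leb]_v `|1 * _|).
  have [e1 e2] := itg_energy_w uT.
  rewrite (eq_Rint leb (g := fun v => energy (win f (x + u)) (x + u) (y - v))).
    by rewrite Rint_reflect.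
  by move=> v; rewrite mul1r ger0_norm// energy_ge0.
have h2 : itg (@lebesgue_measure R \x @lebesgue_measure R)%E D2.
  pose D2' (p : R * R) := \1_`[- 1, 1] (y - p.1) * cauchyK `|y - p.1| (x - p.2).
  suff : itg (@lebesgue_measure R \x @lebesgue_measure R)%E D2' by exact: itg_swap.
  have i1 : itg leb (fun v : R => \1_`[- 1, 1] (y - v)).
    exact: (itg_reflect y (integrable_indic_itv (- 1) 1 true false)).
  have mD2 : measurable_fun setT D2'.
    have my : measurable_fun setT (fun p : R * R => y - p.1).
      by apply: measurable_funB => //; exact: measurable_fst.
    have m11 : measurable_fun setT (fun v : R => \1_`[- 1, 1] v : R).
      exact: measurable_indic.
    apply: measurable_funM; first exact: (measurableT_comp m11 my).
    apply: measurable_cauchyK; last by apply: measurable_funB => //; exact: measurable_snd.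
    exact: (measurableT_comp (@normr_measurable R setT) my).
  apply: (itg_Tonelli _ _ (itgZl pi i1)) => [|v|v]; first exact: mD2.
    exact: (eq_itg (itgZl (\1_`[- 1, 1] (y - v)) (itg_reflect x (itg_cauchyK `|y - v|)))).
  have i0 : 0 <= \1_`[- 1, 1] (y - v) :> R by rewrite indic_itvE.
  rewrite (eq_Rint leb (g := fun u => \1_`[- 1, 1] (y - v) * cauchyK `|y - v| (x - u))).
    rewrite RintZl; last exact: (itg_reflect x (itg_cauchyK `|y - v|)).
    rewrite (Rint_reflect x (itg_cauchyK _)) mulrC; apply: ler_wpM2r => //.
    exact: Rint_cauchyK_le.
  by move=> u; rewrite /D2' /= normrM (ger0_norm i0) (ger0_norm (cauchyK_ge0 _ _)).
apply: (itg_le (itgD h1 (itgZl (C1 ^+ 2) h2))) => [|p].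
  apply: measurable_funM => //; apply: measurable_funM => //.
  rewrite (_ : (fun p : R * R => _) = fun p => cauchyK (y - p.2) (x - p.1)).
    exact: measurable_cauchyK.
  by apply/funext => p; rewrite /cauchyK (addrC (_ ^+ 2)).
rewrite /im_kern /D1 /D2 indic_itvE; case: (boolP (- T <= p.1 <= T)) => uT; last first.
  by rewrite !mul0r normr0 add0r mulr_ge0 ?sqr_ge0// mulr_ge0 ?cauchyK_ge0.
have /andP[k0 kE] := kern_bounds (y - p.2) uT.
rewrite !mul1r (le_trans (im_split (x - p.1) (y - p.2) _))//.
  by rewrite k0 (le_trans kE)// energy_w_le.
by rewrite lerD2r.
Qed.

End WindKernel.

(** * The windows 1_I / F satisfy the equation, and the theorem *)

Section Positivity.
Context {R : realType}.
Implicit Types (f k : R -> R) (A : set R).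

Lemma Rint_gt0 f : itg leb f -> (forall t, 0 <= f t) ->
  ~ {ae (@lebesgue_measure R), forall t, f t = 0} -> 0 < \int[leb]_t f t.
Proof.
move=> hf f0 nf; rewrite lt_neqAle Rint_ge0// andbT eq_sym; apply/eqP => e.
have mf : measurable_fun setT (EFin \o f).
  by have /measurable_EFinP := itg_measurable hf.
have := (ae_eq_integral_abs (@lebesgue_measure R) measurableT mf).1.
have -> : (\int[leb]_x `|(EFin \o f) x|)%E = 0%E.
  rewrite -[RHS]/((0 : R)%:E) -e -EFin_Rint//.
  by apply: eq_integral => t _; rewrite /= ger0_norm.
move=> /(_ erefl) h; apply: nf; apply: ae_lebS h => t /(_ I).
by rewrite /= => -[].
Qed.

Lemma ae_notin A : measurable A -> {ae (@lebesgue_measure R), forall t, ~ A t} ->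
  @lebesgue_measure R A = 0%E.
Proof.
move=> mA h; apply: (@negligibleP _ _ _ (@lebesgue_measure R) A mA).1.
by apply: negligibleS h => t At /=; apply.
Qed.

Lemma notin_ae A : measurable A -> @lebesgue_measure R A = 0%E ->
  {ae (@lebesgue_measure R), forall t, ~ A t}.
Proof.
move=> mA /(@negligibleP _ _ _ (@lebesgue_measure R) A mA).2 h.
by apply: negligibleS h => t /= /contrapT.
Qed.

Lemma conv_ae S f k xi : adm S f -> measurable_fun setT k -> `|xi| < S ->
  {ae (@lebesgue_measure R), forall t, f t = k t} -> conv f xi = conv k xi.
Proof.
move=> af mk xiS fk; apply: ae_Rint; first exact: adm_gam af xiS.
  by apply: measurable_funM => //; exact: measurable_gamB.
by apply: ae_lebS fk => t ->.
Qed.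

Lemma wave_ae S f k a s : adm S f -> measurable_fun setT k -> `|a| < S ->
  {ae (@lebesgue_measure R), forall t, f t = k t} -> wave f a s = wave k a s.
Proof.
move=> af mk aS fk; have hw := itg_win af aS.
have mP := measurable_phase a s.
have mw : measurable_fun setT (win k a).
  by apply: measurable_funM => //; exact: measurable_gamB.
rewrite /wave; congr (_ * (_ -i* _)).
- apply: ae_Rint; first exact: itg_cosT.
    by apply: measurable_funM => //; exact: (measurableT_comp measurable_cos mP).
  by apply: ae_lebS fk => t e; rewrite /win e.
- apply: ae_Rint; first exact: itg_sinT.
    by apply: measurable_funM => //; exact: (measurableT_comp measurable_sin mP).
  by apply: ae_lebS fk => t e; rewrite /win e.
Qed.

Lemma wave0 a s : wave (fun=> 0) a s = 0 :> R[i].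
Proof.
have E (q : R -> R) : \int[leb]_t (q t * win (fun=> 0) a t) = 0 :> R.
  by rewrite -[RHS](Rint0 leb); apply: eq_Rint => t; rewrite /win !mulr0.
by rewrite /wave /cosT /sinT !E oppr0 mulr0.
Qed.

End Positivity.

Section Windowed.
Context {R : realType}.
Variable T : R.
Hypothesis T0 : 0 < T.
Local Notation S := (2 * T).
Implicit Types (I : set R) (z : R[i]) (a s t xi : R).

Lemma conv_wind_gt0 I xi : measurable I -> (0 < @lebesgue_measure R I)%E -> `|xi| < S ->
  0 < conv (wind T I) xi.
Proof.
move=> mI I0 xiS; apply: Rint_gt0 => [|t|h].
- exact: adm_gam (adm_wind T0 mI) xiS.
- by rewrite mulr_ge0 ?(ltW (gam_gt0 _))// wind_ge0.
- move: I0; rewrite (ae_notin mI) ?ltxx//.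
  apply: ae_lebS h => t /eqP; rewrite /wind !mulf_eq0 gt_eqF ?gam_gt0//=.
  rewrite invr_eq0 (gt_eqF (FF_gt0 T0 t)) orbF indicE => /eqP h1 It.
  by move: h1; rewrite mem_set// => /eqP; rewrite oner_eq0.
Qed.

Lemma itg_oitv1 (a b : R) : a <= b -> itg leb (fun t => oitv a b t * 1).
Proof.
move=> ab; apply: (itg_le (integrable_indic_itv a b true false)) => [|t].
  by apply: measurable_funM => //; exact: measurable_oitv.
by rewrite mulr1 norm_oitv_indic.
Qed.

Lemma Rint_oitv1 (a b : R) : \int[leb]_t (oitv a b t * 1) = b - a.
Proof.
wlog ab : a b / a <= b.
  move=> h; have [ab|/ltW ba] := leP a b; first exact: h.
  rewrite -opprB -(h b a ba) -RintN; last exact: itg_oitv1.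
  by apply: eq_Rint => t; rewrite oitvC mulNr.
rewrite -(Rint_FTC (f := fun=> 1) (F := id) ab).
- apply: ae_Rint; first exact: itg_oitv1.
    by apply: measurable_funM.
  apply: ae_lebS (ae_leb2 (ae_neq a) (ae_neq b)) => t [ta tb].
  rewrite indic_itvE !mulr1 /oitv; have [at_|ta'|/eqP] := ltgtP a t.
  - rewrite (ltr0_sg (x := a - t)) ?subr_lt0//=.
    have [tb'|bt|/eqP] := ltgtP t b; last by rewrite (negPf tb).
      by rewrite gtr0_sg ?subr_gt0//=; lra.
    by rewrite ltr0_sg ?subr_lt0// subrr mulr0.
  - by rewrite !gtr0_sg ?subr_gt0 ?(lt_le_trans ta' ab)// subrr mulr0.
  - by rewrite eq_sym (negPf ta).
- by move=> x; exact: cvg_cst.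
Qed.

(** Here f F = 1 on I, so that on the interval I the increments of W are those
    of t; off I the factor f vanishes. *)
Lemma wind_defect I : is_interval I -> I !=set0 ->
  exists c, forall t, wind T I t * (W T (wind T I) t - t - c) = 0.
Proof.
move=> iI [t0 It0]; have mI := is_interval_measurable iI.
exists (W T (wind T I) t0 - t0) => t; rewrite {1}/wind indicE.
have [tI|_] := boolP (t \in I); last by rewrite !mul0r.
suff : W T (wind T I) t - W T (wind T I) t0 = t - t0.
  by move=> /(canRL (subrK _)) ->; rewrite [X in _ * X](_ : _ = 0) ?mulr0//; ring.
rewrite (W_increment T0 t t0 (adm_wind T0 mI)) -(Rint_oitv1 t0 t).
apply: eq_Rint => u; rewrite /wind divfK ?(lt0r_neq0 (FF_gt0 T0 u))//.
rewrite indicE; have [//|uI] := boolP (u \in I).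
rewrite mulr0 mulr1; apply/esym.
have It := set_mem tI.
have nu : ~ I u by move=> Iu; rewrite mem_set in uI.
have out x y : I x -> I y -> x <= y -> (u < x) || (y < u).
  move=> Ix Iy xy; rewrite -implyNb -leNgt; apply/implyP => xu.
  rewrite ltNge; apply/negP => uy; apply: nu; apply: (iI x y) => //; exact/andP.
have : (u < Num.min t0 t) || (Num.max t0 t < u).
  by apply: out; [case: leP|case: leP|rewrite ge_min le_max lexx].
rewrite lt_min gt_max => /orP[]/andP[h1 h2].
  by rewrite /oitv !gtr0_sg ?subr_gt0// subrr mulr0.
by rewrite /oitv !ltr0_sg ?subr_lt0// subrr mulr0.
Qed.

Lemma F_E t : F_ T t%:C = (FF T t)%:C.
Proof.
pose f (u : R) := \1_`](- S), S[ u : R.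
have mf : measurable_fun setT f by exact: measurable_indic.
have af A : adm A f.
  split=> // B _; apply: (eq_itg (itg_indicM (measurable_itv `](- S), S[) (itg_env B))) => u.
  exact: mulrC.
have a0 A : adm A (fun=> 0 : R) by split=> // B _; apply: (eq_itg (itg0 leb)) => u; rewrite mulr0.
have ER : (fun u : R => complex.Re (\1_(`](- (2 * T)), (2 * T)[%classic) u : R[i])) = f.
  by apply/funext => u; rewrite /f !indicE; case: (_ \in _).
have EI : (fun u : R => complex.Im (\1_(`](- (2 * T)), (2 * T)[%classic) u : R[i])) = fun=> 0.
  by apply/funext => u; rewrite !indicE; case: (_ \in _).
have tS : `|t| < `|t| + 1 by rewrite ltrDl.
have := @gauss_convE R (`|t| + 1) \1_(`](- (2 * T)), (2 * T)[%classic) t 0.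
rewrite ER EI => /(_ (af _) (a0 _) tS); rewrite wave0 mulr0 addr0 => e.
transitivity (wave f t 0); first exact: e.
rewrite (wave_real (itg_win (af _) tS)); congr (_%:C).
rewrite /conv; transitivity (\int[leb]_u (\1_`[- S, S] u * gam (u - t))).
  apply: ae_Rint; first exact: adm_gam (af _) tS.
    apply: measurable_funM => //; apply: (measurableT_comp measurable_gam).
    exact: measurable_funB.
  apply: ae_lebS (ae_leb2 (ae_neq (- S)) (ae_neq S)) => u [u1 u2].
  rewrite mulrC -gamN opprB; congr (_ * _).
  rewrite indic_itvE /f indicE; congr (nat_of_bool _)%:R.
  rewrite mem_setE in_itv/= !lt_neqAle u2 eq_sym u1 //.
have SS : - S <= S by rewrite (@le_trans _ _ 0)// ?oppr_le0 mulr_ge0// ltW.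
have cg : continuous (fun u => gam (u - t)).
  apply: (cont_comp _ (@continuous_gam R)).
  by apply: derivable_cont => u; exact: ex_derive.
have dG (u : R) : is_derive u 1 (fun u : R => GG (u - t)) (gam (u - t)).
  have h : is_derive u 1 (fun u : R => u - t) (1 : R) by apply: is_derive_eq; ring.
  have := is_derive1_comp (f := @GG R) (g := fun u => u - t).
  by move=> /(_ u _ _ (is_derive_GG (u - t)) h); rewrite mulr1.
exact: (Rint_FTC SS cg dG).
Qed.

Lemma H_E I a s : measurable I -> `|a| < S -> H_ I T (a +i* s) = wave (wind T I) a s.
Proof.
move=> mI aS; rewrite /H_.
have E t : \1_I t / F_ T t%:C = (wind T I t)%:C :> R[i].
  rewrite F_E -fmorphV [\1_I t](_ : _ = (\1_I t : R)%:C) ?realcM//.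
  by rewrite !indicE; case: (_ \in _).
have ER : (fun t : R => complex.Re (\1_I t / F_ T t%:C : R[i])) = wind T I.
  by apply/funext => t; rewrite E.
have EI : (fun t : R => complex.Im (\1_I t / F_ T t%:C : R[i])) = fun=> 0.
  by apply/funext => t; rewrite E.
have a0 : adm S (fun=> 0 : R) by split=> // B _; apply: (eq_itg (itg0 leb)) => u; rewrite mulr0.
have := @gauss_convE R S (fun t => \1_I t / F_ T t%:C) a s.
by rewrite ER EI => /(_ (adm_wind T0 mI) a0 aS) ->; rewrite wave0 mulr0 addr0.
Qed.

End Windowed.

Theorem theorem6 (R : realType) (T : R) (Phi : R[i] -> R[i]) :
  0 < T -> error_function_type Phi ->
  (hard_edge_ward T Phi <->
   exists I : set R,
     [/\ is_interval I,
         (0 < @lebesgue_measure R I)%E &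
         forall z : R[i], - (2 * T) < Re z < 2 * T -> Phi z = H_ I T z]).
Proof.
move=> T0 [phi [mr mi md PhiE0]].
have S0 : 0 < 2 * T by rewrite mulr_gt0.
split=> [[pos ward]|[I [iI I0 PhiH]]].
- pose fr t := complex.Re (phi t); pose fi t := complex.Im (phi t).
  have ar S : adm S fr := (adm_moderate S mr mi md).1.
  have ai S : adm S fi := (adm_moderate S mr mi md).2.
  have Phi1 a s : Phi (a +i* s) = wave fr a s + 'i * wave fi a s.
    rewrite PhiE0; apply: (@gauss_convE R (`|a| + 1)); [exact: ar|exact: ai|].
    by rewrite ltrDl.
  (* R at the point xi / 2 is the Gaussian convolution of phi at xi. *)
  have onep xi : `|xi| < 2 * T -> 0 < (conv fr xi +i* conv fi xi : R[i]).
    move=> xiS; have zT : Int_strip T ((xi / 2) +i* 0).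
      by move: xiS; rewrite /Int_strip /= ltr_norml => /andP[h1 h2]; apply/andP; split; lra.
    have := pos _ zT; rewrite /one_point mem_strip ?mulr1; last exact: Int_stripW.
    have -> : ((xi / 2) +i* 0) + ((xi / 2) +i* 0)^* = xi +i* 0 :> R[i].
      by rewrite addcE; apply: eqcP; [field|rewrite subrr].
    rewrite Phi1 (wave_real (itg_win (ar _) xiS)) (wave_real (itg_win (ai _) xiS)).
    by rewrite mulcE addcE !mul0r !mul1r !subr0 ?add0r ?addr0.
  have fi0 : {ae (@lebesgue_measure R), forall t, fi t = 0}.
    apply: (conv_uniq ai S0) => xi xiS.
    by have := onep xi xiS; rewrite ltcE /= => /andP[/eqP].
  have P0 xi : `|xi| < 2 * T -> 0 < conv fr xi.
    by move=> xiS; have := onep xi xiS; rewrite ltcE /= => /andP[].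
  have PhiE a s : `|a| < 2 * T -> Phi (a +i* s) = wave fr a s.
    move=> aS; rewrite Phi1 (wave_ae s (ai _) _ aS fi0)//.
    by rewrite wave0 mulr0 addr0.
  have dAI z : Int_strip T z -> dA_integrable (strip T) (fun w => berezin T Phi z w / (z - w)).
    by move=> zT; have [] := ward z zT.
  have [c hc] : exists c, forall xi, `|xi| < 2 * T ->
      conv (fun t => fr t * (W T fr t - t - c)) xi = 0.
    apply/(ward_defect T0 (ar _) P0) => xi xiS.
    have zT : Int_strip T ((xi / 2) +i* 0).
      by move: xiS; rewrite /Int_strip /= ltr_norml => /andP[h1 h2]; apply/andP; split; lra.
    have [_ _ e] := ward _ zT.
    have [_ [he _]] := ward_equation T0 (ar _) PhiE P0 dAI zT.
    have e2 : 2 * (xi / 2) = xi by field.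
    by have := he e; rewrite /= e2.
  have [C hC] := norm_W_le T0 ar.
  (* W is bounded, so the window of the defect is of the same class. *)
  have aV S : adm S (fun t => fr t * (W T fr t - t - c)).
    have aW := adm_bounded (ar S) (measurable_W (ar _)) hC.
    have h := admD aW (admD (admZ (-1) (adm_mulX (ar S))) (admZ (- c) (ar S))).
    by move: h; congr adm; apply/funext => t; ring.
  have fV := conv_uniq aV S0 hc.
  have [I iI fI] := defect_window T0 ar fV.
  have mI := is_interval_measurable iI.
  exists I; split => //.
  (* A null set I would give P = 0. *)
  + rewrite lt0e measure_ge0 andbT; apply/eqP => I0.
    have z0 : `|0 : R| < 2 * T by rewrite normr0.
    have := P0 0 z0; rewrite (@conv_ae R _ fr (fun=> 0) 0 (ar _) _ z0)//.
      rewrite /conv (eq_Rint leb (g := fun=> 0)) ?Rint0 ?ltxx// => t.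
      exact: mulr0.
    apply: ae_lebS (ae_leb2 fI (notin_ae mI I0)) => t [-> nI].
    by rewrite /wind indicE memNset// mul0r.
  + case=> a s /=; rewrite -ltr_norml => aS.
    rewrite (H_E T0 s mI aS) PhiE//.
    exact: (wave_ae s (ar _) (measurable_wind T0 mI) aS fI).
- have mI := is_interval_measurable iI.
  have aw := adm_wind T0 mI.
  have PhiE a s : `|a| < 2 * T -> Phi (a +i* s) = wave (wind T I) a s.
    by move=> aS; rewrite PhiH -?(H_E T0 s mI aS)//= -ltr_norml.
  have P0 xi : `|xi| < 2 * T -> 0 < conv (wind T I) xi by exact: conv_wind_gt0.
  have dAI z : Int_strip T z -> dA_integrable (strip T) (fun w => berezin T Phi z w / (z - w)).
    move=> zT; apply/(dA_integrableE aw PhiE zT); first exact: lt0r_neq0 (P0 _ (norm2 zT)).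
    by split; [exact: itg_re_kern|exact: itg_im_kern].
  have [c hc] : exists c, forall t, wind T I t * (W T (wind T I) t - t - c) = 0.
    apply: wind_defect => //; apply/set0P; apply: contraTN I0 => /eqP ->.
    by rewrite measure0 ltxx.
  have defect0 : forall xi, `|xi| < 2 * T -> dQP T (wind T I) xi = dNP (wind T I) xi.
    apply/(ward_defect T0 aw P0); exists c => xi _.
    rewrite /conv (eq_Rint leb (g := fun=> 0)) ?Rint0// => t.
    by rewrite hc mulr0.
  split=> z zT; first by rewrite (one_pointE aw PhiE)// ltcR P0// norm2.
  have [hp he] := ward_equation T0 aw PhiE P0 dAI zT.
  by split=> //; [exact: dAI|apply/he/defect0/norm2].
Qed.
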